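(* Let $\psi:\mathbb{D}\to\mathbb{D}$ be an analytic function. Then \[\limsup_{|a|\rightarrow 1^{-}}\int_{\mathbb{T}}\frac{1 - |a|^2}{|1 - \bar{a}\psi(\zeta)|^2}\,dm(\zeta)\] (where $a$ ranges over $\mathbb{D}$) is equal to the square of the essential norm of the composition operator $C_{\psi}$ on $H^2$.
   Context: $\mathbb{D}=\{z\in\mathbb{C}:|z|<1\}$ and $\mathbb{T}=\{z\in\mathbb{C}:|z|=1\}$; $m$ is normalized Lebesgue measure on $\mathbb{T}$ (so $m(\mathbb{T})=1$). An analytic $\psi:\mathbb{D}\to\mathbb{D}$ has nontangential boundary values at $m$-almost every point of $\mathbb{T}$; this boundary function is also denoted $\psi$. $H^2=H^2(\mathbb{D})$ is the Hardy space of analytic functions on $\mathbb{D}$, with $\|f\|_{H^2}^2=\int_{\mathbb{T}}|f|^2\,dm$ (boundary values of $f$). The composition operator $C_\psi: H^2\to H^2$, $C_\psi(f)=f\circ\psi$, is bounded (Littlewood Subordination Principle). The essential norm of a bounded operator on $H^2$ is its distance, in operator norm, to the set of compact operators on $H^2$. *)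

(* Defs.v *)
From HB Require Import structures.
From mathcomp Require Import all_boot all_order all_algebra.
From mathcomp Require Import complex.
From mathcomp Require Import all_classical all_reals all_analysis.
Set Implicit Arguments.
Unset Strict Implicit.
Unset Printing Implicit Defensive.
Import Order.TTheory GRing.Theory Num.Theory.
Import numFieldNormedType.Exports.
Import ComplexField.Normc.

Local Open Scope classical_set_scope.
Local Open Scope complex_scope.
Local Open Scope ring_scope.

(* MathComp-Analysis puts the norm topology on R[i]^o only; these instances
   make it available on R[i] itself.  Throughout, the modulus of z is taken as
   the real number normc z, since `|z| lives in R[i]. *)
HB.instance Definition _ (R : rcfType) := PseudoPointedMetric.copy R[i] R[i]^o.
HB.instance Definition _ (R : rcfType) := NormedModule.copy R[i] R[i]^o.

Section composition_operators.
Variable R : realType.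
Local Notation C := R[i].

Definition disc : set C := [set z | normc z < 1].

Definition analytic_on (D : set C) (f : C -> C) : Prop :=
  forall z, D z -> derivable f z 1.

Definition cis (t : R) : C := cos t +i* sin t.

(* The integral of g against normalized arc length on the unit circle. *)
Definition circle_integral (g : C -> \bar R) : \bar R :=
  ((2 * pi)^-1%:E *
   \int[@lebesgue_measure R]_(t in `[0%R, (2 * pi)%R]) g (cis t))%E.

(* Nontangential approach region at the boundary point zeta, of aperture M. *)
Definition stolz_region (zeta : C) (M : R) : set C :=
  [set z | disc z /\ normc (z - zeta) < M * (1 - normc z)].

Definition nontangential_limit (f : C -> C) (zeta l : C) : Prop :=
  forall M : R, 1 < M -> f @ within (stolz_region zeta M) (nbhs zeta) --> l.

(* The nontangential boundary function; its value is 0 by convention at the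
   points where f has no nontangential limit. *)
Definition boundary (f : C -> C) (zeta : C) : C :=
  xget 0 [set l | nontangential_limit f zeta l].

(* A function on the disc is represented by its extension by 0 to the plane,
   so that equality of representatives is equality on the disc. *)
Definition hardy2 : set (C -> C) :=
  [set f | [/\ analytic_on disc f,
     forall z, ~ disc z -> f z = 0 &
     (ereal_sup [set circle_integral
                       (fun zeta => (normc (f (r%:C * zeta)) ^+ 2)%:E)
                | r in `[0%R, 1%R[] < +oo)%E]].

Definition hardy2_norm (f : C -> C) : \bar R :=
  sqrte (circle_integral (fun zeta => (normc (boundary f zeta) ^+ 2)%:E)).

Definition composition_operator (psi f : C -> C) : C -> C :=
  patch (fun=> 0) disc (f \o psi).

Definition operator_norm (T : (C -> C) -> (C -> C)) : \bar R :=
  ereal_sup [set hardy2_norm (T f) |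
             f in [set f | hardy2 f /\ (hardy2_norm f <= 1)%E]].

(* Only the values of an operator on hardy2 matter.  Compactness is sequential:
   the image of a sequence in the unit ball has a norm-convergent
   subsequence. *)
Definition compact_operator (K : (C -> C) -> (C -> C)) : Prop :=
  [/\ forall f, hardy2 f -> hardy2 (K f),
      forall (c : C) f g, hardy2 f -> hardy2 g ->
        K (fun z => c * f z + g z) = (fun z => c * K f z + K g z) &
      forall u : nat -> C -> C,
        (forall n, hardy2 (u n) /\ (hardy2_norm (u n) <= 1)%E) ->
        exists (k : nat -> nat) (g : C -> C),
          [/\ {homo k : m n / (m < n)%N}, hardy2 g &
              hardy2_norm (fun z => K (u (k n)) z - g z) @[n --> \oo]
                --> 0%E]].

Definition essential_norm (T : (C -> C) -> (C -> C)) : \bar R :=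
  ereal_inf [set operator_norm (fun f z => T f z - K f z) |
             K in compact_operator].

(* The filter |a| -> 1^-, a being in the disc. *)
Definition disc_to_circle : set_system C :=
  [set A | \forall r \near (1 : R)^'-, forall a, normc a = r -> A a].

End composition_operators.
Arguments disc {R}.
Arguments disc_to_circle {R}.

(* Main.v *)
Require Import Defs.
From mathcomp Require Import all_boot all_order all_algebra.
From mathcomp Require Import complex.
From mathcomp Require Import all_classical all_reals all_analysis.
From mathcomp Require Import measurable_realfun ring lra.
Import Order.TTheory GRing.Theory Num.Theory.
Import numFieldNormedType.Exports.
Import ComplexField.Normc.

Local Open Scope classical_set_scope.
Local Open Scope complex_scope.
Local Open Scope ring_scope.
Set Implicit Arguments.
Unset Strict Implicit.
Unset Printing Implicit Defensive.

(** The proof tests C_psi on the normalized reproducing kernels of the Hardy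
    space,
      ker a z = sqrt (1 - |a|^2) / (1 - conj a * z).
    Since ker a is continuous on the closed disc, the integral in the theorem is
    the squared norm of C_psi (ker a) (kernel_integral).  The claim is therefore
    that the essential norm of C_psi is the upper limit of the norms of
    C_psi (ker a) as |a| tends to 1.

    Lower bound (essential_lower).  Let K be compact.  If K (ker a) did not tend
    to 0, it would converge to some g other than 0 along a sequence of points a
    tending to the circle.  The inner product of f with ker a is
    sqrt (1 - |a|^2) * f a, which tends to 0 when f is bounded; hence N kernels
    of the sequence can be chosen whose sum has squared norm at most 2 N, while
    the image of the sum under K is close to N g (kernel_sums).  As K is bounded,
    this forces g = 0 (kernel_limit_small).  So K (ker a) tends to 0, and the
    norm of C_psi - K is at least the upper limit.

    Upper bound (essential_upper).  Composing psi with the n-th Taylor polynomial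
    of f is an operator of finite rank, so C_psi has to be bounded on the Taylor
    tails g = f - psum f n.  The value |g w|^2 is at most the Poisson integral of
    |g|^2 (poisson_bound).  For s < 1 fixed, put
      V (w, zeta) = s^2 (1 - |w|^2) / |1 - conj w * s * zeta|^2.
    When n is large, the Poisson kernel P may be replaced by P - V up to a small
    error (tail_pointwise): V is negligible for w near the circle, and g w is
    negligible for the other w.  The point of this is the identity
      V (w, zeta) = P (s w, zeta) - |ker (s zeta) w|^2,
    because, averaged over w = psi z on a circle |z| = t, the difference P - V
    gives by the mean value property
      P (psi 0, zeta) - P (s psi 0, zeta) + the mean of |ker (s zeta) o psi|^2.
    The first two terms cancel in the limit where s tends to 1, and the last one
    is at most the integral of the theorem at a = s zeta (tail_composition).

    The theory of the Hardy space that this uses is built from Goursat's theorem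
    on polar rectangles: it yields the Cauchy formula, the Taylor series and
    Parseval's identity, so that the squared norm becomes the sum hsq of the
    squared coefficients.  Fatou's theorem on nontangential limits
    (nontangential_exists) follows from the Hardy-Littlewood maximal inequality,
    and hardy_integral identifies hsq with the integral of the squared modulus
    of the boundary values. *)

(** * The modulus and continuity in coordinates *)
Section complex_basics.
Variable R : realType.
Local Notation C := R[i].
Local Notation cRe := (@complex.Re R).
Local Notation cIm := (@complex.Im R).

Lemma normcR (z : C) : `|z| = (normc z)%:C.
Proof. by []. Qed.

Lemma normc_ge0 (z : C) : 0 <= normc z.
Proof. by case: z => a b; rewrite /= sqrtr_ge0. Qed.

Lemma normc_sqr (z : C) : normc z ^+ 2 = cRe z ^+ 2 + cIm z ^+ 2.
Proof. by case: z => a b; rewrite /= sqr_sqrtr// addr_ge0// sqr_ge0. Qed.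

Lemma normc_sqrD (x y : C) :
  normc (x + y) ^+ 2 = normc x ^+ 2 + normc y ^+ 2 + 2 * cRe (conjc x * y).
Proof. rewrite !normc_sqr; case: x => a b; case: y => c d /=; ring. Qed.

Lemma normc_conj (z : C) : normc (conjc z) = normc z.
Proof. by case: z => a b; rewrite /= sqrrN. Qed.

Lemma normc_realE (x : R) : normc x%:C = `|x|.
Proof. by rewrite /= expr0n /= addr0 sqrtr_sqr. Qed.

Lemma normc_real (x : R) : 0 <= x -> normc x%:C = x.
Proof. by move=> x0; rewrite normc_realE ger0_norm. Qed.

Lemma normc_nat n : normc (n%:R : C) = n%:R.
Proof.
by rewrite -(_ : (n%:R : R)%:C = n%:R) ?normc_real ?ler0n// rmorph_nat.
Qed.

Lemma normcX (z : C) n : normc (z ^+ n) = normc z ^+ n.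
Proof.
elim: n => [|n IH]; first by rewrite !expr0 normc1.
by rewrite !exprS normcM IH.
Qed.

Lemma normcB (x y : C) : normc (x - y) = normc (y - x).
Proof. by rewrite -normcN opprB. Qed.

Lemma le_normcB (x y : C) : normc (x - y) <= normc x + normc y.
Proof. by rewrite (le_trans (le_normcD _ _))// normcN. Qed.

Lemma ge_normcB (x y : C) : normc x - normc y <= normc (x - y).
Proof. by rewrite lerBlDr (le_trans _ (le_normcD _ _))// subrK. Qed.

Lemma normc_sum n (F : nat -> C) :
  normc (\sum_(0 <= k < n) F k) <= \sum_(0 <= k < n) normc (F k).
Proof.
elim: n => [|n IH]; first by rewrite !big_nil normc0.
by rewrite !big_nat_recr//= (le_trans (le_normcD _ _))// lerD2r.
Qed.

Lemma normc_eq0 (z : C) : (normc z == 0) = (z == 0).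
Proof.
apply/eqP/eqP => [/eq0_normc//|->]; exact: normc0.
Qed.

Lemma normc_gt0 (z : C) : (0 < normc z) = (z != 0).
Proof. by rewrite lt_neqAle eq_sym normc_eq0 normc_ge0 andbT. Qed.

Lemma abs_Re_le (z : C) : `|cRe z| <= normc z.
Proof.
rewrite -(ler_pXn2r (n := 2))// ?nnegrE ?normc_ge0// normc_sqr real_normK ?num_real//.
by rewrite lerDl sqr_ge0.
Qed.

Lemma abs_Im_le (z : C) : `|cIm z| <= normc z.
Proof.
rewrite -(ler_pXn2r (n := 2))// ?nnegrE ?normc_ge0// normc_sqr real_normK ?num_real//.
by rewrite lerDr sqr_ge0.
Qed.

Lemma Re_le_normc (z : C) : cRe z <= normc z.
Proof. exact: le_trans (ler_norm _) (abs_Re_le _). Qed.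

Lemma normc_le_ReIm (z : C) : normc z <= `|cRe z| + `|cIm z|.
Proof.
rewrite -(ler_pXn2r (n := 2))// ?nnegrE ?normc_ge0 ?addr_ge0// normc_sqr.
rewrite sqrrD !real_normK ?num_real// -addrA lerD2l addrC -{1}[X in X <= _]addr0 lerD2l.
by rewrite mulrn_wge0// mulr_ge0.
Qed.

Lemma mulc_conj (z : C) : z * conjc z = (normc z ^+ 2)%:C.
Proof. by rewrite normc_sqr; case: z => a b; congr (_ +i* _) => /=; ring. Qed.

Lemma ReD (x y : C) : cRe (x + y) = cRe x + cRe y.
Proof. by case: x; case: y. Qed.
Lemma ImD (x y : C) : cIm (x + y) = cIm x + cIm y.
Proof. by case: x; case: y. Qed.
Lemma ReN (x : C) : cRe (- x) = - cRe x.
Proof. by case: x. Qed.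
Lemma ImN (x : C) : cIm (- x) = - cIm x.
Proof. by case: x. Qed.
Lemma ReM (x y : C) : cRe (x * y) = cRe x * cRe y - cIm x * cIm y.
Proof. by case: x; case: y. Qed.
Lemma ImM (x y : C) : cIm (x * y) = cRe x * cIm y + cIm x * cRe y.
Proof. by case: x; case: y. Qed.
Lemma eq_ReIm (x y : C) : cRe x = cRe y -> cIm x = cIm y -> x = y.
Proof. by case: x => a b; case: y => c d /= -> ->. Qed.

(** The cross term is absorbed by the arithmetic-geometric mean inequality; the
    free parameter e is what lets the Minkowski inequality be recovered later. *)
Lemma sqr_normcD_le (e : R) (x y : C) : 0 < e ->
  normc (x + y) ^+ 2 <= (1 + e) * normc x ^+ 2 + (1 + e^-1) * normc y ^+ 2.
Proof.
move=> e0; rewrite normc_sqrD.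
have h : cRe (conjc x * y) <= normc x * normc y.
  by rewrite (le_trans (Re_le_normc _))// normcM normc_conj.
have : 0 <= e^-1 * (e * normc x - normc y) ^+ 2.
  by rewrite mulr_ge0 ?sqr_ge0// invr_ge0 ltW.
have -> : e^-1 * (e * normc x - normc y) ^+ 2 =
    e * normc x ^+ 2 - 2 * (normc x * normc y) + e^-1 * normc y ^+ 2.
  by field; rewrite gt_eqF.
move: h; lra.
Qed.

(** * Topology of the plane in terms of the modulus *)

(** The norm of R[i] takes values in R[i] itself; this and the next lemmas
    restate neighborhoods and limits with the real number normc. *)
Lemma nbhs_normcP (z : C) (A : set C) :
  nbhs z A <-> exists2 e : R, 0 < e & forall w, normc (w - z) < e -> A w.
Proof.
split.
  move=> /nbhs_ballP[e e0 H].
  have [er ei] : 0 < cRe e /\ cIm e == 0 by move: e0; rewrite /= ltcE /= => /andP[].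
  exists (cRe e) => // w wz; apply: H.
  by rewrite -ball_normE /= distrC normcR ltcE /= wz andbT.
move=> [e e0 H]; apply/nbhs_ballP; exists (e%:C) => /=.
  by rewrite ltcE /= eqxx.
move=> w; rewrite -ball_normE /= distrC normcR ltcE /= eqxx /=; exact: H.
Qed.

Lemma cvg_normcP (T : Type) (F : set_system T) {FF : Filter F} (f : T -> C) (l : C) :
  (f @ F --> l) <->
  (forall e : R, 0 < e -> \forall x \near F, normc (f x - l) < e).
Proof.
split => [H e e0|H].
  have /H : nbhs l [set w | normc (w - l) < e] by apply/nbhs_normcP; exists e.
  by [].
by move=> A /nbhs_normcP[e e0 HA]; apply: filterS (H e e0) => x /HA.
Qed.

Lemma continuous_Re (T : topologicalType) (F : T -> C) x :
  {for x, continuous F} -> {for x, continuous (fun t => cRe (F t))}.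
Proof.
move=> /cvg_normcP cF; apply/cvgrPdist_lt => e e0.
apply: filterS (cF e e0) => y; apply: le_lt_trans.
by rewrite -ReN -ReD (le_trans (abs_Re_le _))// normcB.
Qed.

Lemma continuous_Im (T : topologicalType) (F : T -> C) x :
  {for x, continuous F} -> {for x, continuous (fun t => cIm (F t))}.
Proof.
move=> /cvg_normcP cF; apply/cvgrPdist_lt => e e0.
apply: filterS (cF e e0) => y; apply: le_lt_trans.
by rewrite -ImN -ImD (le_trans (abs_Im_le _))// normcB.
Qed.

Lemma continuous_ReIm (T : topologicalType) (F : T -> C) x :
  {for x, continuous (fun t => cRe (F t))} ->
  {for x, continuous (fun t => cIm (F t))} -> {for x, continuous F}.
Proof.
move=> /cvgrPdist_lt cR /cvgrPdist_lt cI; apply/cvg_normcP => e e0.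
have e20 : 0 < e / 2 by rewrite divr_gt0.
near=> y.
rewrite (le_lt_trans (normc_le_ReIm _))// ReD ImD ReN ImN (splitr e) ltrD// distrC.
- by near: y; exact: cR.
- by near: y; exact: cI.
Unshelve. all: by end_near. Qed.

Lemma cvg_normc (T : Type) (F : set_system T) {FF : Filter F} (f : T -> C) (l : C) :
  f @ F --> l -> (fun x => normc (f x)) @ F --> normc l.
Proof.
move=> /cvg_normcP cF; apply/cvgrPdist_lt => e e0.
apply: filterS (cF e e0) => y; apply: le_lt_trans.
rewrite ler_norml; apply/andP; split; last by rewrite normcB ge_normcB.
by rewrite lerNl opprB ge_normcB.
Qed.

Lemma continuous_normc (T : topologicalType) (F : T -> C) x :
  {for x, continuous F} -> {for x, continuous (fun t => normc (F t))}.
Proof. exact: cvg_normc. Qed.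

Lemma continuous_normc2 (T : topologicalType) (F : T -> C) x :
  {for x, continuous F} -> {for x, continuous (fun t => normc (F t) ^+ 2)}.
Proof. by move=> /continuous_normc h; rewrite /continuous_at; apply: cvgM; exact: h. Qed.

Lemma continuous_normcP (F : C -> C) (z : C) :
  {for z, continuous F} <-> forall e : R, 0 < e -> exists2 d : R, 0 < d &
    forall w, normc (w - z) < d -> normc (F w - F z) < e.
Proof.
have H := @cvg_normcP C (nbhs z) (@nbhs_filter C z) F (F z).
split => [/H h e /h /nbhs_normcP//|h].
by apply/H => e /h h'; apply/nbhs_normcP.
Qed.

Lemma continuous_const (k z : C) : {for z, continuous (fun _ : C => k)}.
Proof. by apply/continuous_normcP => e e0; exists 1 => // w; rewrite subrr normc0. Qed.

Lemma continuous_ident (z : C) : {for z, continuous (fun x : C => x)}.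
Proof. by apply/continuous_normcP => e e0; exists e. Qed.

Lemma continuous_mulc (T : topologicalType) (F G : T -> C) x :
  {for x, continuous F} -> {for x, continuous G} ->
  {for x, continuous (fun t => F t * G t)}.
Proof. by move=> cF cG; exact: (@cvgM C T (nbhs x) _ F G (F x) (G x) cF cG). Qed.

Lemma continuous_addc (T : topologicalType) (F G : T -> C) x :
  {for x, continuous F} -> {for x, continuous G} ->
  {for x, continuous (fun t => F t + G t)}.
Proof. by move=> cF cG; exact: (@cvgD C C T (nbhs x) _ F G (F x) (G x) cF cG). Qed.

Lemma continuous_cplx (x : R) : {for x, continuous (fun r : R => r%:C)}.
Proof. by apply: continuous_ReIm => /=; [exact: cvg_id|exact: cvg_cst]. Qed.

Lemma continuous_cis (x : R) : {for x, continuous (@cis R)}.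
Proof. by apply: continuous_ReIm => /=; [exact: continuous_cos|exact: continuous_sin]. Qed.

Lemma normc_cis (t : R) : normc (cis t) = 1.
Proof.
apply/eqP; rewrite -(@eqrXn2 _ 2)// ?normc_ge0//.
by rewrite normc_sqr /= expr1n cos2Dsin2.
Qed.

Lemma cisD (s t : R) : cis (s + t) = cis s * cis t.
Proof. by apply: eq_ReIm; rewrite ?ReM ?ImM /= ?cosD ?sinD// addrC [X in _ + X]mulrC mulrC. Qed.

Lemma cis_conj (t : R) : conjc (cis t) = (cis t)^-1.
Proof.
have c0 : cis t != 0 by rewrite -normc_gt0 normc_cis ltr01.
by apply: (mulfI c0); rewrite mulc_conj normc_cis expr1n divff.
Qed.

Lemma cis_neq0 (t : R) : cis t != 0.
Proof. by rewrite -normc_gt0 normc_cis ltr01. Qed.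

Lemma cis2pi : cis (2 * pi) = 1 :> C.
Proof. by rewrite /cis mulrC mulr_natr cos2pi sin2pi. Qed.

Lemma cisDpi2 (t : R) : cis (t + 2 * pi) = cis t.
Proof. by rewrite cisD cis2pi mulr1. Qed.

Lemma analytic_continuous (f : C -> C) (z : C) :
  derivable f z 1 -> {for z, continuous f}.
Proof.
by move=> df; apply: differentiable_continuous; exact/derivable1_diffP.
Qed.

Lemma derivable_chain (f g : C -> C) z :
  derivable f z 1 -> derivable g (f z) 1 -> derivable (fun x => g (f x)) z 1.
Proof.
move=> /derivable1_diffP df /derivable1_diffP dg.
by apply/derivable1_diffP; exact: (differentiable_comp df dg).
Qed.

End complex_basics.
Arguments continuous_const {R} k z.
Arguments continuous_ident {R} z.

(** * Integrals of continuous real and complex functions over segments *)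
Section segment_integrals.
Variable R : realType.
Local Notation C := R[i].
Local Notation cRe := (@complex.Re R).
Local Notation cIm := (@complex.Im R).
Local Notation mu := (@lebesgue_measure R).

Definition cts (T : topologicalType) (a b : R) (F : R -> T) :=
  forall x, a <= x <= b -> {for x, continuous F}.

Definition rint (a b : R) (g : R -> R) : R := \int[mu]_(t in `[a, b]) g t.

Definition cint (a b : R) (F : R -> C) : C :=
  rint a b (fun t => cRe (F t)) +i* rint a b (fun t => cIm (F t)).

Implicit Types (a b c : R) (g h : R -> R) (F G : R -> C).

Lemma cts_integrable a b g :
  cts a b g -> mu.-integrable `[a, b] (EFin \o g).
Proof.
move=> cg; apply: continuous_compact_integrable; first exact: segment_compact.
by apply: continuous_in_subspaceT => x; rewrite inE /= in_itv /=; exact: cg.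
Qed.

Lemma mitv a b : measurable (`[a, b]%classic : set R).
Proof. exact: measurable_itv. Qed.

Lemma rintD a b g h : cts a b g -> cts a b h ->
  rint a b (fun t => g t + h t) = rint a b g + rint a b h.
Proof. by move=> cg ch; apply: RintegralD => //; exact: cts_integrable. Qed.

Lemma rintB a b g h : cts a b g -> cts a b h ->
  rint a b (fun t => g t - h t) = rint a b g - rint a b h.
Proof. by move=> cg ch; apply: RintegralB => //; exact: cts_integrable. Qed.

Lemma rintZ a b k g : cts a b g ->
  rint a b (fun t => k * g t) = k * rint a b g.
Proof. by move=> cg; apply: RintegralZl => //; exact: cts_integrable. Qed.

Lemma rint_cst a b k : a <= b -> rint a b (fun=> k) = k * (b - a).
Proof.
move=> ab; rewrite /rint Rintegral_cst//=.
by rewrite lebesgue_measure_itv /= lte_fin; case: ltgtP ab => // ->; rewrite subrr.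
Qed.

Lemma le_rint a b g h : cts a b g -> cts a b h ->
  (forall t, a <= t <= b -> g t <= h t) -> rint a b g <= rint a b h.
Proof.
move=> cg ch gh; apply: le_Rintegral; [by []|exact: (cts_integrable cg)|exact: (cts_integrable ch)|].
by move=> t /=; rewrite in_itv; exact: gh.
Qed.

Lemma eq_rint a b g h : (forall t, a <= t <= b -> g t = h t) ->
  rint a b g = rint a b h.
Proof. by move=> gh; apply: eq_Rintegral => t; rewrite inE /= in_itv; exact: gh. Qed.

Lemma rint_split a b c g : a <= c -> c <= b -> cts a b g ->
  rint a b g = rint a c g + rint c b g.
Proof.
move=> ac cb cg.
have ig := cts_integrable cg.
have := @Rintegral_itvB _ g (BLeft a) (BRight b) c ig.
rewrite !bnd_simp => /(_ ac cb) H.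
rewrite /rint -[X in _ = _ + X]Rintegral_itv_obnd_cbnd; last first.
  apply: integrableS ig => //; apply: subset_itv; rewrite ?bnd_simp//.
by rewrite -H addrC subrK.
Qed.

Lemma rint_FTC a b g h : a <= b -> cts a b g ->
  (forall x : R, is_derive x (1 : R) h (g x)) -> rint a b g = h b - h a.
Proof.
rewrite le_eqVlt => /predU1P[<- _ _|ab cg dh].
  by rewrite /rint set_itv1 Rintegral_set1 subrr.
have ch x : {for x, continuous h}.
  apply: differentiable_continuous; apply/derivable1_diffP.
  by case: (dh x).
rewrite /rint /Rintegral (@continuous_FTC2 _ g h a b)//.
- by apply: continuous_in_subspaceT => x; rewrite inE /= in_itv /=; exact: cg.
- split.
  + by move=> x _; case: (dh x).
  + by apply: cvg_at_right_filter; exact: ch.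
  + by apply: cvg_at_left_filter; exact: ch.
- by move=> x _; rewrite derive1E; case: (dh x).
Qed.

Lemma rint_bound a b g k : a <= b -> cts a b g ->
  (forall t, a <= t <= b -> `|g t| <= k) -> `|rint a b g| <= k * (b - a).
Proof.
move=> ab cg gk; rewrite ler_norml -mulNr -!rint_cst//.
have cc l : cts a b (fun=> l : R) by move=> x _; exact: cvg_cst.
by apply/andP; split; apply: le_rint => // t /gk; rewrite ler_norml => /andP[].
Qed.

Lemma cts_Re a b F : cts a b F -> cts a b (fun t => cRe (F t)).
Proof. by move=> cF x /cF; exact: continuous_Re. Qed.

Lemma cts_Im a b F : cts a b F -> cts a b (fun t => cIm (F t)).
Proof. by move=> cF x /cF; exact: continuous_Im. Qed.

Lemma ctsM a b F G : cts a b F -> cts a b G -> cts a b (fun t => F t * G t).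
Proof. by move=> cF cG x xab; apply: cvgM; [exact: cF|exact: cG]. Qed.

Lemma cts_cst (T : topologicalType) a b (l : T) : cts a b (fun=> l).
Proof. by move=> x _; exact: cvg_cst. Qed.

Lemma cintD a b F G : cts a b F -> cts a b G ->
  cint a b (fun t => F t + G t) = cint a b F + cint a b G.
Proof.
move=> cF cG; apply: eq_ReIm => /=.
- rewrite -rintD; [|exact: cts_Re..].
  by apply: eq_rint => t _; rewrite ReD.
- rewrite -rintD; [|exact: cts_Im..].
  by apply: eq_rint => t _; rewrite ImD.
Qed.

Lemma eq_cint a b F G : (forall t, a <= t <= b -> F t = G t) ->
  cint a b F = cint a b G.
Proof.
by move=> FG; apply: eq_ReIm; apply: eq_rint => t /FG ->.
Qed.

Lemma cintZ a b k F : cts a b F ->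
  cint a b (fun t => k * F t) = k * cint a b F.
Proof.
move=> cF; have cR := cts_Re cF; have cI := cts_Im cF.
have sc l g : cts a b g -> cts a b (fun t => l * g t).
  by move=> cg x xab; apply: cvgM; [exact: cvg_cst|exact: cg].
apply: eq_ReIm; rewrite ?ReM ?ImM /=.
- rewrite -(rintZ _ cR) -(rintZ _ cI) -rintB; [|exact: sc..].
  by apply: eq_rint => t _; rewrite ReM.
- rewrite -(rintZ _ cR) -(rintZ _ cI) -rintD; [|exact: sc..].
  by apply: eq_rint => t _; rewrite ImM.
Qed.

Lemma cintB a b F G : cts a b F -> cts a b G ->
  cint a b (fun t => F t - G t) = cint a b F - cint a b G.
Proof.
move=> cF cG.
have cN : cts a b (fun t => (-1) * G t) := ctsM (@cts_cst _ a b (-1 : C)) cG.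
have -> : cint a b (fun t => F t - G t) = cint a b (fun t => F t + (-1) * G t).
  by apply: eq_cint => t _; rewrite mulN1r.
by rewrite (cintD cF cN) (cintZ _ cG) mulN1r.
Qed.

Lemma cint_split a b c F : a <= c -> c <= b -> cts a b F ->
  cint a b F = cint a c F + cint c b F.
Proof.
move=> ac cb cF; apply: eq_ReIm => /=; apply: rint_split => //.
- exact: cts_Re.
- exact: cts_Im.
Qed.

(** The constant 2 comes from bounding real and imaginary parts separately;
    every use tolerates a constant factor. *)
Lemma cint_bound a b F k : a <= b -> cts a b F ->
  (forall t, a <= t <= b -> normc (F t) <= k) ->
  normc (cint a b F) <= 2 * k * (b - a).
Proof.
move=> ab cF Fk; apply: (le_trans (normc_le_ReIm _)) => /=.
have -> : 2 * k * (b - a) = k * (b - a) + k * (b - a) by ring.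
rewrite lerD//; apply: rint_bound => //.
- exact: cts_Re.
- by move=> t /Fk; exact: le_trans (abs_Re_le _).
- exact: cts_Im.
- by move=> t /Fk; exact: le_trans (abs_Im_le _).
Qed.

Lemma cint_FTC a b F G : a <= b -> cts a b F ->
  (forall x : R, is_derive x (1 : R) (fun t => cRe (G t)) (cRe (F x))) ->
  (forall x : R, is_derive x (1 : R) (fun t => cIm (G t)) (cIm (F x))) ->
  cint a b F = G b - G a.
Proof.
move=> ab cF dR dI; apply: eq_ReIm => /=; rewrite ?ReD ?ImD ?ReN ?ImN.
- by apply: rint_FTC => //; exact: cts_Re.
- by apply: rint_FTC => //; exact: cts_Im.
Qed.

End segment_integrals.

(** * Goursat's theorem on polar rectangles *)
Section quartering.
Variable R : realType.

Lemma nested_segments (a b : nat -> R) :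
  (forall n, a n <= a n.+1) -> (forall n, b n.+1 <= b n) ->
  (forall n, a n <= b n) -> exists x, forall n, a n <= x <= b n.
Proof.
move=> a_nd b_ni ab.
have amon m n : (m <= n)%N -> a m <= a n.
  by move=> /subnK <-; elim: (n - m)%N => [|k IH]//; rewrite addSn (le_trans IH).
have bmon m n : (m <= n)%N -> b n <= b m.
  by move=> /subnK <-; elim: (n - m)%N => [|k IH]//; rewrite addSn (le_trans _ IH).
have aub n : ubound (range a) (b n).
  move=> _ [m _ <-]; have [mn|/ltnW nm] := leqP m n.
    exact: le_trans (amon _ _ mn) (ab n).
  exact: le_trans (ab m) (bmon _ _ nm).
exists (sup (range a)) => n; apply/andP; split.
  by apply: ub_le_sup; [exists (b n); exact: aub|exists n].
by apply: ge_sup; [exists (a 0%N); exists 0%N|exact: aub].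
Qed.

Variable Phi : R -> R -> R -> R -> R.
Variables A B C D : R.
Hypotheses (AB : A <= B) (CD : C <= D).
Hypothesis Phi_sub : forall a b c d, A <= a -> a <= b -> b <= B ->
  C <= c -> c <= d -> d <= D ->
  Phi a b c d <= Phi a ((a + b) / 2) c ((c + d) / 2) + Phi ((a + b) / 2) b c ((c + d) / 2)
    + Phi a ((a + b) / 2) ((c + d) / 2) d + Phi ((a + b) / 2) b ((c + d) / 2) d.
Hypothesis Phi_loc : forall x y e, A <= x <= B -> C <= y <= D -> 0 < e ->
  exists2 dl, 0 < dl & forall a b c d, A <= a -> a <= x -> x <= b -> b <= B ->
   C <= c -> c <= y -> y <= d -> d <= D -> b - a < dl -> d - c < dl ->
   Phi a b c d <= e * (b - a + (d - c)) ^+ 2.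

Let rect : Type := (R * R * (R * R))%type.
Let val (s : rect) := Phi s.1.1 s.1.2 s.2.1 s.2.2.
Let mid (p : R * R) : R := (p.1 + p.2) / 2.
Let q1 (s : rect) : rect := ((s.1.1, mid s.1), (s.2.1, mid s.2)).
Let q2 (s : rect) : rect := ((mid s.1, s.1.2), (s.2.1, mid s.2)).
Let q3 (s : rect) : rect := ((s.1.1, mid s.1), (mid s.2, s.2.2)).
Let q4 (s : rect) : rect := ((mid s.1, s.1.2), (mid s.2, s.2.2)).
Let next (s : rect) : rect :=
  if val s / 4 <= val (q1 s) then q1 s else
  if val s / 4 <= val (q2 s) then q2 s else
  if val s / 4 <= val (q3 s) then q3 s else q4 s.
Let sq n : rect := iter n next ((A, B), (C, D)).

Let good (s : rect) := [/\ A <= s.1.1, s.1.1 <= s.1.2 & s.1.2 <= B] /\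
  [/\ C <= s.2.1, s.2.1 <= s.2.2 & s.2.2 <= D].

Let nextP s : good s -> [/\ good (next s), val s / 4 <= val (next s),
  s.1.1 <= (next s).1.1 /\ (next s).1.2 <= s.1.2,
  s.2.1 <= (next s).2.1 /\ (next s).2.2 <= s.2.2 &
  (next s).1.2 - (next s).1.1 = (s.1.2 - s.1.1) / 2 /\
  (next s).2.2 - (next s).2.1 = (s.2.2 - s.2.1) / 2].
Proof.
case: s => [[a b] [c d]] [[/= Aa ab bB] [Cc cd dD]].
have hs := Phi_sub Aa ab bB Cc cd dD.
rewrite /next /q1 /q2 /q3 /q4 /val /mid /=.
case: ifPn => [h1|]; last rewrite -ltNge => h1;
  last (case: ifPn => [h2|]; last rewrite -ltNge => h2);
  last (case: ifPn => [h3|]; last rewrite -ltNge => h3);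
  rewrite /good /=; repeat split; lra.
Qed.

(** Goursat's bisection, for an abstract set function Phi of rectangles.  If Phi
    is subadditive under quartering and positive, some quarter carries a fourth
    of its value; iterating produces nested rectangles around a point (x, y)
    on which Phi decreases no faster than the square of the size, with a fixed
    constant, against the local bound Phi_loc. *)
Lemma quartering : Phi A B C D <= 0.
Proof.
rewrite leNgt; apply/negP => P0.
have gs n : good (sq n).
  by elim: n => [|n /nextP[]//]; split; split.
pose a n := (sq n).1.1; pose b n := (sq n).1.2.
pose c n := (sq n).2.1; pose d n := (sq n).2.2.
have [x xab] : exists x, forall n, a n <= x <= b n.
  apply: nested_segments => n.
  - by have [_ _ [? _] _ _] := nextP (gs n).
  - by have [_ _ [_ ?] _ _] := nextP (gs n).
  - by have [[]] := gs n.
have [y ycd] : exists y, forall n, c n <= y <= d n.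
  apply: nested_segments => n.
  - by have [_ _ _ [? _] _] := nextP (gs n).
  - by have [_ _ _ [_ ?] _] := nextP (gs n).
  - by have [_ []] := gs n.
have Pn n : Phi A B C D / 4 ^+ n <= val (sq n).
  elim: n => [|n IH]; first by rewrite expr0 divr1.
  have [_ h _ _ _] := nextP (gs n).
  rewrite exprSr invfM mulrA (le_trans _ h)// ler_pM2r//.
have wab n : b n - a n = (B - A) / 2 ^+ n.
  elim: n => [|n IH]; first by rewrite expr0 divr1.
  have [_ _ _ _ [h _]] := nextP (gs n).
  by rewrite /a /b /= h exprSr invfM mulrA -IH.
have wcd n : d n - c n = (D - C) / 2 ^+ n.
  elim: n => [|n IH]; first by rewrite expr0 divr1.
  have [_ _ _ _ [_ h]] := nextP (gs n).
  by rewrite /c /d /= h exprSr invfM mulrA -IH.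
set w := B - A + (D - C).
have w0 : 0 <= w by rewrite addr_ge0// subr_ge0.
(* The local bound at scale 2^-n is e * w^2 / 4^n, with w the half-perimeter
   of the initial rectangle: this e makes it smaller than Phi / 4^n. *)
set e := Phi A B C D / (2 * (w ^+ 2 + 1)).
have w2 : 0 < 2 * (w ^+ 2 + 1) by rewrite mulr_gt0// ltr_wpDl ?sqr_ge0.
have e0 : 0 < e by rewrite divr_gt0.
have [dl dl0 H] := @Phi_loc x y e (xab 0%N) (ycd 0%N) e0.
have [n hn] : exists n : nat, w < dl * 2 ^+ n.
  have [n hn] : exists n : nat, w / dl < n%:R.
    by exists (Num.bound (w / dl)); rewrite archi_boundP// divr_ge0// ltW.
  exists n; rewrite mulrC -ltr_pdivrMr// (lt_le_trans hn)//.
  by rewrite -natrX ler_nat ltnW// ltn_expl.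
have p2 : 0 < 2 ^+ n :> R by rewrite exprn_gt0.
have [[Aa ab bB] [Cc cd dD]] := gs n.
have /andP[ax xb] := xab n; have /andP[cy yd] := ycd n.
have h1 : b n - a n < dl.
  by rewrite wab ltr_pdivrMr// (le_lt_trans _ hn)// lerDl subr_ge0.
have h2 : d n - c n < dl.
  by rewrite wcd ltr_pdivrMr// (le_lt_trans _ hn)// lerDr subr_ge0.
have := H _ _ _ _ Aa ax xb bB Cc cy yd dD h1 h2.
rewrite wab wcd -mulrDl -/w => /(le_trans (Pn n)).
rewrite expr_div_n -exprM mulnC exprM (_ : 2 ^+ 2 = 4); last by ring.
rewrite mulrA ler_pM2r ?invr_gt0 ?exprn_gt0//.
rewrite /e mulrAC ler_pdivlMr// ler_pM2l//; have := sqr_ge0 w; lra.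
Qed.

End quartering.

Section goursat.
Variable R : realType.
Local Notation C := R[i].
Local Notation cRe := (@complex.Re R).
Local Notation cIm := (@complex.Im R).
Local Notation I := (0 +i* 1 : C).
Implicit Types (h : C -> C) (r t a b : R).

(** The integrals of h dz along a circular arc and along a radial segment.
    Polar coordinates are used so that whole circles are reached directly,
    without deforming contours. *)
Definition arc h r a b := cint a b (fun t => I * (r%:C * cis t) * h (r%:C * cis t)).
Definition ray h t a b := cint a b (fun r => cis t * h (r%:C * cis t)).

Lemma is_derive_cos_scale (k x : R) :
  is_derive x (1 : R) (fun t => k * cos t) (- (k * sin x)).
Proof.
have := is_deriveZ k (is_derive_cos x).
by rewrite /GRing.scale /= mulrN; exact.
Qed.

Lemma is_derive_sin_scale (k x : R) :
  is_derive x (1 : R) (fun t => k * sin t) (k * cos x).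
Proof. exact: (is_deriveZ k (is_derive_sin x)). Qed.

Lemma continuous_circle r t : {for t, continuous (fun t => r%:C * cis t : C)}.
Proof. by apply: cvgM; [exact: cvg_cst|exact: continuous_cis]. Qed.

Lemma continuous_radius r t : {for r, continuous (fun r => r%:C * cis t : C)}.
Proof. by apply: cvgM; [exact: continuous_cplx|exact: cvg_cst]. Qed.

Lemma arc_1 r a b : a <= b -> arc (fun=> 1) r a b = r%:C * cis b - r%:C * cis a.
Proof.
move=> ab; rewrite /arc; apply: (cint_FTC (G := fun t => r%:C * cis t)) => //.
- move=> x _; apply: cvgM; last exact: cvg_cst.
  by apply: cvgM; [exact: cvg_cst|exact: continuous_circle].
- move=> x; rewrite /cis /=.
  have := is_derive_cos_scale r x.
  congr (is_derive _ _ _ _); last by ring.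
  by apply/funext => t; ring.
- move=> x; rewrite /cis /=.
  have := is_derive_sin_scale r x.
  congr (is_derive _ _ _ _); last by ring.
  by apply/funext => t; ring.
Qed.

Lemma arc_id r a b : a <= b ->
  arc id r a b = (r%:C * cis b) ^+ 2 / 2 - (r%:C * cis a) ^+ 2 / 2.
Proof.
move=> ab.
have i2 (z : C) : z / 2 = cRe z / 2 +i* (cIm z / 2).
  rewrite -[2](_ : (2 : R)%:C = 2); last by rewrite rmorph_nat.
  rewrite -fmorphV; case: z => u v /=; apply: eq_ReIm => /=; ring.
rewrite /arc; apply: (cint_FTC (G := fun t => (r%:C * cis t) ^+ 2 / 2)) => //.
- move=> x _; apply: cvgM; last exact: continuous_circle.
  by apply: cvgM; [exact: cvg_cst|exact: continuous_circle].
- move=> x.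
  have dc := is_derive_cos_scale r x; have ds := is_derive_sin_scale r x.
  have := is_deriveZ (1/2) (is_deriveB (is_deriveM dc dc) (is_deriveM ds ds)).
  congr (is_derive _ _ _ _).
  + by apply/funext => t; rewrite i2 expr2 /cis !fctE /= /GRing.scale /=; ring.
  + by rewrite /cis /GRing.scale /=; field.
- move=> x.
  have dc := is_derive_cos_scale r x; have ds := is_derive_sin_scale r x.
  have := is_deriveM dc ds.
  congr (is_derive _ _ _ _).
  + by apply/funext => t; rewrite i2 expr2 /cis !fctE /= /GRing.scale /=; field.
  + by rewrite /cis /GRing.scale /=; ring.
Qed.

Lemma ray_1 t a b : a <= b -> ray (fun=> 1) t a b = b%:C * cis t - a%:C * cis t.
Proof.
move=> ab; rewrite /ray; apply: (cint_FTC (G := fun r => r%:C * cis t)) => //.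
- by move=> x _; exact: cvg_cst.
- move=> x; rewrite /cis /=.
  have := is_deriveZ (cos t) (is_derive_id x (1 : R)).
  congr (is_derive _ _ _ _); rewrite /GRing.scale /=; last by ring.
  by apply/funext => r; transitivity (cos t * r) => //=; ring.
- move=> x; rewrite /cis /=.
  have := is_deriveZ (sin t) (is_derive_id x (1 : R)).
  congr (is_derive _ _ _ _); rewrite /GRing.scale /=; last by ring.
  by apply/funext => r; transitivity (sin t * r) => //=; ring.
Qed.

Lemma ray_id t a b : a <= b ->
  ray id t a b = (b%:C * cis t) ^+ 2 / 2 - (a%:C * cis t) ^+ 2 / 2.
Proof.
move=> ab.
have i2 (z : C) : z / 2 = cRe z / 2 +i* (cIm z / 2).
  rewrite -[2](_ : (2 : R)%:C = 2); last by rewrite rmorph_nat.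
  rewrite -fmorphV; case: z => u v /=; apply: eq_ReIm => /=; ring.
have d2 x := is_deriveM (is_derive_id x (1 : R)) (is_derive_id x (1 : R)).
rewrite /ray; apply: (cint_FTC (G := fun r => (r%:C * cis t) ^+ 2 / 2)) => //.
- by move=> x _; apply: cvgM; [exact: cvg_cst|exact: continuous_radius].
- move=> x; rewrite /cis.
  have := is_deriveZ ((cos t ^+ 2 - sin t ^+ 2) / 2) (d2 x).
  congr (is_derive _ _ _ _); last by rewrite /GRing.scale /=; field.
  by apply/funext => r; rewrite i2 expr2;
      transitivity ((cos t ^+ 2 - sin t ^+ 2) / 2 * (r * r)) => //=; field.
- move=> x; rewrite /cis.
  have := is_deriveZ (cos t * sin t) (d2 x).
  congr (is_derive _ _ _ _); last by rewrite /GRing.scale /=; ring.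
  by apply/funext => r; rewrite i2 expr2;
      transitivity (cos t * sin t * (r * r)) => //=; field.
Qed.

End goursat.

Section goursat_annulus.
Variable R : realType.
Local Notation C := R[i].
Local Notation I := (0 +i* 1 : C).
Implicit Types (h g : C -> C) (r t a b c d : R).

Definition annulus r1 r2 : set C := [set z | r1 <= normc z <= r2].

Definition cts_annulus r1 r2 h := forall z, annulus r1 r2 z -> {for z, continuous h}.

Lemma normc_polar r t : 0 <= r -> normc (r%:C * cis t) = r.
Proof. by move=> r0; rewrite normcM normc_cis mulr1 normc_real. Qed.

Lemma annulus_polar r1 r2 r t : 0 <= r1 -> r1 <= r -> r <= r2 ->
  annulus r1 r2 (r%:C * cis t).
Proof.
by move=> r10 r1r rr2; rewrite /annulus /mkset normc_polar ?r1r ?rr2// (le_trans r10).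
Qed.

(** The chord is the integral of dz along the arc; the factor 2 is that of
    cint_bound. *)
Lemma lip_cis s t : normc (cis t - cis s) <= 2 * `|t - s|.
Proof.
wlog st : s t / s <= t.
  move=> H; have [/H//|/ltW/H] := leP s t.
  by rewrite distrC normcB.
have := arc_1 1 st; rewrite !mul1r => <-.
rewrite ger0_norm ?subr_ge0// -[in X in _ <= X](mulr1 2) mulrC.
rewrite mulrC; apply: cint_bound => //.
  move=> x _; apply: cvgM; last exact: cvg_cst.
  by apply: cvgM; [exact: cvg_cst|exact: continuous_circle].
move=> x _; rewrite mulr1 !normcM normc_cis normc_real// !mulr1.
by rewrite /= expr0n add0r expr1n sqrtr1.
Qed.

Lemma normcI : normc I = 1.
Proof. by rewrite /= expr0n add0r expr1n sqrtr1. Qed.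

Lemma cts_arc r1 r2 h r a b : 0 <= r1 -> r1 <= r -> r <= r2 ->
  cts_annulus r1 r2 h ->
  cts a b (fun t => I * (r%:C * cis t) * h (r%:C * cis t)).
Proof.
move=> r10 r1r rr2 hc x _; apply: cvgM.
  by apply: cvgM; [exact: cvg_cst|exact: continuous_circle].
apply: (@continuous_comp _ _ _ (fun t => r%:C * cis t) h).
  exact: continuous_circle.
by apply: hc; exact: annulus_polar.
Qed.

Lemma cts_ray r1 r2 h t a b : 0 <= r1 -> r1 <= a -> b <= r2 ->
  cts_annulus r1 r2 h -> cts a b (fun r => cis t * h (r%:C * cis t)).
Proof.
move=> r10 r1a br2 hc x /andP[ax xb]; apply: cvgM; first exact: cvg_cst.
apply: (@continuous_comp _ _ _ (fun r => r%:C * cis t) h).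
  exact: continuous_radius.
by apply: hc; apply: annulus_polar => //; [exact: le_trans ax|exact: le_trans br2].
Qed.

(** The integral of h dz along the boundary of the polar rectangle with radii
    in [a, b] and arguments in [c, d], counterclockwise. *)
Definition polar h a b c d := arc h b c d - arc h a c d - ray h d a b + ray h c a b.

Section rectangle.
Variables r1 r2 : R.
Hypotheses (r10 : 0 <= r1) (r21 : r2 <= 1).

Lemma polarD h g a b c d : r1 <= a -> a <= b -> b <= r2 ->
  cts_annulus r1 r2 h -> cts_annulus r1 r2 g ->
  polar (fun z => h z + g z) a b c d = polar h a b c d + polar g a b c d.
Proof.
move=> r1a ab br2 hc gc.
have aD r : r1 <= r -> r <= r2 ->
    arc (fun z => h z + g z) r c d = arc h r c d + arc g r c d.
  move=> h1 h2; rewrite /arc -cintD; [|exact: (cts_arc r10 h1 h2 hc)|exact: (cts_arc r10 h1 h2 gc)].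
  by apply: eq_cint => t _; rewrite mulrDr.
have rD t : ray (fun z => h z + g z) t a b = ray h t a b + ray g t a b.
  rewrite /ray -cintD; [|exact: (cts_ray r10 r1a br2 hc)|exact: (cts_ray r10 r1a br2 gc)].
  by apply: eq_cint => r _; rewrite mulrDr.
rewrite /polar !rD (aD b (le_trans r1a ab) br2) (aD a r1a (le_trans ab br2)).
by ring.
Qed.

Lemma polarZ k h a b c d : r1 <= a -> a <= b -> b <= r2 -> cts_annulus r1 r2 h ->
  polar (fun z => k * h z) a b c d = k * polar h a b c d.
Proof.
move=> r1a ab br2 hc.
have aZ r : r1 <= r -> r <= r2 -> arc (fun z => k * h z) r c d = k * arc h r c d.
  move=> h1 h2; rewrite /arc -cintZ; last exact: (cts_arc r10 h1 h2 hc).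
  by apply: eq_cint => t _; rewrite mulrCA.
have rZ t : ray (fun z => k * h z) t a b = k * ray h t a b.
  rewrite /ray -cintZ; last exact: (cts_ray r10 r1a br2 hc).
  by apply: eq_cint => r _; rewrite mulrCA.
rewrite /polar !rZ (aZ b (le_trans r1a ab) br2) (aZ a r1a (le_trans ab br2)).
by ring.
Qed.

Lemma polar_1 a b c d : a <= b -> c <= d -> polar (fun=> 1) a b c d = 0.
Proof. by move=> ab cd; rewrite /polar !arc_1// !ray_1//; ring. Qed.

Lemma polar_id a b c d : a <= b -> c <= d -> polar id a b c d = 0.
Proof. by move=> ab cd; rewrite /polar !arc_id// !ray_id//; ring. Qed.

Lemma polar_quarter h a b c d m n : r1 <= a -> a <= m -> m <= b -> b <= r2 ->
  c <= n -> n <= d -> cts_annulus r1 r2 h ->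
  polar h a b c d = polar h a m c n + polar h m b c n + polar h a m n d + polar h m b n d.
Proof.
move=> r1a am mb br2 cn nd hc.
have aS r : r1 <= r -> r <= r2 -> arc h r c d = arc h r c n + arc h r n d.
  by move=> h1 h2; apply: cint_split => //; exact: (cts_arc r10 h1 h2 hc).
have rS t : ray h t a b = ray h t a m + ray h t m b.
  by apply: cint_split => //; exact: (cts_ray r10 r1a br2 hc).
have ab := le_trans am mb.
rewrite /polar (rS c) (rS d) (aS b (le_trans r1a ab) br2) (aS a r1a (le_trans ab br2)).
move: (arc h b c n) (arc h b n d) (arc h a c n) (arc h a n d) (arc h m c n) (arc h m n d).
move: (ray h d a m) (ray h d m b) (ray h c a m) (ray h c m b) (ray h n a m) (ray h n m b).
by move=> *; ring.
Qed.

Lemma polar_bound h k a b c d : r1 <= a -> a <= b -> b <= r2 -> c <= d ->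
  cts_annulus r1 r2 h ->
  (forall r t, a <= r <= b -> c <= t <= d -> normc (h (r%:C * cis t)) <= k) ->
  normc (polar h a b c d) <= 4 * k * (b - a + (d - c)).
Proof.
move=> r1a ab br2 cd hc hk.
have a0 := le_trans r10 r1a.
have aB r : a <= r -> r <= b -> normc (arc h r c d) <= 2 * k * (d - c).
  move=> ar rb; apply: cint_bound => //.
    exact: (cts_arc r10 (le_trans r1a ar) (le_trans rb br2) hc).
  move=> t tcd; rewrite normcM (normcM I) normcI mul1r normc_polar ?(le_trans a0)//.
  rewrite (le_trans _ (hk r t _ _)) ?ar ?rb// ler_piMl ?normc_ge0//.
  by rewrite (le_trans rb)// (le_trans br2).
have rB t : c <= t <= d -> normc (ray h t a b) <= 2 * k * (b - a).
  move=> tcd; apply: cint_bound => //; first exact: (cts_ray r10 r1a br2 hc).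
  by move=> r rab; rewrite normcM normc_cis mul1r hk.
have h1 := aB _ ab (lexx b); have h2 := aB _ (lexx a) ab.
have h3 : normc (ray h c a b) <= 2 * k * (b - a) by apply: rB; rewrite lexx.
have h4 : normc (ray h d a b) <= 2 * k * (b - a) by apply: rB; rewrite lexx andbT.
have -> : 4 * k * (b - a + (d - c)) = 2 * k * (d - c) + 2 * k * (d - c) +
  2 * k * (b - a) + 2 * k * (b - a) by ring.
rewrite /polar (le_trans (le_normcD _ _))// lerD//.
rewrite (le_trans (le_normcB _ _))// lerD//.
by rewrite (le_trans (le_normcB _ _))// lerD.
Qed.

(** Goursat's theorem.  Near a point z0, h is an affine function of z up to
    o(|z - z0|); affine functions have primitives and contribute nothing, and
    the remainder contributes o(size^2), so that quartering applies. *)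
Lemma polar_analytic h a b c d : r1 <= a -> a <= b -> b <= r2 -> c <= d ->
  (forall z, annulus r1 r2 z -> derivable h z 1) -> polar h a b c d = 0.
Proof.
move=> r1a ab br2 cd dh.
have hc : cts_annulus r1 r2 h by move=> z /dh; exact: analytic_continuous.
apply/eqP; rewrite -normc_eq0 eq_le normc_ge0 andbT.
apply: (quartering (Phi := fun a b c d => normc (polar h a b c d))) => //.
  move=> a' b' c' d' aa' ab' bb' cc' cd' dd'.
  rewrite (@polar_quarter h a' b' c' d' ((a' + b') / 2) ((c' + d') / 2))//; try lra.
  rewrite (le_trans (le_normcD _ _))// lerD2r.
  rewrite (le_trans (le_normcD _ _))// lerD2r.
  exact: le_normcD.
move=> x y e /andP[ax xb] ycd e0.
have a0 := le_trans r10 r1a; have x0 := le_trans a0 ax.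
set z0 := x%:C * cis y.
have z0A : annulus r1 r2 z0.
  by apply: annulus_polar => //; [exact: le_trans ax|exact: le_trans br2].
(* l is the derivative of h at z0; the statement includes w = z0. *)
have [l hl] : exists l : C, forall e : R, 0 < e -> exists2 dl : R, 0 < dl &
    forall w, normc (w - z0) < dl ->
      normc (h w - h z0 - l * (w - z0)) <= e * normc (w - z0).
  have /cvg_ex[l /cvg_normcP H] := dh _ z0A.
  exists l => e1 e10.
  have /nbhs_normcP[dl dl0 Hd] := H _ e10.
  exists dl => // w wz.
  have [->|wz0] := eqVneq w z0.
    by rewrite !subrr mulr0 subrr normc0 mulr0.
  have /Hd : normc (w - z0 - 0) < dl by rewrite subr0.
  move=> /(_ _); rewrite /= subr_eq0 => /(_ wz0).
  have -> : (w - z0) *: (1 : C) + z0 = w by rewrite /GRing.scale /= mulr1 subrK.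
  rewrite /GRing.scale /= => Hw.
  have wn : 0 < normc (w - z0) by rewrite normc_gt0 subr_eq0.
  rewrite -ler_pdivrMr// -normcV -normcM (le_trans _ (ltW Hw))//.
  rewrite le_eqVlt; apply/orP; left; apply/eqP; congr normc.
  by field; rewrite subr_eq0.
have [dl dl0 Hd] := hl (e / 8) (divr_gt0 e0 (ltr0n _ 8)).
exists (dl / 4); first by rewrite divr_gt0.
move=> a' b' c' d' aa' ax' xb' bb' cc' cy yd dd' ba dc.
set s := b' - a' + (d' - c').
(* E is h minus its affine approximation at z0, written as h plus a
   combination of 1 and the identity to which linearity applies. *)
set E := fun w : C => h w + ((l * z0 - h z0) * 1 + (- l) * w).
have cc1 : cts_annulus r1 r2 (fun=> 1) by move=> z _; exact: continuous_const.
have cid : cts_annulus r1 r2 id by move=> z _; exact: continuous_ident.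
have cZ (k : C) (g : C -> C) : cts_annulus r1 r2 g -> cts_annulus r1 r2 (fun z => k * g z).
  by move=> cg z za; exact: continuous_mulc (continuous_const k z) (cg z za).
have cD (f g : C -> C) : cts_annulus r1 r2 f -> cts_annulus r1 r2 g -> cts_annulus r1 r2 (fun z => f z + g z).
  by move=> cf cg z za; exact: continuous_addc (cf z za) (cg z za).
have r1a' := le_trans r1a aa'.
have ab' := le_trans ax' xb'.
have br2' := le_trans bb' br2.
have cd' := le_trans cy yd.
have pE : polar E a' b' c' d' = polar h a' b' c' d'.
  rewrite /E (polarD _ _ r1a' ab' br2' hc (cD _ _ (cZ _ _ cc1) (cZ _ _ cid))).
  rewrite (polarD _ _ r1a' ab' br2' (cZ _ _ cc1) (cZ _ _ cid)).
  rewrite (polarZ _ _ _ r1a' ab' br2' cc1) (polarZ _ _ _ r1a' ab' br2' cid).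
  by rewrite polar_1// polar_id// !mulr0 !addr0.
rewrite -pE.
have cE : cts_annulus r1 r2 E by apply: (cD _ _ hc); apply: cD; exact: cZ.
have k1 : 4 * (e / 8 * (2 * s)) * s = e * s ^+ 2 by field.
rewrite -k1; apply: polar_bound => // r t /andP[ar rb] /andP[ct td].
have nr : normc (r%:C * cis t - z0) <= 2 * s.
  have -> : r%:C * cis t - z0 = (r - x)%:C * cis t + x%:C * (cis t - cis y).
    by rewrite /z0 rmorphB /=; ring.
  rewrite (le_trans (le_normcD _ _))// !normcM normc_cis mulr1 normc_realE normc_real//.
  have x1 : x <= 1 by rewrite (le_trans xb)// (le_trans br2).
  have h1 : x * normc (cis t - cis y) <= 2 * `|t - y|.
    by rewrite (le_trans _ (lip_cis y t))// ler_piMl// normc_ge0.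
  have h2 : `|r - x| <= b' - a' by rewrite ler_norml; lra.
  have h3 : `|t - y| <= d' - c' by rewrite ler_norml; lra.
  by rewrite /s; lra.
have -> : E (r%:C * cis t) = h (r%:C * cis t) - h z0 - l * (r%:C * cis t - z0).
  by rewrite /E; ring.
rewrite (le_trans (Hd _ _))//; last by rewrite ler_pM2l// divr_gt0.
by rewrite (le_lt_trans nr)// /s; lra.
Qed.

End rectangle.

(** The polar rectangle with arguments in [0, 2 pi] is the annulus cut along a
    radius; its two radial sides coincide and cancel. *)
Lemma cauchy_annulus r1 r2 h : 0 <= r1 -> r1 <= r2 -> r2 <= 1 ->
  (forall z, annulus r1 r2 z -> derivable h z 1) ->
  arc h r1 0 (2 * pi) = arc h r2 0 (2 * pi).
Proof.
move=> r10 r12 r21 dh.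
have p0 : 0 <= 2 * pi :> R by rewrite mulr_ge0// pi_ge0.
have := polar_analytic r10 r21 (lexx r1) r12 (lexx r2) p0 dh.
have -> : polar h r1 r2 0 (2 * pi) = arc h r2 0 (2 * pi) - arc h r1 0 (2 * pi).
  rewrite /polar /ray cis2pi -(cis2pi R).
  rewrite -(cisDpi2 0) add0r; ring.
by move/eqP; rewrite subr_eq0 => /eqP.
Qed.

End goursat_annulus.

(** * Circle means, Cauchy's formula and Taylor expansion *)
Section means.
Variable R : realType.
Local Notation C := R[i].
Local Notation cRe := (@complex.Re R).
Local Notation cIm := (@complex.Im R).
Implicit Types (g h : R -> R) (F G : R -> C).

Definition mean g : R := (2 * pi)^-1 * rint 0 (2 * pi) g.
Definition Cmean F : C := mean (fun t => cRe (F t)) +i* mean (fun t => cIm (F t)).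

Lemma pi2_gt0 : 0 < 2 * pi :> R.
Proof. by rewrite mulr_gt0// pi_gt0. Qed.
Local Hint Resolve pi2_gt0 : core.

Lemma pi2_ge0 : 0 <= 2 * pi :> R. Proof. exact: ltW. Qed.
Local Hint Resolve pi2_ge0 : core.

Lemma pi2V_ge0 : 0 <= (2 * pi)^-1 :> R.
Proof. by rewrite invr_ge0. Qed.
Local Hint Resolve pi2V_ge0 : core.

Lemma continuous_cts (T : topologicalType) a b (F : R -> T) : continuous F -> cts a b F.
Proof. by move=> cF x _; exact: cF. Qed.
Local Hint Resolve continuous_cts : core.

Lemma meanD g h : continuous g -> continuous h ->
  mean (fun t => g t + h t) = mean g + mean h.
Proof. by move=> cg ch; rewrite /mean rintD ?mulrDr//; exact: continuous_cts. Qed.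

Lemma meanB g h : continuous g -> continuous h ->
  mean (fun t => g t - h t) = mean g - mean h.
Proof. by move=> cg ch; rewrite /mean rintB ?mulrBr//; exact: continuous_cts. Qed.

Lemma meanZ k g : continuous g -> mean (fun t => k * g t) = k * mean g.
Proof. by move=> cg; rewrite /mean rintZ 1?mulrCA//; exact: continuous_cts. Qed.

Lemma mean_cst k : mean (fun=> k) = k.
Proof. by rewrite /mean rint_cst// subr0 mulrCA mulVf ?mulr1// gt_eqF. Qed.

Lemma le_mean g h : continuous g -> continuous h -> (forall t, g t <= h t) ->
  mean g <= mean h.
Proof.
by move=> cg ch gh; rewrite ler_wpM2l// le_rint//; exact: continuous_cts.
Qed.

Lemma mean_ge0 g : (forall t, 0 <= g t) -> 0 <= mean g.
Proof. by move=> g0; rewrite mulr_ge0//; apply: Rintegral_ge0. Qed.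

Lemma eq_mean g h : (forall t, g t = h t) -> mean g = mean h.
Proof. by move=> gh; congr mean; exact/funext. Qed.

Lemma CmeanE F : Cmean F = ((2 * pi)^-1)%:C * cint 0 (2 * pi) F.
Proof. by apply: eq_ReIm; rewrite ?ReM ?ImM /= mul0r ?subr0 ?addr0. Qed.

Lemma CmeanD F G : continuous F -> continuous G ->
  Cmean (fun t => F t + G t) = Cmean F + Cmean G.
Proof.
move=> cF cG; rewrite !CmeanE -mulrDr.
by rewrite (@cintD R 0 (2 * pi) F G (continuous_cts cF) (continuous_cts cG)).
Qed.

Lemma CmeanB F G : continuous F -> continuous G ->
  Cmean (fun t => F t - G t) = Cmean F - Cmean G.
Proof.
move=> cF cG; rewrite !CmeanE -mulrBr.
by rewrite (@cintB R 0 (2 * pi) F G (continuous_cts cF) (continuous_cts cG)).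
Qed.

Lemma CmeanZ k F : continuous F -> Cmean (fun t => k * F t) = k * Cmean F.
Proof.
by move=> cF; rewrite !CmeanE cintZ 1?mulrCA//; exact: continuous_cts.
Qed.

Lemma eq_Cmean F G : (forall t, F t = G t) -> Cmean F = Cmean G.
Proof. by move=> FG; congr Cmean; exact/funext. Qed.

Lemma Cmean_cst (k : C) : Cmean (fun=> k) = k.
Proof. by apply: eq_ReIm; rewrite /= mean_cst. Qed.

Lemma Re_Cmean F : cRe (Cmean F) = mean (fun t => cRe (F t)).
Proof. by []. Qed.

Lemma cont_sum n (F : nat -> R -> C) : (forall k, continuous (F k)) ->
  continuous (fun t => \sum_(0 <= k < n) F k t).
Proof.
move=> cF; elim: n => [|n IH].
  under eq_fun do rewrite big_nil; move=> x; exact: cvg_cst.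
under eq_fun do rewrite big_nat_recr//=.
by move=> x; exact: continuous_addc (IH x) (cF n x).
Qed.

Lemma Cmean_sum n (F : nat -> R -> C) : (forall k, continuous (F k)) ->
  Cmean (fun t => \sum_(0 <= k < n) F k t) = \sum_(0 <= k < n) Cmean (F k).
Proof.
move=> cF; elim: n => [|n IH].
  rewrite big_nil; transitivity (Cmean (fun=> 0)); last exact: Cmean_cst.
  by apply: eq_Cmean => t; rewrite big_nil.
rewrite big_nat_recr//= -IH -(CmeanD (cont_sum cF) (cF n)).
by apply: eq_Cmean => t; rewrite big_nat_recr.
Qed.

End means.
#[global] Hint Resolve pi2_gt0 pi2_ge0 : core.

Section tube.
Variable R : realType.
Local Notation C := R[i].

(** By compactness of the circle, continuity at its points is uniform in a
    thin annulus around it. *)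
Lemma circle_tube (h : C -> C) (r0 e : R) : 0 <= r0 -> 0 < e ->
  (forall z, normc z = r0 -> {for z, continuous h}) ->
  exists2 d : R, 0 < d & forall r t, `|r - r0| < d -> 0 <= t <= 2 * pi ->
    normc (h (r%:C * cis t) - h (r0%:C * cis t)) < e.
Proof.
move=> r00 e0 hc.
have K : compact `[0, 2 * pi : R]%classic by exact: segment_compact.
move/compact_near_coveringP : K => /(_ R (nbhs r0)
  (fun r t => normc (h (r%:C * cis t) - h (r0%:C * cis t)) < e)) [].
- move=> t _.
  have e2 : 0 < e / 2 by rewrite divr_gt0.
  have /continuous_normcP /(_ _ e2)[d d0 hd] : {for (r0%:C * cis t), continuous h}.
    by apply: hc; exact: normc_polar.
  pose d' := d / (2 * (1 + 2 * r0)).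
  have r1 : 0 < 1 + 2 * r0 by lra.
  have d'0 : 0 < d' by rewrite divr_gt0// mulr_gt0.
  have dist r t' : `|r - r0| < d' -> `|t' - t| < d' ->
      normc (r%:C * cis t' - r0%:C * cis t) < d.
    move=> hr ht.
    have -> : r%:C * cis t' - r0%:C * cis t = (r - r0)%:C * cis t' + r0%:C * (cis t' - cis t).
      by rewrite rmorphB /=; ring.
    rewrite (le_lt_trans (le_normcD _ _))// !normcM normc_cis mulr1 normc_realE normc_real//.
    have h1 : r0 * normc (cis t' - cis t) <= r0 * (2 * d').
      by rewrite ler_wpM2l// (le_trans (lip_cis _ _))// ler_pM2l// ltW.
    have h2 : d' * (1 + 2 * r0) = d / 2 by rewrite /d'; field; rewrite gt_eqF.
    by lra.
  exists (ball t d', ball r0 d') => /=.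
    by split; [exact: nbhsx_ballx|exact: nbhsx_ballx].
  move=> [t' r] /= [bt br].
  rewrite -ball_normE /= distrC in bt; rewrite -ball_normE /= distrC in br.
  have h1 : normc (h (r0%:C * cis t') - h (r0%:C * cis t)) < e / 2.
    by apply: hd; apply: dist => //; rewrite subrr normr0.
  have h2 := hd _ (dist r t' br bt).
  rewrite (_ : h _ - h _ = (h (r%:C * cis t') - h (r0%:C * cis t)) -
    (h (r0%:C * cis t') - h (r0%:C * cis t))); last by ring.
  by rewrite (le_lt_trans (le_normcB _ _))//; lra.
- move=> d /= d0 hd; exists d => // r t rr0 tpi.
  by apply: (hd r) => /=; rewrite ?in_itv//= distrC.
Qed.

End tube.

Section complex_derivable.
Variable R : realType.
Local Notation C := R[i].
Implicit Types (f g : C -> C) (k z : C).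

Lemma derivable_const k z : derivable (fun _ : C => k) z 1.
Proof. exact: (@derivable_cst _ C C k z 1). Qed.

Lemma derivable_ident z : derivable (fun x : C => x) z 1.
Proof. exact: (@derivable_id _ C z 1). Qed.

Lemma derivable_addc f g z : derivable f z 1 -> derivable g z 1 ->
  derivable (fun x => f x + g x) z 1.
Proof. by move=> df dg; exact: (derivableD df dg). Qed.

Lemma derivable_mulc f g z : derivable f z 1 -> derivable g z 1 ->
  derivable (fun x => f x * g x) z 1.
Proof. by move=> df dg; exact: (derivableM df dg). Qed.

Lemma derivable_invc f z : f z != 0 -> derivable f z 1 ->
  derivable (fun x => (f x)^-1) z 1.
Proof. by move=> f0 df; exact: (derivableV f0 df). Qed.

Lemma derivable_subc f g z : derivable f z 1 -> derivable g z 1 ->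
  derivable (fun x => f x - g x) z 1.
Proof. by move=> df dg; exact: (derivableB df dg). Qed.

End complex_derivable.
Arguments derivable_const {R} k z.
Arguments derivable_ident {R} z.

Section cauchy.
Variable R : realType.
Local Notation C := R[i].
Local Notation cRe := (@complex.Re R).
Local Notation I := (0 +i* 1 : C).
Implicit Types (f h : C -> C) (r t : R).

Lemma cont_circle h r : 0 <= r -> (forall z, normc z = r -> {for z, continuous h}) ->
  continuous (fun t => h (r%:C * cis t)).
Proof.
move=> r0 hc t; apply: (@continuous_comp _ _ _ (fun t => r%:C * cis t) h).
  exact: continuous_circle.
by apply: hc; exact: normc_polar.
Qed.

Lemma I_neq0 : I != 0.
Proof. by rewrite -normc_gt0 normcI. Qed.

(** In terms of means, h dz on the circle of radius r is I * z * h(z) dt, which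
    explains the extra factor z. *)
Lemma Cmean_annulus r1 r2 h : 0 <= r1 -> r1 <= r2 -> r2 <= 1 ->
  (forall z, annulus r1 r2 z -> derivable h z 1) ->
  Cmean (fun t => r1%:C * cis t * h (r1%:C * cis t)) =
  Cmean (fun t => r2%:C * cis t * h (r2%:C * cis t)).
Proof.
move=> r10 r12 r21 dh.
have hc z : annulus r1 r2 z -> {for z, continuous h} by move/dh; exact: analytic_continuous.
have E r : r1 <= r -> r <= r2 ->
    Cmean (fun t => r%:C * cis t * h (r%:C * cis t)) =
    ((2 * pi)^-1)%:C * (I^-1 * arc h r 0 (2 * pi)).
  move=> h1 h2; rewrite CmeanE; congr (_ * _); apply: (mulfI I_neq0).
  rewrite mulVKf ?I_neq0// /arc -cintZ.
    by apply: eq_cint => t _; rewrite mulrA.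
  have c2 : continuous (fun t => h (r%:C * cis t)).
    apply: (@cont_circle h r) => [|z zr]; first exact: le_trans h1.
    by apply: hc; rewrite /annulus /mkset zr h1.
  apply: continuous_cts => t.
  exact: (continuous_mulc (@continuous_circle R r t) (c2 t)).
by rewrite (E _ (lexx r1) r12) (E _ r12 (lexx r2)) (cauchy_annulus r10 r12 r21 dh).
Qed.

Lemma derivable_pow n (z : C) : derivable (fun x : C => x ^+ n) z 1.
Proof.
elim: n => [|n IH].
  rewrite (_ : (fun x : C => x ^+ 0) = cst 1); first exact: derivable_const.
  by apply/funext => x; rewrite expr0.
rewrite (_ : (fun x : C => x ^+ n.+1) = (fun x => x * x ^+ n)).
  exact: (derivable_mulc (derivable_ident z) IH).
by apply/funext => x; rewrite exprS.
Qed.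

Lemma derivable_powV n (z : C) : z != 0 -> derivable (fun x : C => (x ^+ n)^-1) z 1.
Proof.
move=> z0; have zn : z ^+ n != 0 by rewrite expf_neq0.
exact: (@derivable_invc R (fun x => x ^+ n) z zn (@derivable_pow n z)).
Qed.

Lemma Cmean_pow n : (0 < n)%N -> Cmean (fun t => (cis t : C) ^+ n) = 0.
Proof.
case: n => // n _.
have := @Cmean_annulus 0 1 (fun z => z ^+ n) (lexx 0) ler01 (lexx 1)
  (fun z _ => @derivable_pow n z).
rewrite (_ : Cmean _ = 0).
  by move=> ->; apply: eq_Cmean => t; rewrite mul1r exprS.
rewrite -[RHS]Cmean_cst; apply: eq_Cmean => t; by rewrite !mul0r.
Qed.

Lemma polar_neq0 r t : 0 < r -> r%:C * cis t != 0 :> C.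
Proof. by move=> r0; rewrite -normc_gt0 normc_polar// ltW. Qed.

(** The Taylor coefficient, as a mean over the circle of radius 1/2: an arbitrary
    choice by coefE. *)
Definition coef f n : C := Cmean (fun t => f ((1 / 2)%:C * cis t) / ((1 / 2)%:C * cis t) ^+ n).

Lemma coefE f n r : analytic_on disc f -> 0 < r -> r < 1 ->
  Cmean (fun t => f (r%:C * cis t) / (r%:C * cis t) ^+ n) = coef f n.
Proof.
move=> fa r0 r1.
have half : 0 < 1 / 2 :> R by lra.
have dh z : 0 < normc z -> normc z < 1 -> derivable (fun z => f z / z ^+ n.+1) z 1.
  move=> z0 z1; apply: (derivable_mulc (fa _ z1)).
  by apply: derivable_powV; rewrite -normc_gt0.
have E s : 0 < s -> Cmean (fun t => f (s%:C * cis t) / (s%:C * cis t) ^+ n) =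
    Cmean (fun t => s%:C * cis t * (f (s%:C * cis t) / (s%:C * cis t) ^+ n.+1)).
  move=> s0; apply: eq_Cmean => t.
  by rewrite exprS invfM mulrCA (mulVKf (polar_neq0 t s0)).
rewrite /coef (E r r0) (E _ half).
have [h|/ltW h] := leP r (1 / 2).
  apply: (@Cmean_annulus r (1 / 2) (fun z => f z / z ^+ n.+1)); [lra|exact: h|lra|].
  by move=> z /andP[z1 z2]; apply: dh; [exact: lt_le_trans z1|apply: le_lt_trans z2 _; lra].
apply/esym; apply: (@Cmean_annulus (1 / 2) r (fun z => f z / z ^+ n.+1)); [lra|exact: h|lra|].
by move=> z /andP[z1 z2]; apply: dh; [apply: lt_le_trans z1; lra|exact: le_lt_trans z2 _].
Qed.

Lemma analytic_cst (k : C) : analytic_on disc (fun=> k).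
Proof. by move=> z _; exact: derivable_const. Qed.

(** The mean is a constant c independent of r, while dividing r by 2 multiplies
    it by 2^n; hence c = 0. *)
Lemma Cmean_powV n r : (0 < n)%N -> 0 < r -> r < 1 ->
  Cmean (fun t => ((r%:C * cis t) ^+ n)^-1) = 0.
Proof.
move=> n0 r0 r1.
have E s : 0 < s -> s < 1 -> Cmean (fun t => ((s%:C * cis t) ^+ n)^-1) =
    coef (fun=> 1) n.
  move=> s0 s1; rewrite -(@coefE (fun=> 1) n s (@analytic_cst 1) s0 s1).
  by apply: eq_Cmean => t; rewrite mul1r.
have cX (s : R) : 0 < s -> continuous (fun t => ((s%:C * cis t) ^+ n)^-1 : C).
  move=> s0; apply: (@cont_circle (fun z => (z ^+ n)^-1) s); first exact: ltW.
  move=> z zs; apply: analytic_continuous; apply: derivable_powV.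
  by rewrite -normc_gt0 zs.
have r20 : 0 < r / 2 by lra.
have r21 : r / 2 < 1 by lra.
have : Cmean (fun t => (((r / 2)%:C * cis t) ^+ n)^-1) =
    2 ^+ n * Cmean (fun t => ((r%:C * cis t) ^+ n)^-1).
  rewrite -CmeanZ//; last exact: cX.
  apply: eq_Cmean => t.
  have -> : (r / 2)%:C * cis t = (r%:C * cis t) / 2.
    by rewrite rmorphM fmorphV rmorph_nat mulrAC.
  by rewrite expr_div_n invf_div.
rewrite (E _ r0 r1) (E _ r20 r21).
move/eqP; rewrite -subr_eq0 -{1}[coef _ _]mul1r -mulrBl mulf_eq0 => /orP[|/eqP//].
rewrite subr_eq0 => /eqP/(congr1 (fun z : C => normc z)).
rewrite normc1 normcX normc_nat => /esym/eqP.
rewrite -natrX pnatr_eq1 -[X in _ == X](expn0 2) eqn_exp2l// => /eqP n00.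
by rewrite n00 in n0.
Qed.

End cauchy.

(** * The Cauchy formula and the Taylor series *)
Section taylor.
Variable R : realType.
Local Notation C := R[i].
Implicit Types (f h : C -> C) (r t : R).

Lemma Cmean_bound_itv (F : R -> C) (k : R) : continuous F ->
  (forall t, 0 <= t <= 2 * pi -> normc (F t) <= k) -> normc (Cmean F) <= 2 * k.
Proof.
move=> cF Fk; have p0 := pi2_gt0 R.
rewrite CmeanE normcM normc_real ?invr_ge0 ?(ltW p0)// ler_pdivrMl//.
by have := cint_bound (ltW p0) (continuous_cts cF) Fk; rewrite subr0 [X in _ <= X -> _]mulrC.
Qed.

Lemma analytic_quotient f (z0 : C) : derivable f z0 1 ->
  exists l : C, {for z0, continuous (fun z => if z == z0 then l else (f z - f z0) / (z - z0))}.
Proof.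
move=> /cvg_ex[l /cvg_normcP H]; exists l.
apply/continuous_normcP => e e0.
have /nbhs_normcP[d d0 Hd] := H _ e0.
exists d => // w wz; rewrite eqxx.
case: eqVneq => [_|wz0]; first by rewrite subrr normc0.
have /Hd : normc (w - z0 - 0) < d by rewrite subr0.
move=> /(_ _); rewrite /= subr_eq0 => /(_ wz0).
have -> : (w - z0) *: (1 : C) + z0 = w by rewrite /GRing.scale /= mulr1 subrK.
by rewrite /GRing.scale /= mulrC.
Qed.

Lemma derivable_quotient f (z0 l z : C) : derivable f z 1 -> z != z0 ->
  derivable (fun z => if z == z0 then l else (f z - f z0) / (z - z0)) z 1.
Proof.
move=> df zz0.
have d1 := derivable_subc df (derivable_const (f z0) z).
have d2 := derivable_subc (derivable_ident z) (derivable_const z0 z).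
have z0' : z - z0 != 0 by rewrite subr_eq0.
have := derivable_mulc d1 (@derivable_invc R (fun x => x - z0) z z0' d2).
apply: (@near_eq_derivable _ C C).
apply/nbhs_normcP; exists (normc (z - z0)); first by rewrite normc_gt0.
move=> w wz; case: eqVneq => // wz0.
by move: wz; rewrite wz0 normcB ltxx.
Qed.

(** The difference quotient h of f at z0, extended by continuity, is analytic
    off z0 only, so Goursat's theorem is not available in an annulus containing
    z0.  Circles of radius less than |z0| give mean 0 and circles of radius in
    (|z0|, r] all give the same mean; the two values agree because the mean of
    the continuous function z * h(z) depends continuously on the radius, also
    across the radius |z0|. *)
Lemma cauchy_quotient f (z0 : C) r : analytic_on disc f -> normc z0 < r -> r < 1 ->
  Cmean (fun t => r%:C * cis t * ((f (r%:C * cis t) - f z0) / (r%:C * cis t - z0))) = 0.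
Proof.
move=> fa z0r r1; set x0 := normc z0.
have x00 : 0 <= x0 := normc_ge0 z0.
have z0d : disc z0 by rewrite /disc /mkset (lt_trans z0r).
have [l hl] := analytic_quotient (fa _ z0d).
pose h := fun z => if z == z0 then l else (f z - f z0) / (z - z0).
have dh z : normc z < 1 -> normc z != x0 -> derivable h z 1.
  move=> z1 zx; apply: (@derivable_quotient f z0 l z (fa z z1)).
  by apply: contra zx => /eqP ->.
have ch z : normc z < 1 -> {for z, continuous h}.
  move=> z1; have [->//|zz0] := eqVneq z z0.
  exact: analytic_continuous (@derivable_quotient f z0 l z (fa z z1) zz0).
pose k z : C := z * h z.
have ck z : normc z < 1 -> {for z, continuous k}.
  by move=> z1; exact: (continuous_mulc (continuous_ident z) (ch z z1)).
pose c (s : R) := Cmean (fun t => k (s%:C * cis t)).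
have cc s : 0 <= s -> s < 1 -> continuous (fun t => k (s%:C * cis t)).
  by move=> s0 s1; apply: (@cont_circle R k s s0) => z zs; apply: ck; rewrite zs.
have x01 : x0 < 1 := lt_trans z0r r1.
(* inside the circle through z0, the radius may be shrunk to 0 *)
have cin s : 0 <= s -> s < x0 -> c s = 0.
  move=> s0 sx.
  have dA z : annulus 0 s z -> derivable h z 1.
    move=> /andP[_ zs]; apply: dh; first by rewrite (le_lt_trans zs)// (lt_trans sx).
    by rewrite lt_eqF// (le_lt_trans zs).
  have s1 : s <= 1 by rewrite ltW// (lt_trans sx).
  have := @Cmean_annulus R 0 s h (lexx 0) s0 s1 dA.
  rewrite (_ : Cmean _ = 0); first by move=> ->.
  by rewrite -[RHS]Cmean_cst; apply: eq_Cmean => t; rewrite !mul0r.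
have cout s : x0 < s -> s <= r -> c s = c r.
  move=> xs sr.
  have dA z : annulus s r z -> derivable h z 1.
    move=> /andP[sz zr]; apply: dh; first exact: le_lt_trans r1.
    by rewrite gt_eqF// (lt_le_trans xs).
  exact: (@Cmean_annulus R s r h (le_trans x00 (ltW xs)) sr (ltW r1) dA).
have ccont e : 0 < e -> exists2 d, 0 < d & forall s, 0 <= s -> s < 1 -> `|s - x0| < d ->
    normc (c s - c x0) <= 2 * e.
  move=> e0; have [|d d0 hd] := @circle_tube _ k x0 e x00 e0.
    by move=> z zx; apply: ck; rewrite zx.
  exists d => // s s0 s1 sd; rewrite /c -CmeanB; [|exact: cc|exact: cc].
  apply: Cmean_bound_itv => [t|t t2]; last by rewrite ltW// hd.
  have cx := cc x0 x00 x01 t; have cs := cc s s0 s1 t.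
  apply: cvgB; [exact: cs|exact: cx].
have small (v : C) : (forall e, 0 < e -> normc v <= e) -> v = 0.
  move=> hv; apply/eqP; rewrite -normc_eq0 eq_le normc_ge0 andbT.
  by apply/ler_addgt0Pr => e e0; rewrite add0r hv.
have cx0 : c x0 = 0.
  apply: small => e e0.
  move: x00; rewrite le_eqVlt => /predU1P[x00|x00].
    rewrite (_ : c x0 = 0) ?normc0 1?ltW//.
    rewrite /c -[RHS]Cmean_cst; apply: eq_Cmean => t.
    by rewrite /k -x00 !mul0r.
  have [d d0 hd] := ccont (e / 2) (divr_gt0 e0 (ltr0n _ 2)).
  pose s := Num.max 0 (x0 - d / 2).
  have s0 : 0 <= s by rewrite le_max lexx.
  have sx : s < x0 by rewrite gt_max x00 /=; lra.
  have := hd s s0 (lt_trans sx x01); rewrite cin// sub0r normcN => h1.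
  rewrite (le_trans (h1 _))//; last by lra.
  by rewrite ltr0_norm ?subr_lt0// opprB ltrBlDr -ltrBlDl lt_max; apply/orP; right; lra.
rewrite (_ : Cmean _ = c r); last first.
  apply: eq_Cmean => t; rewrite /k /h; case: eqVneq => // E.
  have := normc_polar t (ltW (le_lt_trans x00 z0r)); rewrite E => E'.
  by move: z0r; rewrite E' ltxx.
apply: small => e e0.
have [d d0 hd] := ccont (e / 2) (divr_gt0 e0 (ltr0n _ 2)).
pose s := Num.min r (x0 + d / 2).
have sx : x0 < s by rewrite lt_min z0r /=; lra.
have sr : s <= r by rewrite ge_min lexx.
have := hd s (le_trans x00 (ltW sx)) (le_lt_trans sr r1); rewrite cx0 subr0 (cout s)// => h1.
rewrite (le_trans (h1 _))//; last by lra.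
rewrite gtr0_norm ?subr_gt0// ltrBlDr gt_min; apply/orP; right; lra.
Qed.

End taylor.

Section taylor_parseval.
Variable R : realType.
Local Notation C := R[i].
Local Notation cRe := (@complex.Re R).
Implicit Types (f h : C -> C) (r t : R).

Definition psum f n (z : C) : C := \sum_(0 <= k < n) coef f k * z ^+ k.

Lemma geometric_remainder (w z : C) n : w != 0 -> w != z ->
  w / (w - z) = \sum_(0 <= k < n) (z / w) ^+ k + (z / w) ^+ n * (w / (w - z)).
Proof.
move=> w0 wz; have wz' : w - z != 0 by rewrite subr_eq0.
have key : w / (w - z) = 1 + z / w * (w / (w - z)) by field; rewrite wz' w0.
elim: n => [|n IH]; first by rewrite big_nil add0r expr0 mul1r.
rewrite {1}IH big_nat_recr//= -addrA; congr (_ + _).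
by rewrite {1}key mulrDr mulr1 exprSr mulrA.
Qed.

Lemma circle_bounded (F : R -> C) : continuous F ->
  exists2 M : R, 0 <= M & forall t, 0 <= t <= 2 * pi -> normc (F t) <= M.
Proof.
move=> cF.
have [||c _ H] := @EVT_max _ (fun t => normc (F t)) 0 (2 * pi).
- exact: pi2_ge0.
- by apply: continuous_subspaceT => t; exact: continuous_normc (cF t).
- exists (normc (F c)); first exact: normc_ge0.
  by move=> t tpi; apply: H; rewrite in_itv.
Qed.

Lemma cont_analytic f r : analytic_on disc f -> 0 <= r -> r < 1 ->
  continuous (fun t => f (r%:C * cis t)).
Proof.
move=> fa r0 r1; apply: (@cont_circle R f r r0) => z zr.
by apply: analytic_continuous; apply: fa; rewrite /disc /mkset zr.
Qed.

Lemma polar_sub_neq0 r t (z : C) : normc z < r -> r%:C * cis t - z != 0.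
Proof.
move=> zr; rewrite -normc_gt0 (lt_le_trans _ (ge_normcB _ _))//.
by rewrite normc_polar ?subr_gt0// ltW// (le_lt_trans (normc_ge0 z)).
Qed.

Lemma cont_kernel r (z : C) : normc z < r ->
  continuous (fun t => r%:C * cis t / (r%:C * cis t - z)).
Proof.
move=> zr; have r0 : 0 <= r by rewrite ltW// (le_lt_trans (normc_ge0 z)).
apply: (@cont_circle R (fun w => w / (w - z)) r r0) => w wr.
apply: analytic_continuous; apply: (derivable_mulc (derivable_ident w)).
have wz : w - z != 0.
  by rewrite -normc_gt0 (lt_le_trans _ (ge_normcB _ _))// wr subr_gt0.
exact: (@derivable_invc R (fun w => w - z) w wz
  (derivable_subc (derivable_ident w) (derivable_const z w))).
Qed.

(** The Cauchy kernel w / (w - z) is expanded as a finite geometric series in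
    z / w: the terms integrate to the Taylor polynomial, the remainder is
    bounded on the circle. *)
Lemma taylor_remainder f (M s r : R) (z : C) n : analytic_on disc f -> s < r -> r < 1 ->
  normc z <= s -> (forall t, 0 <= t <= 2 * pi -> normc (f (r%:C * cis t)) <= M) ->
  normc (Cmean (fun t => f (r%:C * cis t) * (r%:C * cis t / (r%:C * cis t - z))) - psum f n z)
  <= 2 * (M * ((s / r) ^+ n * (r / (r - s)))).
Proof.
move=> fa sr r1 zs fM.
have s0 : 0 <= s := le_trans (normc_ge0 z) zs.
have r0 : 0 < r := le_lt_trans s0 sr.
have zr : normc z < r := le_lt_trans zs sr.
have cf := cont_analytic fa (ltW r0) r1.
have ck := cont_kernel zr.
have cP k : continuous (fun t => z ^+ k * (f (r%:C * cis t) / (r%:C * cis t) ^+ k)).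
  apply: (@cont_circle R (fun w => z ^+ k * (f w / w ^+ k)) r (ltW r0)) => w wr.
  apply: analytic_continuous; apply: (derivable_mulc (derivable_const _ w)).
  apply: derivable_mulc; first by apply: fa; rewrite /disc /mkset wr.
  by apply: derivable_powV; rewrite -normc_gt0 wr.
have -> : psum f n z = Cmean (fun t => \sum_(0 <= k < n)
    z ^+ k * (f (r%:C * cis t) / (r%:C * cis t) ^+ k)).
  rewrite (Cmean_sum n cP); apply: eq_bigr => k _.
  have c2 : continuous (fun t => f (r%:C * cis t) / (r%:C * cis t) ^+ k).
    apply: (@cont_circle R (fun w => (f w / w ^+ k)) r (ltW r0)) => w wr.
    apply: analytic_continuous.
    apply: derivable_mulc; first by apply: fa; rewrite /disc /mkset wr.
    by apply: derivable_powV; rewrite -normc_gt0 wr.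
  rewrite -(coefE k fa r0 r1) mulrC.
  exact: (esym (CmeanZ (z ^+ k) c2)).
have cS := @cont_sum R n _ cP.
have cFk : continuous (fun t => f (r%:C * cis t) * (r%:C * cis t / (r%:C * cis t - z))).
  by move=> t; exact: (continuous_mulc (cf t) (ck t)).
rewrite -(CmeanB cFk cS); apply: Cmean_bound_itv.
  by move=> t; exact: (cvgB (cFk t) (cS t)).
move=> t tpi; set w := r%:C * cis t.
have nw : normc w = r by exact: normc_polar (ltW r0).
have w0 : w != 0 := polar_neq0 t r0.
have wz' : w - z != 0 := polar_sub_neq0 t zr.
have wz : w != z by rewrite -subr_eq0.
have fw : normc (f w) <= M := fM t tpi.
clearbody w.
rewrite (geometric_remainder n w0 wz) mulrDr mulr_sumr.
rewrite (eq_bigr (fun k => z ^+ k * (f w / w ^+ k))); last first.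
  by move=> k _; rewrite expr_div_n mulrCA.
rewrite [X in X - _]addrC addrK !normcM normcX !normcM !normcV nw.
rewrite ler_pM ?normc_ge0//.
  by rewrite mulr_ge0 ?exprn_ge0// ?divr_ge0 ?mulr_ge0 ?invr_ge0 ?normc_ge0// ltW.
apply: ler_pM.
- by rewrite exprn_ge0// divr_ge0 ?normc_ge0// ltW.
- by rewrite divr_ge0 ?normc_ge0// ltW.
- by rewrite lerXn2r ?nnegrE ?divr_ge0 ?normc_ge0 ?(ltW r0)// ler_pM2r ?invr_gt0.
- rewrite ler_pM2l// lef_pV2 ?posrE ?subr_gt0// ?normc_gt0//.
  by rewrite (le_trans _ (ge_normcB _ _))// nw lerD2l lerN2.
Qed.

Lemma geometric_small (q K e : R) : 0 <= q -> q < 1 -> 0 < e ->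
  exists2 n, (0 < n)%N & K * q ^+ n < e.
Proof.
move=> q0 q1 e0.
have qn : (fun n => K * q ^+ n) @ \oo --> K * 0.
  by apply: cvgM; [exact: cvg_cst|apply: cvg_expr; rewrite ger0_norm].
rewrite mulr0 in qn; move/cvgrPdist_lt : qn => /(_ _ e0)[n _ hn].
exists n.+1 => //; have := hn n.+1 (leqnSn n).
by rewrite /= sub0r normrN; exact: le_lt_trans (ler_norm _).
Qed.

(** Writing f = (f - f(z)) + f(z), the first part integrates to 0 by
    cauchy_quotient; the mean of the kernel itself is 1, by taylor_remainder
    applied to the constant 1 with n going to infinity. *)
Lemma cauchy_formula f r (z : C) : analytic_on disc f -> normc z < r -> r < 1 ->
  Cmean (fun t => f (r%:C * cis t) * (r%:C * cis t / (r%:C * cis t - z))) = f z.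
Proof.
move=> fa zr r1.
have s0 := normc_ge0 z.
have r0 : 0 < r := le_lt_trans s0 zr.
have ck := cont_kernel zr; have cf := cont_analytic fa (ltW r0) r1.
have kernel1 : Cmean (fun t => r%:C * cis t / (r%:C * cis t - z)) = 1.
  apply/eqP; rewrite -subr_eq0 -normc_eq0 eq_le normc_ge0 andbT.
  apply/ler_addgt0Pr => e e0; rewrite add0r.
  have q1 : normc z / r < 1 by rewrite ltr_pdivrMr// mul1r.
  have [n n0 hn] := geometric_small (2 * (r / (r - normc z))) (divr_ge0 s0 (ltW r0)) q1 e0.
  have := @taylor_remainder (fun=> 1) 1 (normc z) r z n (@analytic_cst R 1) zr r1 (lexx _).
  have -> : psum (fun=> 1) n z = 1.
    case: n n0 {hn} => // n _; rewrite /psum big_nat_recl//= expr0 mulr1 big1 ?addr0.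
      by rewrite /coef -[RHS]Cmean_cst; apply: eq_Cmean => t; rewrite expr0 divr1.
    move=> k _; rewrite -(@coefE R (fun=> 1) k.+1 r (@analytic_cst R 1) r0 r1).
    rewrite (_ : Cmean _ = 0) ?mul0r//.
    rewrite -[RHS](@Cmean_powV R k.+1 r)//; apply: eq_Cmean => t.
    by rewrite mul1r.
  have -> : Cmean (fun t => 1 * (r%:C * cis t / (r%:C * cis t - z))) =
      Cmean (fun t => r%:C * cis t / (r%:C * cis t - z)).
    by apply: eq_Cmean => t; rewrite mul1r.
  move=> H; rewrite (le_trans (H _)) ?normc1//.
  by rewrite mul1r (le_trans _ (ltW hn))// -mulrA [_ ^+ n * _]mulrC.
have := cauchy_quotient fa zr r1.
have -> : Cmean (fun t => r%:C * cis t * ((f (r%:C * cis t) - f z) / (r%:C * cis t - z))) =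
  Cmean (fun t => f (r%:C * cis t) * (r%:C * cis t / (r%:C * cis t - z)) -
     f z * (r%:C * cis t / (r%:C * cis t - z))).
  by apply: eq_Cmean => t; rewrite mulrCA mulrBl.
have cfk : continuous (fun t => f (r%:C * cis t) * (r%:C * cis t / (r%:C * cis t - z))).
  by move=> t; exact: (continuous_mulc (cf t) (ck t)).
have cfz : continuous (fun t => f z * (r%:C * cis t / (r%:C * cis t - z))).
  by move=> t; apply: cvgM; [exact: cvg_cst|exact: ck].
rewrite (CmeanB cfk cfz) (CmeanZ _ ck) kernel1 mulr1 => /eqP.
by rewrite subr_eq0 => /eqP.
Qed.

(** The rate (s / r)^n of taylor_remainder, with r halfway between s and 1. *)
Lemma taylor f (s : R) : analytic_on disc f -> 0 <= s -> s < 1 ->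
  exists M q : R, [/\ 0 <= M, 0 <= q, q < 1 &
    forall z n, normc z <= s -> normc (f z - psum f n z) <= M * q ^+ n].
Proof.
move=> fa s0 s1; pose r := (1 + s) / 2.
have sr : s < r by rewrite /r; lra.
have r1 : r < 1 by rewrite /r; lra.
have r0 : 0 < r := le_lt_trans s0 sr.
have [M M0 HM] := circle_bounded (cont_analytic fa (ltW r0) r1).
exists (2 * (M * (r / (r - s)))), (s / r); split.
- by rewrite mulr_ge0// mulr_ge0// divr_ge0// ?subr_ge0 ltW.
- by rewrite divr_ge0// ltW.
- by rewrite ltr_pdivrMr// mul1r.
move=> z n zs.
rewrite -(cauchy_formula fa (le_lt_trans zs sr) r1).
rewrite (le_trans (taylor_remainder n fa sr r1 zs HM))//.
by rewrite le_eqVlt; apply/orP; left; apply/eqP; ring.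
Qed.

End taylor_parseval.

(** * Parseval's identity and the coefficient form of the Hardy norm *)
Section parseval.
Variable R : realType.
Local Notation C := R[i].
Local Notation cRe := (@complex.Re R).
Implicit Types (f g h : C -> C) (r t : R).

Lemma normc_dist (x y : C) : `|normc x - normc y| <= normc (x - y).
Proof.
rewrite ler_norml ge_normcB andbT lerNl opprB normcB.
exact: ge_normcB.
Qed.

Lemma conjcM (x y : C) : conjc (x * y) = conjc x * conjc y.
Proof. exact: rmorphM. Qed.

Lemma conjcX (x : C) n : conjc (x ^+ n) = conjc x ^+ n.
Proof. exact: rmorphXn. Qed.

Lemma conjc_sum n (F : nat -> C) :
  conjc (\sum_(0 <= k < n) F k) = \sum_(0 <= k < n) conjc (F k).
Proof. exact: rmorph_sum. Qed.

Lemma cont_cisX n : continuous (fun t : R => cis t ^+ n : C).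
Proof.
have cX (z : C) : normc z = 1 -> {for z, continuous (fun x : C => x ^+ n)}.
  by move=> _; exact: analytic_continuous (@derivable_pow R n z).
have H := @cont_circle R (fun x : C => x ^+ n) 1 ler01 cX.
rewrite (_ : (fun t => cis t ^+ n) = (fun t => (1%:C * cis t) ^+ n))//.
by apply/funext => t; rewrite mul1r.
Qed.

(** Orthogonality of the characters: adding one frequency n, the cross terms
    have the positive frequencies n - k and mean zero. *)
Lemma mean_sq_trig (b : nat -> C) n :
  mean (fun t => normc (\sum_(0 <= k < n) b k * cis t ^+ k) ^+ 2) =
  \sum_(0 <= k < n) normc (b k) ^+ 2.
Proof.
have cb k : continuous (fun t => b k * cis t ^+ k).
  by move=> t; exact: (continuous_mulc (@cvg_cst _ (b k) _ _ _) (@cont_cisX k t)).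
elim: n => [|n IH].
  rewrite big_nil -[RHS]mean_cst; apply: eq_mean => t.
  by rewrite big_nil normc0 expr0n.
pose P t := \sum_(0 <= k < n) b k * cis t ^+ k.
have cP : continuous P by exact: (@cont_sum R n _ cb).
pose cross t := \sum_(0 <= k < n) (conjc (b k) * b n) * cis t ^+ (n - k).
have crossE t : cRe (conjc (P t) * (b n * cis t ^+ n)) = cRe (cross t).
  congr (cRe _); rewrite /P /cross conjc_sum mulr_suml.
  apply: eq_big_nat => k /andP[_ kn].
  rewrite conjcM conjcX cis_conj.
  rewrite -[in cis t ^+ n](subnK (ltnW kn)) exprD exprVn.
  by rewrite mulrACA; congr (_ * _); rewrite mulrCA mulVf ?mulr1// expf_neq0 ?cis_neq0.
have cc : continuous cross.
  apply: (@cont_sum R n) => k t.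
  exact: (continuous_mulc (@cvg_cst _ (conjc (b k) * b n) _ _ _) (@cont_cisX (n - k) t)).
have cross0 : mean (fun t => cRe (cross t)) = 0.
  rewrite -Re_Cmean (_ : Cmean cross = 0)//.
  have cck k : continuous (fun t => (conjc (b k) * b n) * cis t ^+ (n - k)).
    by move=> t; exact: (continuous_mulc (@cvg_cst _ (conjc (b k) * b n) _ _ _) (@cont_cisX (n - k) t)).
  rewrite /cross (Cmean_sum n cck) big_nat_cond big1// => k /andP[/andP[_ kn] _].
  by rewrite (CmeanZ _ (@cont_cisX (n - k))) Cmean_pow ?mulr0// subn_gt0.
rewrite big_nat_recr//= -IH.
rewrite (@eq_mean _ _ (fun t => (normc (P t) ^+ 2 + normc (b n) ^+ 2) + 2 * cRe (cross t))); last first.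
  move=> t; rewrite big_nat_recr//= normc_sqrD -/(P t) crossE.
  by rewrite normcM normcX normc_cis expr1n mulr1.
have c1 : continuous (fun t => normc (P t) ^+ 2).
  by move=> t; exact: (continuous_normc2 (cP t)).
have c2 : continuous (fun t => cRe (cross t)).
  by move=> t; exact: (continuous_Re (cc t)).
have c3 : continuous (fun t => normc (P t) ^+ 2 + normc (b n) ^+ 2).
  by move=> t; apply: cvgD; [exact: c1|exact: cvg_cst].
have c4 : continuous (fun t => 2 * cRe (cross t)).
  by move=> t; apply: cvgM; [exact: cvg_cst|exact: c2].
rewrite (meanD c3 c4) (meanZ _ c2) cross0 mulr0 addr0.
rewrite meanD ?mean_cst//.
by move=> t; exact: cvg_cst.
Qed.

Definition mean_sq f r := mean (fun t => normc (f (r%:C * cis t)) ^+ 2).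
Definition coef_sq f n := \sum_(0 <= k < n) normc (coef f k) ^+ 2.

Lemma cont_sq f r : analytic_on disc f -> 0 <= r -> r < 1 ->
  continuous (fun t => normc (f (r%:C * cis t)) ^+ 2).
Proof.
move=> fa r0 r1; have cf := cont_analytic fa r0 r1.
by move=> t; exact: (continuous_normc2 (cf t)).
Qed.

Lemma mean_sq_psum f n r : 0 <= r -> mean (fun t => normc (psum f n (r%:C * cis t)) ^+ 2) =
  \sum_(0 <= k < n) normc (coef f k) ^+ 2 * (r ^+ 2) ^+ k.
Proof.
move=> r0; transitivity (\sum_(0 <= k < n) normc (coef f k * r%:C ^+ k) ^+ 2).
  rewrite -mean_sq_trig; apply: eq_mean => t; congr (normc _ ^+ 2).
  by apply: eq_bigr => k _; rewrite exprMn mulrA.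
apply: eq_bigr => k _.
by rewrite normcM normcX normc_real// exprMn exprAC.
Qed.

Lemma analytic_psum f n (z : C) : derivable (psum f n) z 1.
Proof.
rewrite /psum; elim: n => [|n IH].
  under eq_fun do rewrite big_nil; exact: derivable_const.
under eq_fun do rewrite big_nat_recr//=.
apply: (derivable_addc IH).
exact: (derivable_mulc (derivable_const _ z) (@derivable_pow R n z)).
Qed.

(** Exact for Taylor polynomials by orthogonality; these converge to f uniformly
    on the circle, hence so do the squared moduli. *)
Lemma parseval f r : analytic_on disc f -> 0 <= r -> r < 1 ->
  (fun n => \sum_(0 <= k < n) normc (coef f k) ^+ 2 * (r ^+ 2) ^+ k) @ \oo --> mean_sq f r.
Proof.
move=> fa r0 r1; have [M [q [M0 q0 q1 HM]]] := taylor fa r0 r1.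
have [K K0 HK] := circle_bounded (cont_analytic fa r0 r1).
apply/cvgrPdist_le => e e0.
have qn : (fun n => (M * (2 * K + M)) * q ^+ n) @ \oo --> (M * (2 * K + M)) * 0.
  by apply: cvgM; [exact: cvg_cst|apply: cvg_expr; rewrite ger0_norm].
rewrite mulr0 in qn; move/cvgrPdist_le : qn => /(_ _ e0); apply: filterS => n.
rewrite sub0r normrN ger0_norm ?mulr_ge0 ?addr_ge0 ?mulr_ge0 ?exprn_ge0// => he.
rewrite -mean_sq_psum//.
have cf := cont_sq fa r0 r1.
have cp : continuous (fun t => normc (psum f n (r%:C * cis t)) ^+ 2).
  have cpn : continuous (fun t => psum f n (r%:C * cis t)).
    apply: (@cont_circle R (psum f n) r r0) => z _.
    exact: analytic_continuous (@analytic_psum f n z).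
  by move=> t; exact: (continuous_normc2 (cpn t)).
rewrite /mean_sq -(meanB cf cp).
rewrite (le_trans _ he)//.
have cd : continuous (fun t => normc (f (r%:C * cis t)) ^+ 2 - normc (psum f n (r%:C * cis t)) ^+ 2).
  by move=> t; exact: (cvgB (cf t) (cp t)).
rewrite /mean normrM ger0_norm ?invr_ge0 ?pi2_ge0//.
rewrite ler_pdivrMl ?pi2_gt0// [X in _ <= X]mulrC.
have := @rint_bound R 0 (2 * pi) _ (M * (2 * K + M) * q ^+ n) (pi2_ge0 R) (continuous_cts cd).
rewrite subr0; apply => t tpi.
set u := f _; set v := psum _ _ _.
have uv : normc (u - v) <= M * q ^+ n.
  by apply: HM; rewrite normc_polar.
have uK : normc u <= K := HK t tpi.
have q1n : q ^+ n <= 1 by rewrite exprn_ile1// ltW.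
have vK : normc v <= K + M.
  rewrite (_ : v = u - (u - v)); last by rewrite opprB addrC subrK.
  rewrite (le_trans (le_normcB _ _))// lerD// (le_trans uv)//.
  by rewrite ler_piMr.
rewrite subr_sqr normrM.
have -> : M * (2 * K + M) * q ^+ n = (M * q ^+ n) * (K + (K + M)) by ring.
rewrite ler_pM//.
  exact: le_trans (normc_dist u v) uv.
by rewrite ger0_norm ?addr_ge0 ?normc_ge0// lerD.
Qed.

Lemma bessel f r n : analytic_on disc f -> 0 <= r -> r < 1 ->
  \sum_(0 <= k < n) normc (coef f k) ^+ 2 * (r ^+ 2) ^+ k <= mean_sq f r.
Proof.
move=> fa r0 r1; have H := parseval fa r0 r1.
rewrite -(cvg_lim (@Rhausdorff R) H).
apply: nondecreasing_cvgn_le; last by apply/cvg_ex; exists (mean_sq f r).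
apply/nondecreasing_seqP => m; rewrite big_nat_recr//= lerDl.
by rewrite mulr_ge0 ?exprn_ge0 ?normc_ge0.
Qed.

Lemma mean_sq_le f r A : analytic_on disc f -> 0 <= r -> r < 1 ->
  (forall n, coef_sq f n <= A) -> mean_sq f r <= A.
Proof.
move=> fa r0 r1 hA; have H := parseval fa r0 r1.
rewrite -(cvg_lim (@Rhausdorff R) H).
apply: limr_le; first by apply/cvg_ex; exists (mean_sq f r).
apply: nearW => n; rewrite (le_trans _ (hA n))// ler_sum_nat// => k _.
by rewrite ler_piMr ?exprn_ge0 ?normc_ge0// exprn_ile1 ?exprn_ge0// exprn_ile1// ltW.
Qed.

(** Bessel's inequality on the circle of radius r, with finitely many terms, then
    r tends to 1. *)
Lemma coef_sq_le f A : analytic_on disc f ->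
  (forall r, 0 <= r -> r < 1 -> mean_sq f r <= A) -> forall n, coef_sq f n <= A.
Proof.
move=> fa hA n.
pose B m (r : R) := \sum_(0 <= k < m) normc (coef f k) ^+ 2 * (r ^+ 2) ^+ k.
have cB m : continuous (B m).
  elim: m => [|m IH].
    rewrite (_ : B 0%N = fun=> 0); first by move=> x; exact: cvg_cst.
    by apply/funext => x; rewrite /B big_nil.
  rewrite (_ : B m.+1 = fun r => B m r + normc (coef f m) ^+ 2 * (r ^+ 2) ^+ m).
    move=> x; apply: cvgD; first exact: IH.
    apply: cvgM; first exact: cvg_cst.
    by apply: (@continuous_comp _ _ _ (fun r : R => r ^+ 2) (fun r => r ^+ m)); exact: exprn_continuous.
  by apply/funext => x; rewrite /B big_nat_recr.
have cp := cB n 1.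
have -> : coef_sq f n = B n 1.
  by apply: eq_bigr => k _; rewrite !expr1n mulr1.
have := cvg_at_left_filter cp => H.
rewrite -(cvg_lim (@Rhausdorff R) H).
apply: limr_le; first by apply/cvg_ex; eexists; exact: H.
near=> r.
have r0 : 0 <= r by near: r; apply: nbhs_left_ge; exact: ltr01.
have r1 : r < 1 by near: r; exact: nbhs_left_lt.
by rewrite (le_trans (bessel n fa r0 r1))// hA.
Unshelve. all: by end_near. Qed.

End parseval.

Section coefficient_algebra.
Variable R : realType.
Local Notation C := R[i].
Implicit Types (f g : C -> C) (r t : R) (z w : C).

Lemma cont_coef f n r : analytic_on disc f -> 0 < r -> r < 1 ->
  continuous (fun t => f (r%:C * cis t) / (r%:C * cis t) ^+ n).
Proof.
move=> fa r0 r1; apply: (@cont_circle R (fun w => f w / w ^+ n) r (ltW r0)) => w wr.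
apply: analytic_continuous.
apply: derivable_mulc; first by apply: fa; rewrite /disc /mkset wr.
by apply: derivable_powV; rewrite -normc_gt0 wr.
Qed.

Lemma half_gt0 : 0 < 1 / 2 :> R. Proof. by lra. Qed.
Lemma half_lt1 : 1 / 2 < 1 :> R. Proof. by lra. Qed.

Lemma eq_coef f g n : (forall z, disc z -> f z = g z) -> coef f n = coef g n.
Proof.
move=> fg; apply: eq_Cmean => t; rewrite fg// /disc /mkset normc_polar ?(ltW half_gt0)//.
exact: half_lt1.
Qed.

Lemma coef_lin (k : C) f g n : analytic_on disc f -> analytic_on disc g ->
  coef (fun z => k * f z + g z) n = k * coef f n + coef g n.
Proof.
move=> fa ga.
have cf := @cont_coef f n _ fa half_gt0 half_lt1.
have cg := @cont_coef g n _ ga half_gt0 half_lt1.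
have ckf : continuous (fun t => k * (f ((1 / 2)%:C * cis t) / ((1 / 2)%:C * cis t) ^+ n)).
  by move=> t; exact: (continuous_mulc (@cvg_cst _ k _ _ _) (cf t)).
rewrite /coef -(CmeanZ k cf) -(CmeanD ckf cg).
by apply: eq_Cmean => t; rewrite mulrDl mulrA.
Qed.

Lemma coef_monomial m n : coef (fun z : C => z ^+ m) n = (m == n)%:R.
Proof.
have h0 := half_gt0; have h1 := half_lt1.
have z0 t : (1 / 2)%:C * cis t != 0 :> C := polar_neq0 t h0.
case: (ltngtP m n) => mn.
- rewrite -[RHS](@Cmean_powV R (n - m) (1 / 2))// ?subn_gt0//.
  apply: eq_Cmean => t; rewrite -[in LHS](subnK (ltnW mn)) exprD invfM mulrCA divff ?mulr1//.
  by rewrite expf_neq0.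
- transitivity (((1 / 2)%:C ^+ (m - n)) * Cmean (fun t => (cis t : C) ^+ (m - n))).
    rewrite -(CmeanZ _ (@cont_cisX R (m - n))).
    apply: eq_Cmean => t; rewrite -[in LHS](subnK (ltnW mn)) exprD mulfK.
      by rewrite exprMn.
    by rewrite expf_neq0.
  by rewrite Cmean_pow ?mulr0// subn_gt0.
- rewrite mn -[RHS]Cmean_cst; apply: eq_Cmean => t.
  by rewrite divff// expf_neq0.
Qed.

Lemma coef0 n : coef (fun _ : C => 0) n = 0 :> C.
Proof. by rewrite -[RHS]Cmean_cst; apply: eq_Cmean => t; rewrite mul0r. Qed.

Lemma coef_psum f n k : coef (psum f n) k = if (k < n)%N then coef f k else 0.
Proof.
elim: n => [|n IH].
  by rewrite -[RHS](coef0 k); apply: eq_coef => z _; rewrite /psum big_nil.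
have -> : coef (psum f n.+1) k = coef (fun z => coef f n * z ^+ n + psum f n z) k.
  by apply: eq_coef => z _; rewrite /psum big_nat_recr//= addrC.
rewrite coef_lin; last 2 first.
- by move=> z _; exact: derivable_pow.
- by move=> z _; exact: analytic_psum.
rewrite coef_monomial IH ltnS.
by case: (ltngtP k n) => kn /=; rewrite ?mulr0 ?add0r// mulr1 addr0 kn.
Qed.

Definition tail f n z : C := f z - psum f n z.

Lemma analytic_tail f n : analytic_on disc f -> analytic_on disc (tail f n).
Proof.
by move=> fa z zd; exact: (derivable_subc (fa z zd) (@analytic_psum R f n z)).
Qed.

Lemma coef_tail f n k : analytic_on disc f ->
  coef (tail f n) k = if (k < n)%N then 0 else coef f k.
Proof.
move=> fa; have -> : coef (tail f n) k = coef (fun z => (-1) * psum f n z + f z) k.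
  by apply: eq_coef => z _; rewrite /tail mulN1r addrC.
rewrite (@coef_lin (-1) (psum f n) f k (fun z _ => @analytic_psum R f n z) fa).
by rewrite coef_psum mulN1r; case: ifP; rewrite ?addNr// oppr0 add0r.
Qed.

Lemma coef_sq_ge0 f n : 0 <= coef_sq f n.
Proof. by apply: sumr_ge0 => k _; rewrite exprn_ge0 ?normc_ge0. Qed.

Lemma coef_sq_nd f m n : (m <= n)%N -> coef_sq f m <= coef_sq f n.
Proof.
move=> /subnK <-; elim: (n - m)%N => // k IH.
by rewrite addSn /coef_sq big_nat_recr//= (le_trans IH)// lerDl exprn_ge0 ?normc_ge0.
Qed.

(** Removing the first n coefficients removes the first n squares.  With
    hsq below, this makes tails small in norm. *)
Lemma coef_sq_tail f n m : analytic_on disc f ->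
  coef_sq (tail f n) m + coef_sq f n <= coef_sq f (maxn m n).
Proof.
move=> fa; have [mn|/ltnW nm] := leqP m n.
  rewrite (_ : coef_sq (tail f n) m = 0) ?add0r//.
  rewrite /coef_sq big_nat_cond big1// => k /andP[/andP[_ km] _].
  by rewrite coef_tail// (leq_trans km mn) normc0 expr0n.
have split_sq g : coef_sq g m = coef_sq g n + \sum_(n <= k < m) normc (coef g k) ^+ 2.
  by rewrite /coef_sq (@big_cat_nat _ _ _ n).
rewrite split_sq (split_sq f) addrC lerD2l.
have -> : coef_sq (tail f n) n = 0.
  rewrite /coef_sq big_nat_cond big1// => k /andP[/andP[_ kn] _].
  by rewrite coef_tail// kn normc0 expr0n.
rewrite add0r le_eqVlt; apply/orP; left; apply/eqP; apply: eq_big_nat => k /andP[nk _].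
by rewrite coef_tail// ltnNge nk.
Qed.

Lemma cauchy_schwarz_sum (a b : nat -> R) m n :
  (forall k, 0 <= a k) -> (forall k, 0 <= b k) ->
  (\sum_(m <= k < n) a k * b k) ^+ 2 <=
  (\sum_(m <= k < n) a k ^+ 2) * (\sum_(m <= k < n) b k ^+ 2).
Proof.
move=> a0 b0; have [nm|/ltnW mn] := leqP n m.
  by rewrite !big_geq// expr0n mul0r.
rewrite -(subnKC mn); elim: (n - m)%N => [|d IH]; first by rewrite addn0 !big_geq// expr0n mul0r.
rewrite addnS !big_nat_recr ?leq_addr//=.
set S := \sum_(_ <= _ < _) _ in IH *; set A := \sum_(_ <= _ < _) _ in IH *.
set B := \sum_(_ <= _ < _) _ in IH *.
have A0 : 0 <= A by apply: sumr_ge0 => k _; exact: sqr_ge0.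
have B0 : 0 <= B by apply: sumr_ge0 => k _; exact: sqr_ge0.
have S0 : 0 <= S by apply: sumr_ge0 => k _; exact: mulr_ge0.
set x := a _; set y := b _.
have x0 : 0 <= x := a0 _; have y0 : 0 <= y := b0 _.
have key : 2 * S * (x * y) <= A * y ^+ 2 + B * x ^+ 2.
  rewrite -(ler_pXn2r (n := 2))// ?nnegrE ?addr_ge0 ?mulr_ge0 ?exprn_ge0//.
  have h1 : 0 <= (A * y ^+ 2 - B * x ^+ 2) ^+ 2 := sqr_ge0 _.
  have h2 : S ^+ 2 * (x * y) ^+ 2 <= A * B * (x * y) ^+ 2 by rewrite ler_wpM2r ?sqr_ge0.
  have e1 : (2 * S * (x * y)) ^+ 2 = 4 * (S ^+ 2 * (x * y) ^+ 2) by ring.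
  have e2 : (A * y ^+ 2 + B * x ^+ 2) ^+ 2 =
    (A * y ^+ 2 - B * x ^+ 2) ^+ 2 + 4 * (A * B * (x * y) ^+ 2) by ring.
  by rewrite e1 e2; lra.
have -> : (S + x * y) ^+ 2 = S ^+ 2 + 2 * S * (x * y) + x ^+ 2 * y ^+ 2 by ring.
have -> : (A + x ^+ 2) * (B + y ^+ 2) = A * B + (A * y ^+ 2 + B * x ^+ 2) + x ^+ 2 * y ^+ 2 by ring.
by rewrite lerD2r lerD.
Qed.

Lemma geometric_tail (x : R) m n : 0 <= x -> x < 1 ->
  \sum_(m <= k < n) x ^+ k <= x ^+ m / (1 - x).
Proof.
move=> x0 x1; have x1' : 0 < 1 - x by rewrite subr_gt0.
have [nm|/ltnW mn] := leqP n m.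
  by rewrite big_geq// divr_ge0 ?exprn_ge0// ltW.
rewrite ler_pdivlMr// -(subnKC mn).
have -> : (\sum_(m <= k < m + (n - m)) x ^+ k) * (1 - x) = x ^+ m - x ^+ (m + (n - m)).
  elim: (n - m)%N => [|d IH]; first by rewrite addn0 big_geq// mul0r subrr.
  by rewrite addnS big_nat_recr ?leq_addr//= mulrDl IH exprS; ring.
by rewrite lerBlDr lerDl exprn_ge0.
Qed.

Lemma psum_cvg f z : analytic_on disc f -> disc z -> psum f n z @[n --> \oo] --> f z.
Proof.
move=> fa zd; have [M [q [M0 q0 q1 HM]]] := taylor fa (normc_ge0 z) zd.
apply/cvg_normcP => e e0.
have [n n0 hn] := geometric_small M q0 q1 e0.
exists n => // m /= nm.
rewrite normcB (le_lt_trans (HM z m (lexx _)))// (le_lt_trans _ hn)//.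
by rewrite ler_wpM2l// ler_wiXn2l// ltW.
Qed.

(** Weighted Cauchy-Schwarz inequality: the weight s^k goes with the coefficients
    and |w|^k is summed as a geometric series. *)
Lemma tail_bound f s w A n : analytic_on disc f -> 0 <= s -> s <= 1 -> disc w ->
  (forall m, \sum_(0 <= k < m) normc (coef f k) ^+ 2 * (s ^+ 2) ^+ k <= A) ->
  normc (tail f n (s%:C * w)) ^+ 2 <= A * ((normc w ^+ 2) ^+ n / (1 - normc w ^+ 2)).
Proof.
move=> fa s0 s1 wd hA.
have wd2 : normc w ^+ 2 < 1 by rewrite expr_lt1 ?normc_ge0.
have zd : disc (s%:C * w).
  rewrite /disc /mkset normcM normc_real// (le_lt_trans _ wd)//.
  by rewrite ler_piMl ?normc_ge0.
have A0 : 0 <= A by have := hA 0%N; rewrite big_nil.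
have cv : (fun m => normc (psum f m (s%:C * w) - psum f n (s%:C * w)) ^+ 2) @ \oo -->
    normc (tail f n (s%:C * w)) ^+ 2.
  have h : (fun m => normc (psum f m (s%:C * w) - psum f n (s%:C * w))) @ \oo -->
      normc (tail f n (s%:C * w)).
    apply: cvg_normc; apply: cvgB; first exact: psum_cvg.
    exact: cvg_cst.
  by rewrite (_ : (fun m => _ ^+ 2) = (fun m => normc (psum f m (s%:C * w) - psum f n (s%:C * w))
   * normc (psum f m (s%:C * w) - psum f n (s%:C * w))))//; apply: cvgM.
rewrite -(cvg_lim (@Rhausdorff R) cv).
apply: limr_le; first by apply/cvg_ex; eexists; exact: cv.
exists n => // m /= nm.
have -> : psum f m (s%:C * w) - psum f n (s%:C * w) =
    \sum_(n <= k < m) coef f k * (s%:C * w) ^+ k.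
  by rewrite /psum (@big_cat_nat _ _ _ n)//= addrC addrK.
have h1 : normc (\sum_(n <= k < m) coef f k * (s%:C * w) ^+ k) <=
    \sum_(n <= k < m) (normc (coef f k) * s ^+ k) * normc w ^+ k.
  elim/big_rec2 : _ => [|k y1 y2 _ h]; first by rewrite normc0.
  rewrite (le_trans (le_normcD _ _))// lerD//.
  by rewrite !normcM normcX normcM normc_real// exprMn mulrA.
rewrite -(ler_pXn2r (n := 2)) ?nnegrE ?normc_ge0// in h1; last first.
  by apply: sumr_ge0 => k _; rewrite !mulr_ge0 ?exprn_ge0 ?normc_ge0.
rewrite (le_trans h1)//.
rewrite (le_trans (cauchy_schwarz_sum n m _ _))//.
- by move=> k; rewrite mulr_ge0 ?exprn_ge0 ?normc_ge0.
- by move=> k; rewrite exprn_ge0 ?normc_ge0.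
apply: ler_pM.
- by apply: sumr_ge0 => k _; exact: sqr_ge0.
- by apply: sumr_ge0 => k _; exact: sqr_ge0.
- rewrite (le_trans _ (hA m))// [X in _ <= X](@big_cat_nat _ _ _ n)//=.
  rewrite -[X in X <= _]add0r lerD//.
    by apply: sumr_ge0 => k _; rewrite mulr_ge0 ?exprn_ge0 ?normc_ge0.
  by rewrite le_eqVlt; apply/orP; left; apply/eqP; apply: eq_bigr => k _; rewrite exprMn exprAC.
- rewrite (eq_bigr (fun k => (normc w ^+ 2) ^+ k)); last by move=> k _; rewrite exprAC.
  by apply: geometric_tail; rewrite ?sqr_ge0.
Qed.

(** Point evaluations are bounded: the case n = 0 of tail_bound, with the
    coefficients controlled by Bessel's inequality. *)
Lemma point_bound f r w : analytic_on disc f -> 0 <= r -> r < 1 -> disc w ->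
  normc (f (r%:C * w)) ^+ 2 <= mean_sq f r / (1 - normc w ^+ 2).
Proof.
move=> fa r0 r1 wd.
have := @tail_bound f r w (mean_sq f r) 0 fa r0 (ltW r1) wd (fun m => bessel m fa r0 r1).
by rewrite /tail /psum big_nil subr0 expr0 mul1r.
Qed.

End coefficient_algebra.

(** * The Poisson inequality *)
Section poisson.
Variable R : realType.
Local Notation C := R[i].
Implicit Types (f g : C -> C) (r t : R) (z w : C).

Definition poisson w (zeta : C) : R := (1 - normc w ^+ 2) / normc (1 - conjc w * zeta) ^+ 2.

Lemma one_sub_neq0 z : disc z -> 1 - z != 0.
Proof.
move=> zd; rewrite -normc_gt0 (lt_le_trans _ (ge_normcB _ _))//.
by rewrite normc1 subr_gt0.
Qed.

Lemma disc_conjM w z : disc w -> normc z <= 1 -> disc (conjc w * z).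
Proof.
move=> wd z1; rewrite /disc /mkset normcM normc_conj (le_lt_trans _ wd)//.
by rewrite ler_piMr// normc_ge0.
Qed.

(** A radius r' > r for which g (r' z) / (1 - conj w * (r' / r) * z) still is
    analytic in the whole disc. *)
Lemma dilation_exists r w : 0 < r -> r < 1 -> disc w ->
  exists r', [/\ r < r', r' < 1 & r' * normc w < r].
Proof.
move=> r0 r1 wd; set m := Num.max r (normc w).
have rm : r <= m by rewrite le_max lexx.
have wm : normc w <= m by rewrite le_max lexx orbT.
have m1 : m < 1 by rewrite gt_max r1.
have w0 := normc_ge0 w.
exists (2 * r / (1 + m)); have m10 : 0 < 1 + m by lra.
split.
- rewrite ltr_pdivlMr//; have := ltr_pM2l r0 (1 + m) 2; lra.
- by rewrite ltr_pdivrMr//; lra.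
- rewrite mulrAC ltr_pdivrMr//.
  have -> : 2 * r * normc w = r * (2 * normc w) by ring.
  by rewrite ltr_pM2l//; lra.
Qed.

(** The pointwise bound point_bound, applied to
    G z = g (r' z) / (1 - conj w * (r' / r) * z) on the circle of radius
    s = r / r': at the point w, the denominator of G equals the Poisson
    numerator 1 - |w|^2, and on the circle its squared modulus is the
    denominator of the Poisson kernel. *)
Lemma poisson_bound g r w : analytic_on disc g -> 0 < r -> r < 1 -> disc w ->
  normc (g (r%:C * w)) ^+ 2 <=
  mean (fun t => normc (g (r%:C * cis t)) ^+ 2 * poisson w (cis t)).
Proof.
move=> ga r0 r1 wd.
(* the dilation makes room for the circle of radius r inside the disc *)
have [r' [rr' r'1 r'w]] := dilation_exists r0 r1 wd.
have r'0 : 0 < r' := lt_trans r0 rr'.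
have w2 : 0 < 1 - normc w ^+ 2 by rewrite subr_gt0 expr_lt1// normc_ge0.
have q0 : 0 <= r' / r := divr_ge0 (ltW r'0) (ltW r0).
pose G z := g (r'%:C * z) * (1 - (conjc w * (r' / r)%:C) * z)^-1.
have den z : disc z -> 1 - (conjc w * (r' / r)%:C) * z != 0.
  move=> zd; apply: one_sub_neq0; rewrite /disc /mkset !normcM normc_conj.
  rewrite normc_real// (le_lt_trans (y := normc w * (r' / r)))//.
    by apply: ler_piMr; [rewrite mulr_ge0// normc_ge0|exact: ltW].
  by rewrite mulrA ltr_pdivrMr// mul1r mulrC.
have Ga : analytic_on disc G.
  move=> z zd; apply: derivable_mulc.
    apply: (@derivable_chain R (fun z => r'%:C * z) g z).
      exact: (derivable_mulc (derivable_const _ z) (derivable_ident z)).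
    apply: ga; rewrite /disc /mkset normcM normc_real ?(ltW r'0)// (le_lt_trans _ zd)//.
    by rewrite ler_piMl ?normc_ge0// ltW.
  apply: (@derivable_invc R (fun z => 1 - (conjc w * (r' / r)%:C) * z) z (den z zd)).
  apply: (derivable_subc (derivable_const _ z)).
  exact: (derivable_mulc (derivable_const _ z) (derivable_ident z)).
pose s := r / r'.
have s0 : 0 <= s by rewrite divr_ge0 ?ltW.
have s1 : s < 1 by rewrite ltr_pdivrMr// mul1r.
have r's : r' * s = r by rewrite /s mulrCA divff ?mulr1// gt_eqF.
have GE z : G (s%:C * z) = g (r%:C * z) / (1 - conjc w * z).
  rewrite /G mulrA -rmorphM /= r's; congr (_ * (1 - _)^-1).
  rewrite -mulrA; congr (_ * _); rewrite mulrA -rmorphM /=.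
  by rewrite /s (_ : r' / r * (r / r') = 1) ?mul1r//; field; rewrite !gt_eqF.
have cG := cont_sq Ga s0 s1.
have w1 : 1 - conjc w * w = (1 - normc w ^+ 2)%:C.
  by rewrite mulrC mulc_conj rmorphB.
have := point_bound Ga s0 s1 wd.
rewrite GE w1 normcM exprMn normcV normc_real ?(ltW w2)// exprVn => H.
have -> : mean (fun t => normc (g (r%:C * cis t)) ^+ 2 * poisson w (cis t)) =
    (1 - normc w ^+ 2) * mean_sq G s.
  rewrite -(meanZ _ cG); apply: eq_mean => t.
  by rewrite GE /poisson normcM exprMn normcV exprVn mulrCA.
rewrite ler_pdivlMr// in H; rewrite -(ler_pM2l w2) in H.
rewrite (le_trans _ H)// le_eqVlt; apply/orP; left; apply/eqP.
by field; rewrite gt_eqF.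
Qed.

End poisson.

(** * The Poisson kernel inside an approach region *)
Section periodic.
Variable R : realType.
Implicit Types (g F H : R -> R) (a b c t u : R).

Lemma is_derive_shift_id (x c : R) : is_derive x (1 : R) (fun y : R => y + c) 1.
Proof.
have := is_deriveD (is_derive_id x (1 : R)) (is_derive_cst c x (1 : R)).
by rewrite addr0.
Qed.

Lemma rint_shift g a b c : a <= b -> continuous g ->
  rint (a + c) (b + c) g = rint a b (fun x => g (x + c)).
Proof.
move=> ab cg; pose S (x : R) := x + c.
have dS : S^`()%classic = cst 1.
  by apply/funext => x; rewrite derive1E; case: (is_derive_shift_id x c).
have cS : continuous S.
  by move=> x; apply: cvgD; [exact: cvg_id|exact: cvg_cst].
rewrite /rint /Rintegral; congr fine.
rewrite -[a + c]/(S a) -[b + c]/(S b).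
rewrite (@integration_by_substitution_increasing R S g a b)//.
- by apply: eq_integral => x _; rewrite dS !fctE mulr1.
- by move=> x y _ _; rewrite ltrD2r.
- by rewrite dS => x _; exact: cvg_cst.
- by rewrite dS; exact: is_cvg_cst.
- by rewrite dS; exact: is_cvg_cst.
- split.
  + by move=> x _; case: (is_derive_shift_id x c).
  + by apply: cvg_at_right_filter; exact: cS.
  + by apply: cvg_at_left_filter; exact: cS.
- exact: continuous_subspaceT.
Qed.

Lemma rint_periodic H p a : 0 <= p -> continuous H -> (forall x, H (x + p) = H x) ->
  0 <= a -> a <= p -> rint a (a + p) H = rint 0 p H.
Proof.
move=> p0 cH Hp a0 ap.
have cc x y : cts x y H by exact: continuous_cts.
rewrite (@rint_split _ a (a + p) p)//; last by rewrite lerDr.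
rewrite [RHS](@rint_split _ 0 p a)// addrC; congr (_ + _).
have := rint_shift p a0 cH; rewrite add0r => ->.
by apply: eq_rint => x _; rewrite Hp.
Qed.

Lemma rint_periodic_sym H p t : 0 <= p -> continuous H -> (forall x, H (x + p) = H x) ->
  0 <= t -> t <= p -> rint (t - p / 2) (t + p / 2) H = rint 0 p H.
Proof.
move=> p0 cH Hp t0 tp.
pose a := t - p / 2; have -> : t + p / 2 = a + p by rewrite /a; lra.
rewrite -/a; have [a0|a0] := leP 0 a; first by apply: rint_periodic => //; rewrite /a; lra.
rewrite -(@rint_periodic H p (a + p))//; [|by rewrite /a; lra|by rewrite /a in a0 *; lra].
have aap : a <= a + p by rewrite lerDl.
rewrite (rint_shift p aap cH); apply: eq_rint => x _.
by rewrite Hp.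
Qed.

(** Mean value theorem where cos x >= 1/2; elsewhere sin x >= 1/2 >= x / 4. *)
Lemma sin_lower (x : R) : 0 <= x -> x <= 2 -> x <= pi / 2 -> x / 4 <= sin x.
Proof.
move=> x0 x2 xp.
have c0 : 0 <= cos x by apply: cos_ge0_pihalf; rewrite xp andbT; have := pi_ge0 R; lra.
have [->|xn0] := eqVneq x 0; first by rewrite sin0 mul0r.
have {}x0 : 0 < x by rewrite lt_neqAle eq_sym xn0.
have s0 : 0 <= sin x by rewrite sin_ge0_pi// ltW//= (le_trans xp)//; have := pi_ge0 R; lra.
have [h|h] := leP (1 / 2) (cos x).
  have [y yx E] : exists2 y, y \in `]0, x[%R & sin x - sin 0 = cos y * (x - 0).
    apply: (@MVT _ (@sin R) (@cos R)) => //.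
      by apply: continuous_subspaceT; exact: continuous_sin.
  move: yx; rewrite in_itv /= => /andP[y0 yx].
  have cyx : cos x <= cos y.
    rewrite ltW// ltr_cos// in_itv/= ?(ltW y0) ?(ltW x0)/=; have := pi_ge0 R; lra.
  rewrite sin0 !subr0 in E; rewrite E mulrC.
  by rewrite ler_wpM2r ?(ltW x0)//; lra.
have : (1 / 2) ^+ 2 <= sin x ^+ 2.
  rewrite sin2cos2; have : cos x ^+ 2 <= (1 / 2) ^+ 2 by rewrite ler_pXn2r// ?nnegrE ltW.
  by rewrite (_ : (1 / 2) ^+ 2 = 1 / 4 :> R); [lra|field].
rewrite ler_pXn2r ?nnegrE ?divr_ge0//.
by move=> hs; rewrite (le_trans _ hs)//; lra.
Qed.

(** The chord is 2 |sin ((t - s) / 2)|.  This bounds the Poisson kernel from above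
    by a power of the angular distance. *)
Lemma cis_dist_lower (t s : R) : `|t - s| <= pi -> `|t - s| / 4 <= normc (cis t - cis s).
Proof.
move=> tspi; set u := (t - s) / 2.
have E : normc (cis t - cis s) ^+ 2 = (2 * sin u) ^+ 2.
  have -> : t = (s + u) + u by rewrite /u; field.
  have -> : cis (s + u + u) - cis s = cis (s + u) * (cis u - cis (- u)).
    rewrite mulrBr -!cisD; congr (_ - cis _); ring.
  rewrite normcM normc_cis mul1r normc_sqr /cis /= cosN sinN; ring.
have un : normc (cis t - cis s) = 2 * `|sin u|.
  apply/eqP; rewrite -(@eqrXn2 _ 2)// ?normc_ge0 ?mulr_ge0//.
  by rewrite E !exprMn real_normK// num_real.
rewrite un.
have au : `|u| = `|t - s| / 2 by rewrite normrM (ger0_norm (x := 2^-1)).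
have p4 := pihalf_lt2 R.
have h : `|u| / 4 <= sin `|u|.
  by apply: sin_lower; rewrite ?au ?normr_ge0 ?divr_ge0//; lra.
have hs : sin `|u| <= `|sin u|.
  have [u0|u0] := leP 0 u; first by rewrite (ger0_norm u0) ler_norm.
  by rewrite ltr0_norm// sinN -normrN ler_norm.
have := le_trans h hs; rewrite au; lra.
Qed.

(** The kernel min (1/d, d/u^2) is summable over dyadic rings around t, so the
    averages of F over intervals centered at t control the integral of H. *)
Lemma dyadic_kernel F H t c d K : continuous F -> continuous H ->
  (forall x, 0 <= F x) -> 0 <= c -> 0 < d -> d <= pi -> 0 <= K ->
  (forall rho, 0 < rho -> rho <= pi -> rint (t - rho) (t + rho) F <= 2 * rho * c) ->
  (forall x, H x <= K / d * F x) ->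
  (forall x, 0 < `|x - t| <= pi -> H x <= K * d / (x - t) ^+ 2 * F x) ->
  rint (t - pi) (t + pi) H <= 18 * K * c.
Proof.
move=> cF cH F0 c0 d0 dpi K0 avg near_t far_t.
have cc (G : R -> R) x y : continuous G -> cts x y G by move=> cG; exact: continuous_cts.
have cZ k : continuous (fun x => k * F x).
  by move=> x; apply: cvgM; [exact: cvg_cst|exact: cF].
(* Induction on the number of doublings of the interval.  The ring
   rho/2 <= |x - t| <= rho contributes at most 8 K c d / rho, so a bound of the
   form 18 - 8 d / rho reproduces itself when rho is doubled. *)
have claim n rho : d / 2 <= rho -> rho <= 2 ^+ n * d -> rho <= pi ->
    rint (t - rho) (t + rho) H <= K * c * (18 - 8 * d / rho).
  elim: n rho => [|n IH] rho dr rn rpi.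
    have r0 : 0 < rho by lra.
    rewrite expr0 mul1r in rn.
    have h1 : rint (t - rho) (t + rho) H <= K / d * rint (t - rho) (t + rho) F.
      rewrite -rintZ; last exact: cc.
      by apply: le_rint => [||x _]; [exact: cc|exact: cc|exact: near_t].
    rewrite (le_trans h1)//.
    have h2 : K / d * rint (t - rho) (t + rho) F <= K / d * (2 * rho * c).
      by rewrite ler_wpM2l ?divr_ge0 ?(ltW d0)// avg.
    rewrite (le_trans h2)//.
    have -> : K / d * (2 * rho * c) = K * c * (2 * (rho / d)) by field; rewrite gt_eqF.
    rewrite ler_wpM2l ?mulr_ge0//.
    have h3 : rho / d <= 1 by rewrite ler_pdivrMr// mul1r.
    have h4 : d / rho <= 2 by rewrite ler_pdivrMr//; lra.
    by rewrite -mulrA; lra.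
  have r0 : 0 < rho by lra.
  have [rd|dr'] := leP rho d.
    by apply: IH => //; rewrite (le_trans rd)// ler_peMl ?(ltW d0)// exprn_ege1// ler1n.
  have IHr := IH (rho / 2).
  have {}IHr : rint (t - rho / 2) (t + rho / 2) H <= K * c * (18 - 8 * d / (rho / 2)).
    by apply: IHr; [lra|move: rn; rewrite exprS -mulrA; lra|lra].
  rewrite (@rint_split _ _ _ (t - rho / 2)); [|lra|lra|exact: cc].
  rewrite (@rint_split R (t - rho / 2) (t + rho) (t + rho / 2) H); [|lra|lra|exact: cc].
  pose k := K * d / (rho / 2) ^+ 2.
  have k0 : 0 <= k by rewrite divr_ge0 ?exprn_ge0 ?mulr_ge0 ?divr_ge0 ?(ltW d0) ?(ltW r0).
  have kb x : rho / 2 <= `|x - t| -> `|x - t| <= rho -> H x <= k * F x.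
    move=> h1 h2; have h0 : 0 < `|x - t| by rewrite (lt_le_trans _ h1)// divr_gt0.
    rewrite (le_trans (far_t x _)) ?h0 ?(le_trans h2)//.
    rewrite ler_wpM2r// /k ler_wpM2l ?mulr_ge0 ?(ltW d0)//.
    have xt2 : 0 < (x - t) ^+ 2 by rewrite -real_normK ?num_real// exprn_gt0.
    have rho2 : 0 < (rho / 2) ^+ 2 by rewrite exprn_gt0// divr_gt0.
    rewrite lef_pV2 ?posrE//.
    rewrite -[X in _ <= X]real_normK ?num_real//.
    by rewrite ler_pXn2r ?nnegrE ?divr_ge0 ?(ltW r0).
  have left_le : rint (t - rho) (t - rho / 2) H <= k * rint (t - rho) (t - rho / 2) F.
    rewrite -rintZ; last exact: cc.
    apply: le_rint => [||x /andP[x1 x2]]; [exact: cc|exact: cc|].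
    by apply: kb; rewrite ler0_norm; lra.
  have right_le : rint (t + rho / 2) (t + rho) H <= k * rint (t + rho / 2) (t + rho) F.
    rewrite -rintZ; last exact: cc.
    apply: le_rint => [||x /andP[x1 x2]]; [exact: cc|exact: cc|].
    by apply: kb; rewrite ger0_norm; lra.
  have tot := avg rho r0 rpi.
  rewrite (@rint_split _ _ _ (t - rho / 2)) in tot; [|lra|lra|exact: cc].
  rewrite (@rint_split R (t - rho / 2) (t + rho) (t + rho / 2) F) in tot; [|lra|lra|exact: cc].
  have mid0 : 0 <= rint (t - rho / 2) (t + rho / 2) F by apply: Rintegral_ge0.
  have {}tot : k * (rint (t - rho) (t - rho / 2) F + rint (t + rho / 2) (t + rho) F)
      <= k * (2 * rho * c) by rewrite ler_wpM2l//; lra.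
  have e1 : k * (2 * rho * c) = K * c * (8 * d / rho) by rewrite /k; field; rewrite gt_eqF.
  have e2 : K * c * (18 - 8 * d / (rho / 2)) = K * c * (18 - 16 * d / rho).
    by field; rewrite gt_eqF.
  rewrite e1 in tot; rewrite e2 in IHr.
  have e3 : K * c * (18 - 8 * d / rho) = K * c * (18 - 16 * d / rho) + K * c * (8 * d / rho).
    by field; rewrite gt_eqF.
  rewrite e3; lra.
have pi0 := pi_gt0 R.
have [n hn] : exists n : nat, pi <= 2 ^+ n * d.
  exists (Num.bound (pi / d)).
  rewrite -ler_pdivrMr// ltW// (lt_le_trans (archi_boundP _))// ?divr_ge0 ?(ltW d0) ?(ltW pi0)//.
  by rewrite -natrX ler_nat ltnW// ltn_expl.
rewrite (le_trans (claim n pi _ hn (lexx _)))//; first by lra.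
have Kc : 0 <= K * c by rewrite mulr_ge0.
have -> : 18 * K * c = K * c * 18 by ring.
by rewrite ler_wpM2l// lerBlDr lerDl divr_ge0 ?mulr_ge0 ?(ltW d0) ?(ltW pi0).
Qed.

End periodic.

(** * Hardy-Littlewood maximal bound for approach regions *)
Section weak_type.
Variable R : realType.
Local Notation C := R[i].
Local Notation mu := (@lebesgue_measure R).
Implicit Types (f g : C -> C) (r t c d M : R) (z w : C).

(** The Hardy-Littlewood maximal inequality on the line, applied to F cut off to
    [-pi, 3 pi]: this contains every interval of radius at most pi centered
    in [0, 2 pi], and covers two periods, whence the factor 6 = 2 * 3. *)
Lemma maximal_set (F : R -> R) c : continuous F -> (forall x, 0 <= F x) ->
  (forall x, F (x + 2 * pi) = F x) -> 0 < c ->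
  exists B : set R, [/\ measurable B,
    (mu B <= (6 / c * rint 0 (2 * pi) F)%:E)%E &
    forall t, 0 <= t <= 2 * pi -> ~ B t -> forall rho, 0 < rho -> rho <= pi ->
      rint (t - rho) (t + rho) F <= 2 * rho * c].
Proof.
move=> cF F0 Fp c0.
have pi0 := pi_gt0 R.
have cc x y : cts x y F by exact: continuous_cts.
pose D : set R := `[- pi, 3 * pi]%classic.
pose F1 := F \_ D.
have F1E x : D x -> F1 x = F x by move=> Dx; rewrite /F1 patchE mem_set.
have iF : mu.-integrable D (EFin \o F) by exact: cts_integrable.
have iF1 : mu.-integrable setT (EFin \o F1).
  have [H _] := @integrable_mkcond _ _ R mu D (EFin \o F) (mitv _ _).
  by have := H iF; rewrite restrict_EFin.
have locF1 : locally_integrable setT F1 by apply: open_integrable_locally => //; exact: openT.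
exists [set x | (HL_maximal F1 x > c%:E)%E]; split.
- rewrite -[X in measurable X]setTI; apply: emeasurable_fun_o_infty => //.
  exact: measurable_HL_maximal.
- rewrite (le_trans (maximal_inequality locF1 c0))//.
  have -> : (\int[mu]_(y in setT) `|(F1 y)%:E| = (rint (- pi) (3 * pi) F)%:E)%E.
    rewrite /rint /Rintegral fineK; last by exact: integrable_fin_num.
    rewrite [RHS]integral_mkcond; apply: eq_integral => x _.
    rewrite /F1 !patchE; case: ifP => _ /=; rewrite ?normr0// ger0_norm//.
  rewrite -EFinM lee_fin.
  have -> : rint (- pi) (3 * pi) F = 2 * rint 0 (2 * pi) F.
    rewrite (@rint_split R (- pi) (3 * pi) pi F); [|lra|lra|exact: cc].
    have p2 : 0 <= 2 * pi :> R by lra.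
    have e1 := @rint_periodic R F (2 * pi) pi p2 cF Fp (ltW pi0).
    have e2 := @rint_periodic_sym R F (2 * pi) 0 p2 cF Fp (lexx 0) p2.
    have h : 2 * pi / 2 = pi :> R by field.
    rewrite h sub0r add0r in e2; rewrite e2.
    have -> : 3 * pi = pi + 2 * pi :> R by ring.
    by rewrite e1; [ring|lra].
  by rewrite le_eqVlt; apply/orP; left; apply/eqP; field; rewrite gt_eqF.
- move=> t /andP[t0 t2] /negP; rewrite -leNgt => Ht rho r0 rpi.
  have : (iavg F1 (ball t rho) <= c%:E)%E.
    rewrite (le_trans _ Ht)//; apply: ereal_sup_ubound.
    by exists rho => //=; rewrite in_itv/= r0.
  rewrite /iavg lebesgue_measure_ball ?(ltW r0)// inver mulrn_eq0/= (gt_eqF r0).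
  have -> : (\int[mu]_(y in ball t rho) `|(F1 y)%:E| = (rint (t - rho) (t + rho) F)%:E)%E.
    rewrite /rint /Rintegral fineK; last by apply: integrable_fin_num => //; exact: cts_integrable.
    rewrite ball_itv [RHS]integral_itv_bndoo; last first.
      apply: measurable_funTS; apply/measurable_EFinP.
      exact: continuous_measurable_fun.
    apply: eq_integral => x; rewrite inE /= in_itv /= => /andP[x1 x2].
    by rewrite F1E ?ger0_norm// /D /= in_itv /=; lra.
  have r2E : rho *+ 2 = 2 * rho by rewrite mulr_natl.
  by rewrite r2E -EFinM lee_fin mulrC ler_pdivrMr ?mulr_gt0// [c * _]mulrC.
Qed.

(** In an approach region at cis t, |cis s - w| is at least 1 - |w|, and also at
    least |s - t| / (4 (1 + M)), because the distance from w to cis t is at most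
    M times |cis s - w|. *)
Lemma stolz_poisson w t M : 0 <= M -> stolz_region (cis t) M w ->
  (forall s, poisson w (cis s) <= 32 * (1 + M) ^+ 2 / (1 - normc w)) /\
  (forall s, 0 < `|s - t| <= pi ->
     poisson w (cis s) <= 32 * (1 + M) ^+ 2 * (1 - normc w) / (s - t) ^+ 2).
Proof.
move=> M0 [wd wM]; pose d := 1 - normc w.
have w0 := normc_ge0 w.
have d0 : 0 < d by rewrite subr_gt0.
rewrite -/d in wM *.
have num : 1 - normc w ^+ 2 <= 2 * d.
  have -> : 1 - normc w ^+ 2 = d * (1 + normc w) by rewrite /d; ring.
  by rewrite mulrC ler_pM2r//; rewrite /d in d0; lra.
have num0 : 0 <= 1 - normc w ^+ 2 by rewrite subr_ge0 expr_le1// ltW.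
have M1 : 1 <= (1 + M) ^+ 2 by rewrite expr_ge1//; lra.
have denE s : normc (1 - conjc w * cis s) = normc (cis s - w).
  have -> : 1 - conjc w * cis s = cis s * conjc (cis s - w).
    rewrite (_ : conjc (cis s - w) = conjc (cis s) - conjc w); last exact: rmorphB.
    by rewrite mulrBr mulc_conj normc_cis expr1n mulrC.
  by rewrite normcM normc_cis mul1r normc_conj.
have dend s : d <= normc (cis s - w).
  by rewrite (le_trans _ (ge_normcB _ _))// normc_cis.
have gen s m : 0 < m -> m <= normc (cis s - w) -> poisson w (cis s) <= 2 * d / m ^+ 2.
  move=> m0 mle; rewrite /poisson denE.
  rewrite ler_pM ?invr_ge0 ?exprn_ge0 ?normc_ge0// lef_pV2 ?posrE ?exprn_gt0//.
    by rewrite ler_pXn2r ?nnegrE ?normc_ge0// ltW.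
  exact: lt_le_trans mle.
split=> s.
  rewrite (le_trans (gen s d d0 (dend s)))//.
  have -> : 2 * d / d ^+ 2 = 2 / d by field; rewrite gt_eqF.
  by rewrite ler_pM2r ?invr_gt0//; lra.
move=> /andP[st0 stpi].
pose m := `|s - t| / (4 * (1 + M)).
have M10 : 0 < 1 + M by lra.
have m0 : 0 < m by rewrite divr_gt0// mulr_gt0.
have mle : m <= normc (cis s - w).
  rewrite /m ler_pdivrMr ?mulr_gt0//.
  have h1 := cis_dist_lower stpi.
  have h2 : normc (cis s - cis t) <= normc (cis s - w) + normc (w - cis t).
    by rewrite (le_trans _ (le_normcD _ _))// addrA subrK.
  have h3 := dend s.
  have h4 : M * d <= M * normc (cis s - w) by rewrite ler_wpM2l.
  have -> : normc (cis s - w) * (4 * (1 + M)) =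
    4 * (normc (cis s - w) + M * normc (cis s - w)) by ring.
  by lra.
rewrite (le_trans (gen s m m0 mle))//.
rewrite /m le_eqVlt; apply/orP; left; apply/eqP.
have E : (`|s - t| / (4 * (1 + M))) ^+ 2 = (s - t) ^+ 2 / (16 * (1 + M) ^+ 2).
  by rewrite expr_div_n real_normK ?num_real// exprMn; congr (_ / (_ * _)); ring.
rewrite E; field.
rewrite (gt_eqF M10) /= andbT; apply/eqP => h.
by move: st0; rewrite h normr0 ltxx.
Qed.

Lemma continuous_constR (k : C) t : {for t, continuous (fun _ : R => k)}.
Proof. exact: cvg_cst. Qed.

Lemma cont_poisson w : disc w -> continuous (fun t => poisson w (cis t)).
Proof.
move=> wd.
rewrite (_ : (fun t => poisson w (cis t)) =
    (fun t => (1 - normc w ^+ 2) / normc (1 + (- conjc w) * cis t) ^+ 2)); last first.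
  by apply/funext => s; rewrite mulNr.
move=> t.
have c2 := continuous_mulc (@continuous_constR (- conjc w) t) (@continuous_cis R t).
have c1 := continuous_addc (@continuous_constR 1 t) c2.
apply: cvgM; first exact: cvg_cst.
apply: cvgV; last exact: continuous_normc2 c1.
rewrite expf_neq0// normc_eq0 mulNr; apply: one_sub_neq0.
by apply: disc_conjM => //; rewrite normc_cis.
Qed.

(** On each circle of radius r k, outside the maximal set B k the Poisson bound
    and dyadic_kernel control g (r k * w) for every w of the approach region.
    A point outside the lower limit of the sets B k lies outside infinitely many
    of them, and along these g (r k * w) tends to g w. *)
Lemma weak_type g M A c : analytic_on disc g -> (forall n, coef_sq g n <= A) ->
  0 <= M -> 0 < c -> exists B : set R, [/\ measurable B,
    (mu B <= (6 * (18 * (32 * (1 + M) ^+ 2)) * A / c)%:E)%E &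
    forall t, 0 <= t <= 2 * pi -> ~ B t -> forall w, stolz_region (cis t) M w ->
      normc (g w) ^+ 2 <= c].
Proof.
move=> ga gA M0 c0; have pi0 := pi_gt0 R.
pose K := 32 * (1 + M) ^+ 2.
have K0 : 0 < K by rewrite mulr_gt0// exprn_gt0//; lra.
(* the level of the maximal function for which dyadic_kernel returns c *)
pose c' := c * (2 * pi) / (18 * K).
have pi20 : 0 < 2 * pi :> R by rewrite mulr_gt0.
have K18 : 0 < 18 * K by rewrite mulr_gt0.
have c'0 : 0 < c' by rewrite divr_gt0// mulr_gt0.
pose r (k : nat) : R := 1 - (k.+2%:R)^-1.
have r0 k : 0 < r k by rewrite subr_gt0 invf_lt1 ?ltr1n.
have r1 k : r k < 1 by rewrite ltrBlDr ltrDl invr_gt0.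
pose F k t := normc (g ((r k)%:C * cis t)) ^+ 2.
have cF k : continuous (F k) := cont_sq ga (ltW (r0 k)) (r1 k).
have F0 k x : 0 <= F k x by rewrite exprn_ge0 ?normc_ge0.
have Fp k x : F k (x + 2 * pi) = F k x by rewrite /F cisDpi2.
have /choice[B HB] k := maximal_set (cF k) (F0 k) (Fp k) c'0.
have BA k : (mu (B k) <= (6 / c' * (2 * pi * A))%:E)%E.
  have [_ h _] := HB k; rewrite (le_trans h)// lee_fin.
  have c6 : 0 <= 6 / c' := divr_ge0 (ler0n _ 6) (ltW c'0).
  rewrite ler_wpM2l//.
  have := mean_sq_le ga (ltW (r0 k)) (r1 k) gA.
  by rewrite /mean_sq /mean ler_pdivrMl.
pose BB j := \bigcap_(k in [set k | (j <= k)%N]) B k.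
have mBB j : measurable (BB j).
  apply: bigcap_measurable => [|k _]; last by have [] := HB k.
  by exists j => /=.
exists (\bigcup_j BB j); split.
- exact: bigcup_measurable.
- have nd : {homo BB : n m / (n <= m)%N >-> (n <= m)%O}.
    move=> n m nm; apply/subsetPset => x Bx k /= mk; apply: Bx => /=.
    exact: leq_trans mk.
  have H : (mu \o BB) x @[x --> \oo] --> mu (\bigcup_j BB j).
    apply: nondecreasing_cvg_mu; [exact: mBB|exact: (bigcup_measurable (fun k _ => mBB k))|exact: nd].
  rewrite -(cvg_lim (@ereal_hausdorff R) H); apply: lime_le; first by apply/cvg_ex; eexists; exact: H.
  apply: nearW => j /=.
  have le1 : (mu (BB j) <= mu (B j))%E.
    apply: le_measure; [rewrite inE; exact: mBB|rewrite inE; by have [] := HB j|].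
    by apply: bigcap_inf => /=.
  rewrite (le_trans le1)// (le_trans (BA j))// lee_fin.
  rewrite le_eqVlt; apply/orP; left; apply/eqP; rewrite /c' -/K.
  have gen (p : R) : 0 < p -> 6 / (c * p / (18 * K)) * (p * A) = 6 * (18 * K) * A / c.
    by move=> p0; field; rewrite !gt_eqF.
  exact: gen.
- move=> t t2 nB w ws; have [wd wM] := ws.
  have d0 : 0 < 1 - normc w by rewrite subr_gt0.
  have [near_t far_t] := stolz_poisson M0 ws.
  have bound k : ~ B k t -> normc (g ((r k)%:C * w)) ^+ 2 <= c.
    move=> nBk; have [_ _ avg] := HB k.
    rewrite (le_trans (poisson_bound ga (r0 k) (r1 k) wd))//.
    pose H s := F k s * poisson w (cis s).
    have cH : continuous H.
      by move=> s; apply: cvgM; [exact: cF|exact: cont_poisson].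
    have Hp s : H (s + 2 * pi) = H s by rewrite /H Fp cisDpi2.
    rewrite -/(mean H) /mean.
    have [t0 t2'] : 0 <= t /\ t <= 2 * pi by move: t2 => /andP[].
    have p2 : 0 <= 2 * pi :> R by rewrite mulr_ge0// ltW.
    rewrite -(rint_periodic_sym p2 cH Hp t0 t2').
    have -> : 2 * pi / 2 = pi :> R by field.
    rewrite ler_pdivrMl ?mulr_gt0//.
    have -> : 2 * pi * c = 18 * K * c' by rewrite /c'; field; rewrite gt_eqF.
    have w0 := normc_ge0 w; have p22 := pi_ge2 R.
    apply: (@dyadic_kernel R (F k) H t c' (1 - normc w) K) => //.
    + exact: ltW.
    + lra.
    + exact: ltW.
    + by move=> rho rho0 rhopi; apply: avg.
    + by move=> x; rewrite /H mulrC ler_wpM2r// near_t.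
    + by move=> x xt; rewrite /H mulrC ler_wpM2r// far_t.
  have cv : normc (g ((r k)%:C * w)) ^+ 2 @[k --> \oo] --> normc (g w) ^+ 2.
    have cr : (r k)%:C * w @[k --> \oo] --> w.
      apply/cvg_normcP => e e0.
      move/cvgrPdist_lt : (@cvg_harmonic R) => /(_ _ e0)[N _ HN].
      exists N => // k /= Nk.
      have := HN k.+1 (leqW Nk); rewrite /harmonic /= sub0r normrN => h.
      have -> : (r k)%:C * w - w = - ((k.+2%:R)^-1)%:C * w.
        by rewrite /r rmorphB /=; ring.
      rewrite normcM normcN normc_realE (le_lt_trans _ h)//.
      by rewrite ler_piMr// ltW.
    have cg : {for w, continuous (fun z => normc (g z) ^+ 2)}.
      by apply: continuous_normc2; apply: analytic_continuous; exact: ga.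
    exact: (cvg_comp _ _ cr cg).
  rewrite leNgt; apply/negP => cg.
  have := cv; move/cvgrPdist_lt => /(_ (normc (g w) ^+ 2 - c)).
  rewrite subr_gt0 => /(_ cg)[N _ HN].
  apply: nB; exists N => // k /= Nk.
  apply: contrapT => nBk; have h1 := bound k nBk.
  have := HN k Nk; rewrite /= ger0_norm; last by rewrite subr_ge0 (le_trans h1)// ltW.
  by rewrite ltrD2l ltrN2 ltNge h1.
Qed.

End weak_type.

(** * Fatou's theorem *)
Section fatou.
Variable R : realType.
Local Notation C := R[i].
Local Notation cRe := (@complex.Re R).
Local Notation cIm := (@complex.Im R).
Local Notation mu := (@lebesgue_measure R).
Implicit Types (f g : C -> C) (r t c M : R) (z w : C).

Lemma cauchy_seq_cvg (u : nat -> R) :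
  (forall e, 0 < e -> exists N, forall m n, (N <= m)%N -> (N <= n)%N -> `|u m - u n| <= e) ->
  exists l : R, u @ \oo --> l.
Proof.
move=> H; apply/cvg_ex; apply/cauchy_cvgP; apply: cauchy_exP => e e0.
have [|N HN] := H (e / 2); first by rewrite divr_gt0.
exists (u N); exists N => // n /= Nn; rewrite -ball_normE /=.
by rewrite (le_lt_trans (HN N n (leqnn N) Nn))// ltr_pdivrMr// ltr_pMr// ltr1n.
Qed.

Lemma cauchy_seq_cvgC (u : nat -> C) :
  (forall e, 0 < e -> exists N, forall m n, (N <= m)%N -> (N <= n)%N -> normc (u m - u n) <= e) ->
  exists l : C, u @ \oo --> l.
Proof.
move=> H.
have [a ha] : exists a : R, (fun n => cRe (u n)) @ \oo --> a.
  apply: cauchy_seq_cvg => e /H[N HN]; exists N => m n Nm Nn.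
  by rewrite -ReN -ReD (le_trans (abs_Re_le _))// HN.
have [b hb] : exists b : R, (fun n => cIm (u n)) @ \oo --> b.
  apply: cauchy_seq_cvg => e /H[N HN]; exists N => m n Nm Nn.
  by rewrite -ImN -ImD (le_trans (abs_Im_le _))// HN.
exists (a +i* b); apply/cvg_normcP => e e0.
have e2 : 0 < e / 2 by rewrite divr_gt0.
move/cvgrPdist_lt : ha => /(_ _ e2)[N1 _ H1].
move/cvgrPdist_lt : hb => /(_ _ e2)[N2 _ H2].
exists (maxn N1 N2) => // n /=; rewrite geq_max => /andP[n1 n2].
rewrite (le_lt_trans (normc_le_ReIm _))// ReD ImD ReN ImN (splitr e) ltrD// distrC.
- exact: H1.
- exact: H2.
Qed.

Lemma null_bigcup (F : nat -> set R) : (forall j, measurable (F j)) ->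
  (forall j, mu (F j) = 0%E) -> mu (\bigcup_j F j) = 0%E.
Proof.
move=> mF F0; have mU : measurable (\bigcup_j F j) by exact: bigcup_measurable.
apply: measure_negligible => //; apply: negligible_bigcup => j.
by exists (F j); split; [exact: mF|exact: F0|].
Qed.

Definition rad (k : nat) : R := 1 - (k.+2%:R)^-1.

Lemma rad_lt1 k : rad k < 1.
Proof. by rewrite ltrBlDr ltrDl invr_gt0. Qed.

Lemma rad_gt0 k : 0 < rad k.
Proof. by rewrite subr_gt0 invf_lt1 ?ltr1n. Qed.

Lemma rad_cvg t : (rad k)%:C * cis t @[k --> \oo] --> cis t.
Proof.
apply/cvg_normcP => e e0.
move/cvgrPdist_lt : (@cvg_harmonic R) => /(_ _ e0)[N _ HN].
exists N => // k Nk.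
have h := HN k.+1 (leqW Nk); rewrite /harmonic /= sub0r normrN in h.
rewrite /mkset.
have -> : (rad k)%:C * cis t - cis t = - ((k.+2%:R)^-1)%:C * cis t.
  by rewrite /rad rmorphB /=; ring.
by rewrite normcM normcN normc_realE normc_cis mulr1.
Qed.

Lemma rad_stolz t M k : 1 < M -> stolz_region (cis t) M ((rad k)%:C * cis t).
Proof.
move=> M1; have r0 := ltW (rad_gt0 k); have r1 := rad_lt1 k.
split; first by rewrite /disc /mkset normc_polar.
have -> : (rad k)%:C * cis t - cis t = - (1 - rad k)%:C * cis t.
  by move: (rad k) => a; rewrite rmorphB rmorph1 mulNr mulrBl mul1r opprB.
rewrite normcM normcN normc_cis mulr1 normc_real ?subr_ge0 ?ltW// normc_polar//.
by rewrite ltr_pMl ?subr_gt0.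
Qed.

(** The squared norm of the Hardy space, as a sum of squared coefficients;
    hardy_integral identifies it with the integral of the boundary values. *)
Definition hsq f : R := sup (range (coef_sq f)).

Section bounded_coefficients.
Variables (f : C -> C) (A : R).
Hypotheses (fa : analytic_on disc f) (fA : forall n, coef_sq f n <= A).

Lemma coef_sq_le_hsq n : coef_sq f n <= hsq f.
Proof. by apply: ub_le_sup; [exists A => _ [m _ <-]; exact: fA|exists n]. Qed.

Lemma hsq_tail e : 0 < e ->
  exists n, hsq f - e < coef_sq f n /\ forall m, coef_sq (tail f n) m <= e.
Proof.
move=> e0.
have hs : has_sup (range (coef_sq f)).
  by split; [exists (coef_sq f 0); exists 0%N|exists A => _ [m _ <-]; exact: fA].
have [_ [n _ <-] hn] := sup_adherent e0 hs; exists n; split => // m.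
have h1 := coef_sq_tail n m fa.
have h2 := coef_sq_le_hsq (maxn m n).
by rewrite /hsq in h2; lra.
Qed.

(** Fatou's theorem.  By the weak-type estimate, tails of small norm are
    uniformly small in an approach region outside a set of small measure, while
    Taylor polynomials are continuous up to the circle; hence outside a null set
    f is Cauchy in every approach region. *)
Lemma nontangential_exists :
  exists N : set R, [/\ measurable N, mu N = 0%E &
    forall t, 0 <= t <= 2 * pi -> ~ N t -> exists l, nontangential_limit f (cis t) l].
Proof.
pose c (j : nat) : R := (j.+1%:R^-1) ^+ 2.
have c0 j : 0 < c j by rewrite exprn_gt0// invr_gt0.
have m0 (m : nat) : 0 <= m.+2%:R :> R by [].
pose K (m : nat) : R := 6 * (18 * (32 * (1 + m.+2%:R) ^+ 2)).
have K0 m : 0 < K m by rewrite mulr_gt0// mulr_gt0// mulr_gt0// exprn_gt0// addr_gt0.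
(* for the aperture m + 2 and the accuracy 1 / (j + 1), the set of boundary
   points at which no tail is small throughout the approach region is null *)
have bad m j : exists B : set R, [/\ measurable B, mu B = 0%E &
    forall t, 0 <= t <= 2 * pi -> ~ B t -> exists n, forall w,
      stolz_region (cis t) m.+2%:R w -> normc (tail f n w) ^+ 2 <= c j].
  have step i : exists nB : nat * set R, [/\ measurable nB.2, (mu nB.2 <= (i.+1%:R^-1)%:E)%E &
      forall t, 0 <= t <= 2 * pi -> ~ nB.2 t -> forall w,
      stolz_region (cis t) m.+2%:R w -> normc (tail f nB.1 w) ^+ 2 <= c j].
    pose e := i.+1%:R^-1 * c j / K m.
    have e0 : 0 < e by rewrite divr_gt0// mulr_gt0// invr_gt0.
    have [n [_ hn]] := hsq_tail e0.
    have [B [mB muB HB]] := weak_type (@analytic_tail R f n fa) hn (m0 m) (c0 j).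
    exists (n, B); split => //=.
    rewrite (le_trans muB)// lee_fin -/(K m) /e.
    rewrite le_eqVlt; apply/orP; left; apply/eqP.
    by rewrite mulrCA divff ?mulr1 ?gt_eqF// mulfK ?gt_eqF.
  have /choice[nB HB] := step.
  exists (\bigcap_i (nB i).2); split.
  - by apply: bigcap_measurable => [|i _]; [exists 0%N|have [] := HB i].
  - apply/eqP; rewrite eq_le measure_ge0 andbT; apply/lee_addgt0Pr => e e0.
    rewrite add0e.
    have [i hi] : exists i : nat, i.+1%:R^-1 <= e.
      exists (Num.bound e^-1); rewrite -[leRHS]invrK lef_pV2 ?posrE ?invr_gt0//.
      by rewrite ltW// (lt_trans (archi_boundP _))// ?invr_ge0 ?ltr_nat// ltW.
    have [mB muB _] := HB i.
    rewrite (le_trans _ (le_trans muB _)) ?lee_fin//.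
    apply: le_measure; rewrite ?inE//.
      by apply: bigcap_measurable => [|k _]; [exists 0%N|have [] := HB k].
    exact: bigcap_inf.
  - move=> t t2 nBt.
    have [i ni] : exists i, ~ (nB i).2 t.
      by apply/existsNP => H; apply: nBt => i _; exact: H.
    by exists (nB i).1; have [_ _ h] := HB i; exact: h.
have /choice[B1 HB1] : forall p : nat * nat, exists B : set R, [/\ measurable B, mu B = 0%E &
    forall t, 0 <= t <= 2 * pi -> ~ B t -> exists n, forall w,
      stolz_region (cis t) p.1.+2%:R w -> normc (tail f n w) ^+ 2 <= c p.2].
  by move=> p; exact: bad.
pose N := \bigcup_m \bigcup_j B1 (m, j).
have mN1 m : measurable (\bigcup_j B1 (m, j)).
  by apply: bigcup_measurable => j _; have [] := HB1 (m, j).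
exists N; split.
- by apply: bigcup_measurable => m _; exact: mN1.
- by apply: null_bigcup => // m; apply: null_bigcup => j; have [] := HB1 (m, j).
- move=> t t2 nN.
  have good m j : exists n, forall w, stolz_region (cis t) m.+2%:R w ->
      normc (tail f n w) <= j.+1%:R^-1.
    have [_ _ H] := HB1 (m, j).
    have [|n Hn] := H t t2; first by move=> Bt; apply: nN; exists m => //; exists j.
    exists n => w /Hn; rewrite /c /= ler_pXn2r// ?nnegrE ?normc_ge0//.
  have small (e : R) : 0 < e -> exists j : nat, j.+1%:R^-1 <= e.
    move=> e0; exists (Num.bound e^-1).
    rewrite -[leRHS]invrK lef_pV2 ?posrE ?invr_gt0//.
    by rewrite ltW// (lt_trans (archi_boundP _))// ?invr_ge0 ?ltr_nat// ltW.
  have pc n (e : R) : 0 < e -> exists2 d : R, 0 < d & forall w, normc (w - cis t) < d ->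
      normc (psum f n w - psum f n (cis t)) < e.
    have [H _] := continuous_normcP (psum f n) (cis t).
    exact: H (analytic_continuous (@analytic_psum R f n (cis t))) e.
  (* f oscillates by at most e near cis t inside an approach region *)
  have osc m (e : R) : 0 < e -> exists2 d : R, 0 < d & forall w v,
      stolz_region (cis t) m.+2%:R w -> stolz_region (cis t) m.+2%:R v ->
      normc (w - cis t) < d -> normc (v - cis t) < d -> normc (f w - f v) <= e.
    move=> e0; have e4 : 0 < e / 4 by rewrite divr_gt0.
    have [j hj] := small _ e4; have [n hn] := good m j.
    have [d d0 hd] := pc n _ e4; exists d => // w v ws vs wd vd.
    have -> : f w - f v = (tail f n w - tail f n v) +
      ((psum f n w - psum f n (cis t)) - (psum f n v - psum f n (cis t))).
      by rewrite /tail; ring.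
    rewrite (le_trans (le_normcD _ _))//.
    have h1 := le_normcB (tail f n w) (tail f n v).
    have h2 := le_normcB (psum f n w - psum f n (cis t)) (psum f n v - psum f n (cis t)).
    have h3 := hn _ ws; have h4 := hn _ vs; have h5 := hd _ wd; have h6 := hd _ vd.
    apply: (le_trans (lerD h1 h2)).
    have -> : e = (e / 4 + e / 4) + (e / 4 + e / 4) by field.
    by rewrite lerD// lerD ?(le_trans h3 hj) ?(le_trans h4 hj)// ltW.
  have two : 1 < 2%:R :> R by rewrite ltr1n.
  have [l hl] : exists l : C, f ((rad k)%:C * cis t) @[k --> \oo] --> l.
    apply: cauchy_seq_cvgC => e e0.
    have [d d0 hd] := osc 0%N e e0.
    have /cvg_normcP /(_ _ d0)[k0 _ hk] := @rad_cvg t.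
    by exists k0 => p q pk qk; apply: hd; [exact: rad_stolz|exact: rad_stolz|exact: hk|exact: hk].
  exists l => M M1; apply/cvg_normcP => e e0.
  pose m := Num.bound M.
  have Mm : M <= m.+2%:R.
    by rewrite ltW// (lt_trans (archi_boundP _)) ?ltr_nat// ltW// (lt_trans _ M1).
  have m1 : 1 < m.+2%:R :> R by rewrite ltr1n.
  have e2 : 0 < e / 2 by rewrite divr_gt0.
  have [d d0 hd] := osc m (e / 4) (divr_gt0 e0 (ltr0n _ 4)).
  apply/nbhs_normcP; exists d => // w wd [wdisc wM].
  have ws : stolz_region (cis t) m.+2%:R w.
    split => //; rewrite (lt_le_trans wM)// ler_wpM2r// subr_ge0; exact: ltW.
  have /cvg_normcP /(_ _ d0)[k0 _ hk] := @rad_cvg t.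
  move/cvg_normcP : hl => /(_ _ e2)[k1 _ hk1].
  pose k := maxn k0 k1.
  have h1 := hd w _ ws (rad_stolz t k m1) wd (hk k (leq_maxl _ _)).
  have h2 := hk1 k (leq_maxr _ _).
  have -> : f w - l = (f w - f ((rad k)%:C * cis t)) + (f ((rad k)%:C * cis t) - l) by ring.
  rewrite (le_lt_trans (le_normcD _ _))//; move: h1 h2 => /=; lra.
Qed.

End bounded_coefficients.

End fatou.

(** * Boundary values carry the Hardy norm *)
Section circle_integrals.
Variable R : realType.
Local Notation C := R[i].
Local Notation mu := (@lebesgue_measure R).
Local Open Scope ereal_scope.

Import HBNNSimple.

(** The integral of a nonnegative function is the supremum of the integrals of
    the simple functions below it, and a simple function below f may be set
    to 0 on N without changing its integral. *)
Lemma ge0_le_integral_null (f g : R -> \bar R) (N : set R) :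
  measurable N -> mu N = 0 -> (forall x, 0 <= f x) -> (forall x, 0 <= g x) ->
  (forall x, ~ N x -> f x <= g x) -> \int[mu]_x f x <= \int[mu]_x g x.
Proof.
move=> mN N0 f0 g0 fg.
rewrite ge0_integralTE// [leRHS]ge0_integralTE//.
apply: ge_ereal_sup => _ [h /= hf <-].
have mCN : measurable (~` N) by exact: measurableC.
have hle x : (proj_nnsfun h mCN x)%:E <= g x.
  rewrite /proj_nnsfun /= mindicE.
  have [Nx|Nx] := pselect (N x).
    by rewrite memNset; [rewrite mulr0|move=> /(_ Nx)].
  by rewrite mem_set// mulr1 (le_trans (hf x))// fg.
apply: le_ereal_sup_tmp.
exists (sintegral mu (proj_nnsfun h mCN)); first by exists (proj_nnsfun h mCN).
rewrite -!integralT_nnsfun.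
rewrite le_eqVlt; apply/orP; left; apply/eqP.
apply: ge0_ae_eq_integral => //.
- exact/measurable_EFinP.
- exact/measurable_EFinP.
- by move=> x _; rewrite lee_fin; exact: fun_ge0.
- by move=> x _; rewrite lee_fin; exact: fun_ge0.
- exists N; split => // x /= H; apply: contrapT => Nx; apply: H => _.
  by rewrite /= mindicE mem_set ?mulr1.
Qed.

End circle_integrals.

Section hardy_norm.
Variable R : realType.
Local Notation C := R[i].
Local Notation rad := (@rad R).
Local Notation mu := (@lebesgue_measure R).
Local Notation D := (`[0%R, (2 * pi)%R]%classic : set R).
Implicit Types (f g : C -> C) (r t c M : R) (z w : C).

Lemma circle_integral_mean (g : C -> R) : continuous (fun t => g (cis t)) ->
  circle_integral (fun zeta => (g zeta)%:E) = (mean (fun t => g (cis t)))%:E.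
Proof.
move=> cg; rewrite /circle_integral /mean EFinM; congr (_ * _)%E.
rewrite /rint /Rintegral fineK//; apply: integrable_fin_num => //.
by apply: cts_integrable => t _; exact: cg.
Qed.

Lemma integral_null (h : R -> R) (N : set R) : measurable N -> mu N = 0%E ->
  (forall x, 0 <= h x) ->
  (\int[mu]_(x in D) (h x)%:E = \int[mu]_(x in D `\` N) (h x)%:E)%E.
Proof.
move=> mN N0 h0; rewrite integral_mkcond [RHS]integral_mkcond.
have p0 (E : set R) x : (0 <= ((fun x => (h x)%:E) \_ E) x)%E.
  by rewrite patchE; case: ifP => // _; rewrite lee_fin.
apply/eqP; rewrite eq_le; apply/andP; split;
  apply: (ge0_le_integral_null mN N0 (p0 _) (p0 _)) => x Nx; rewrite !patchE.
- case: ifPn => [|_]; last by case: ifP; rewrite ?lee_fin.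
  by rewrite inE => Dx; rewrite mem_set.
- case: ifPn => [|_]; last by case: ifP; rewrite ?lee_fin.
  by rewrite inE => -[Dx _]; rewrite mem_set.
Qed.

Lemma measurable_ae_lim (G : nat -> R -> R) (h : R -> R) (N : set R) : measurable N ->
  (forall k, continuous (G k)) ->
  (forall t, 0 <= t <= 2 * pi -> ~ N t -> G k t @[k --> \oo] --> h t) ->
  measurable_fun (D `\` N) h.
Proof.
move=> mN cG Gh; apply: (@measurable_fun_cvg _ _ R _ G).
  by move=> k; apply: measurable_funTS; exact: continuous_measurable_fun.
by move=> x [/= Dx Nx]; apply: Gh => //; move: Dx; rewrite in_itv.
Qed.

Lemma ae_fatou (G : nat -> R -> R) (h : R -> R) (N : set R) B : measurable N -> mu N = 0%E ->
  (forall k, continuous (G k)) -> (forall k x, 0 <= G k x) -> (forall x, 0 <= h x) ->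
  (forall t, 0 <= t <= 2 * pi -> ~ N t -> G k t @[k --> \oo] --> h t) ->
  (forall k, mean (G k) <= B) ->
  (\int[mu]_(x in D) (h x)%:E <= (2 * pi * B)%:E)%E.
Proof.
move=> mN N0 cG G0 h0 Gh GB.
have mD : measurable (D `\` N) by apply: measurableD => //; exact: mitv.
rewrite (integral_null mN N0 h0).
have -> : (\int[mu]_(x in D `\` N) (h x)%:E =
    \int[mu]_(x in D `\` N) limn_einf (fun k => (G k x)%:E))%E.
  apply: eq_integral => x; rewrite inE => -[/= Dx Nx].
  have cv : (G k x)%:E @[k --> \oo] --> (h x)%:E.
    by apply: cvg_EFin; [exact: nearW|apply: Gh => //; move: Dx; rewrite in_itv].
  by have /cvg_limn_einf_sup[-> _] := cv.
have mG k : measurable_fun (D `\` N) (fun x => (G k x)%:E).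
  by apply: measurable_funTS; apply/measurable_EFinP; exact: continuous_measurable_fun.
have G0' k x : (D `\` N) x -> (0 <= (G k x)%:E)%E by rewrite lee_fin.
rewrite (le_trans (fatou mu mD mG G0'))//.
have le1 k : (\int[mu]_(x in D `\` N) (G k x)%:E <= (2 * pi * B)%:E)%E.
  rewrite -(integral_null mN N0 (G0 k)).
  have := GB k; rewrite /mean ler_pdivrMl ?pi2_gt0// => h1.
  rewrite (le_trans _ (_ : ((rint 0 (2 * pi) (G k))%:E <= _)%E)) ?lee_fin//.
  rewrite /rint /Rintegral fineK//; apply: integrable_fin_num => //.
  by apply: cts_integrable => t _; exact: cG.
rewrite limn_einf_lim; apply: lime_le; first exact: is_cvg_einfs.
apply: nearW => k; apply: le_trans (le1 k).
by apply: ereal_inf_lbound; exists k => /=.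
Qed.

Section boundary_values.
Variables (f : C -> C) (A : R).
Hypotheses (fa : analytic_on disc f) (fA : forall n, coef_sq f n <= A).

(** The radius ending at cis t lies in every approach region at cis t. *)
Lemma boundary_radial : exists N : set R, [/\ measurable N, mu N = 0%E &
  forall t, 0 <= t <= 2 * pi -> ~ N t ->
    f ((rad k)%:C * cis t) @[k --> \oo] --> boundary f (cis t)].
Proof.
have [N [mN N0 HN]] := nontangential_exists fa fA.
exists N; split => // t t2 Nt.
have Hb : nontangential_limit f (cis t) (boundary f (cis t)).
  by apply: (xgetPex 0); exact: HN.
have two : 1 < 2%:R :> R by rewrite ltr1n.
apply/cvg_normcP => e e0.
have /cvg_normcP /(_ e e0) := Hb 2%:R two.
rewrite /within /= => /nbhs_normcP[d d0 hd].
have /cvg_normcP /(_ _ d0)[k0 _ hk] := @rad_cvg R t.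
exists k0 => // k kk0; apply: hd; first exact: hk.
exact: rad_stolz.
Qed.

Lemma cont_rad k : continuous (fun t => f ((rad k)%:C * cis t)).
Proof. exact: (cont_analytic fa (ltW (rad_gt0 R k)) (rad_lt1 R k)). Qed.

Lemma mean_sq_le_hsq r : 0 <= r -> r < 1 -> mean_sq f r <= hsq f.
Proof. by move=> r0 r1; apply: mean_sq_le => // n; exact: (coef_sq_le_hsq fA). Qed.

(** Fatou's lemma along circles gives the inequality of the left side by the
    right one.  Conversely, a Taylor polynomial p carries all but eta^2 of the
    squared norm, the boundary values of f - p have squared mean at most eta^2,
    again by Fatou's lemma, and p is continuous on the circle: so the boundary
    values of f cannot have lost mass. *)
Lemma hardy_integral :
  circle_integral (fun zeta => (normc (boundary f zeta) ^+ 2)%:E) = (hsq f)%:E.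
Proof.
have [N [mN N0 HN]] := boundary_radial.
have p0 := pi2_gt0 R.
pose b t := boundary f (cis t); pose u t := normc (b t) ^+ 2.
have u0 t : 0 <= u t by rewrite exprn_ge0 ?normc_ge0.
have sq_cvg (F : nat -> C) l : F k @[k --> \oo] --> l ->
    normc (F k) ^+ 2 @[k --> \oo] --> normc l ^+ 2.
  by move=> /cvg_normc h; apply: cvgM; exact: h.
have up : (\int[mu]_(x in D) (u x)%:E <= (2 * pi * hsq f)%:E)%E.
  apply: (@ae_fatou (fun k t => normc (f ((rad k)%:C * cis t)) ^+ 2) u N) => //.
  - by move=> k t; exact: continuous_normc2 (@cont_rad k t).
  - by move=> k x; rewrite exprn_ge0 ?normc_ge0.
  - by move=> t t2 Nt; apply: sq_cvg; exact: HN.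
  - by move=> k; exact: (mean_sq_le_hsq (ltW (rad_gt0 R k)) (rad_lt1 R k)).
have i0 : (0 <= \int[mu]_(x in D) (u x)%:E)%E.
  by apply: integral_ge0 => x _; rewrite lee_fin.
have ifin : (\int[mu]_(x in D) (u x)%:E)%E \is a fin_num.
  by rewrite ge0_fin_numE// (le_lt_trans up)// ltry.
pose J := (2 * pi)^-1 * fine (\int[mu]_(x in D) (u x)%:E)%E.
have JE : (\int[mu]_(x in D) (u x)%:E = (2 * pi * J)%:E)%E.
  by rewrite /J mulVKf ?gt_eqF// fineK.
have J0 : 0 <= J by rewrite /J mulr_ge0 ?invr_ge0 ?(ltW p0)// fine_ge0.
have mD0 : measurable (D `\` N) by apply: measurableD => //; exact: mitv.
have mu_u : measurable_fun (D `\` N) u.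
  apply: (@measurable_ae_lim (fun k t => normc (f ((rad k)%:C * cis t)) ^+ 2) u N) => //.
  - by move=> k t; exact: continuous_normc2 (@cont_rad k t).
  - by move=> t t2 Nt; apply: sq_cvg; exact: HN.
have main eta : 0 < eta -> eta <= 1 -> hsq f <= J + eta * (J + 3).
  move=> eta0 eta1.
  have d0 : 0 < eta ^+ 2 by rewrite exprn_gt0.
  have [n [hn tn]] := hsq_tail fa fA d0.
  pose p t := psum f n (cis t).
  have cp : continuous p.
    move=> t; have := @cont_circle R (psum f n) 1 ler01.
    have cpn z : normc z = 1 -> {for z, continuous (psum f n)}.
      by move=> _; exact: analytic_continuous (@analytic_psum R f n z).
    move=> /(_ cpn t); rewrite /p.
    rewrite (_ : (fun t => psum f n (1%:C * cis t)) = (fun t => psum f n (cis t))).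
      exact: id.
    by apply/funext => s; rewrite mul1r.
  pose v t := normc (b t - p t) ^+ 2.
  have v0 t : 0 <= v t by rewrite exprn_ge0 ?normc_ge0.
  pose G k t := normc (tail f n ((rad k)%:C * cis t)) ^+ 2.
  have cG k : continuous (G k).
    exact: (cont_sq (@analytic_tail R f n fa) (ltW (rad_gt0 R k)) (rad_lt1 R k)).
  have Gv t : 0 <= t <= 2 * pi -> ~ N t -> G k t @[k --> \oo] --> v t.
    move=> t2 Nt; apply: sq_cvg; apply: cvgB; first exact: HN.
    have cpn : {for (cis t), continuous (psum f n)} :=
      analytic_continuous (@analytic_psum R f n (cis t)).
    exact: (cvg_comp _ _ (@rad_cvg R t) cpn).
  have vup : (\int[mu]_(x in D) (v x)%:E <= (2 * pi * eta ^+ 2)%:E)%E.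
    have G0 k x : 0 <= G k x by rewrite exprn_ge0 ?normc_ge0.
    have GB k : mean (G k) <= eta ^+ 2.
      apply: (mean_sq_le (@analytic_tail R f n fa) (ltW (rad_gt0 R k)) (rad_lt1 R k)).
      exact: tn.
    exact: (@ae_fatou G v N (eta ^+ 2) mN N0 cG G0 v0 Gv GB).
  have mv : measurable_fun (D `\` N) v by exact: (@measurable_ae_lim G v N).
  have pE : (\int[mu]_(x in D) (normc (p x) ^+ 2)%:E = (2 * pi * coef_sq f n)%:E)%E.
    have := @circle_integral_mean (fun z => normc (psum f n z) ^+ 2).
    have c2 : continuous (fun t => normc (psum f n (cis t)) ^+ 2).
      by move=> t; exact: continuous_normc2 (cp t).
    move=> /(_ c2); rewrite (mean_sq_trig (coef f) n) /circle_integral -/(coef_sq f n) => h.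
    by rewrite EFinM -h muleA -EFinM divff ?gt_eqF// mul1e.
  have ineq : (\int[mu]_(x in D `\` N) (normc (p x) ^+ 2)%:E <=
     \int[mu]_(x in D `\` N) ((1 + eta) * u x + (1 + eta^-1) * v x)%:E)%E.
    apply: ge0_le_integral => //.
    - by move=> x _; rewrite lee_fin exprn_ge0 ?normc_ge0.
    - apply: measurable_funTS; apply/measurable_EFinP; apply: continuous_measurable_fun.
      by move=> t; exact: continuous_normc2 (cp t).
    - by apply/measurable_EFinP; apply: measurable_funD; apply: measurable_funM.
    - move=> x _; rewrite lee_fin /u /v.
      have := sqr_normcD_le (b x) (p x - b x) eta0.
      by rewrite addrC subrK normcB.
  have e0 : 0 <= 1 + eta by lra.
  have ei0 : 0 <= 1 + eta^-1 by rewrite addr_ge0// invr_ge0 ltW.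
  have pull (k : R) (h : R -> R) : 0 <= k -> (forall x, 0 <= h x) -> measurable_fun (D `\` N) h ->
    (\int[mu]_(x in D `\` N) (k%:E * (h x)%:E) = k%:E * \int[mu]_(x in D `\` N) (h x)%:E)%E.
    move=> k0 h0 mh; apply: ge0_integralZl_EFin => //.
    - by move=> x _; rewrite lee_fin.
    - exact/measurable_EFinP.
  have : (\int[mu]_(x in D `\` N) ((1 + eta) * u x + (1 + eta^-1) * v x)%:E =
     (1 + eta)%:E * \int[mu]_(x in D) (u x)%:E + (1 + eta^-1)%:E * \int[mu]_(x in D) (v x)%:E)%E.
    rewrite (integral_null mN N0 u0) (integral_null mN N0 v0).
    have pm (k : R) (h : R -> R) : measurable_fun (D `\` N) h ->
        measurable_fun (D `\` N) (fun x => (k%:E * (h x)%:E)%E).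
      move=> mh; rewrite (_ : (fun x => _) = EFin \o (fun x => k * h x)).
        by apply/measurable_EFinP; exact: measurable_funM.
      by apply/funext => x; rewrite /= EFinM.
    have pp (k : R) (h : R -> R) : 0 <= k -> (forall x, 0 <= h x) ->
        forall x, (D `\` N) x -> (0 <= k%:E * (h x)%:E)%E.
      by move=> k0 h0 x _; rewrite -EFinM lee_fin mulr_ge0.
    have H := ge0_integralD mu mD0 (pp _ u e0 u0) (pm _ u mu_u) (pp _ v ei0 v0) (pm _ v mv).
    rewrite -(pull _ u e0 u0 mu_u) -(pull _ v ei0 v0 mv).
    etransitivity; last exact: H.
    by apply: eq_integral => x _; rewrite EFinD !EFinM.
  move=> E; rewrite E JE -(integral_null mN N0) in ineq; last first.
    by move=> x; rewrite exprn_ge0 ?normc_ge0.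
  rewrite pE in ineq.
  have : ((2 * pi * coef_sq f n)%:E <= ((1 + eta) * (2 * pi * J) + (1 + eta^-1) * (2 * pi * eta ^+ 2))%:E)%E.
    rewrite (le_trans ineq)// [X in (_ <= X)%E]EFinD (EFinM (1 + eta) (2 * pi * J)).
    rewrite (EFinM (1 + eta^-1)) leeD2l// lee_pmul2l//.
    by rewrite lte_fin addr_gt0// invr_gt0.
  rewrite lee_fin.
  have -> : (1 + eta) * (2 * pi * J) + (1 + eta^-1) * (2 * pi * eta ^+ 2) =
     2 * pi * ((1 + eta) * J + (eta ^+ 2 + eta)).
    have gen (q : R) : (1 + eta) * (q * J) + (1 + eta^-1) * (q * eta ^+ 2) =
      q * ((1 + eta) * J + (eta ^+ 2 + eta)) by field; rewrite gt_eqF.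
    exact: gen.
  rewrite ler_pM2l// => h1.
  have h2 : eta ^+ 2 <= eta by rewrite expr2 ler_piMl// ltW.
  have -> : J + eta * (J + 3) = (1 + eta) * J + 3 * eta by ring.
  by lra.
rewrite /circle_integral JE -EFinM mulKf ?gt_eqF//; congr (_%:E).
apply/eqP; rewrite eq_le; apply/andP; split.
  by rewrite JE lee_fin ler_pM2l in up.
apply/ler_addgt0Pr => e e0.
pose eta := Num.min 1 (e / (J + 3)).
have J3 : 0 < J + 3 by lra.
have eta0 : 0 < eta by rewrite lt_min ltr01 divr_gt0.
have eta1 : eta <= 1 by rewrite ge_min lexx.
rewrite (le_trans (main eta eta0 eta1))// lerD2l -ler_pdivlMr//.
by rewrite ge_min lexx orbT.
Qed.

End boundary_values.

End hardy_norm.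

(** * The Hardy space as a space of coefficient sequences *)
Section hardy_space.
Variable R : realType.
Local Notation C := R[i].
Local Notation cRe := (@complex.Re R).
Local Notation mu := (@lebesgue_measure R).
Local Notation D := (`[0%R, (2 * pi)%R]%classic : set R).
Local Notation rad := (@rad R).
Implicit Types (f g h : C -> C) (r t : R) (z w a b : C).

Definition H2 f := analytic_on disc f /\ exists A, forall n, coef_sq f n <= A.

Lemma hsq_ge f n : H2 f -> coef_sq f n <= hsq f.
Proof. by move=> [fa [A fA]]; exact: (coef_sq_le_hsq fA). Qed.

Lemma hsq_le f B : (forall n, coef_sq f n <= B) -> hsq f <= B.
Proof.
by move=> fB; apply: ge_sup; [exists (coef_sq f 0); exists 0%N|move=> _ [n _ <-]].
Qed.

Lemma H2_mean f B : analytic_on disc f ->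
  (forall r, 0 <= r -> r < 1 -> mean_sq f r <= B) -> H2 f /\ hsq f <= B.
Proof.
move=> fa fB; have h := coef_sq_le fa fB.
by split; [split => //; exists B|exact: hsq_le].
Qed.

Lemma H2_bounded f B : analytic_on disc f -> 0 <= B ->
  (forall z, disc z -> normc (f z) <= B) -> H2 f /\ hsq f <= B ^+ 2.
Proof.
move=> fa B0 fB; apply: H2_mean => // r r0 r1.
rewrite /mean_sq -[X in _ <= X](@mean_cst R); apply: le_mean.
- exact: cont_sq.
- by move=> t; exact: cvg_cst.
- move=> t; rewrite ler_pXn2r ?nnegrE ?normc_ge0//; apply: fB.
  by rewrite /disc /mkset normc_polar.
Qed.

Lemma H2_hsq_ge0 f : H2 f -> 0 <= hsq f.
Proof. by move=> fH; rewrite (le_trans (coef_sq_ge0 f 0))// hsq_ge. Qed.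

Lemma eq_coef_sq f g n : (forall z, disc z -> f z = g z) -> coef_sq f n = coef_sq g n.
Proof. by move=> fg; apply: eq_bigr => k _; rewrite (eq_coef k fg). Qed.

Lemma eq_hsq f g : (forall z, disc z -> f z = g z) -> hsq f = hsq g.
Proof.
move=> fg; congr sup; apply/seteqP.
by split => _ [n _ <-]; exists n => //; rewrite (eq_coef_sq n fg).
Qed.

Lemma eq_analytic f g : (forall z, disc z -> f z = g z) ->
  analytic_on disc f -> analytic_on disc g.
Proof.
move=> fg fa z zd; apply: (@near_eq_derivable _ C C f); last exact: fa.
apply/nbhs_normcP; exists (1 - normc z); first by rewrite subr_gt0.
move=> w wz; apply: fg; rewrite /disc /mkset.
have := le_normcD (w - z) z; rewrite subrK; lra.
Qed.

Lemma eq_H2 f g : (forall z, disc z -> f z = g z) -> H2 f -> H2 g.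
Proof.
move=> fg [fa [A fA]]; split; first exact: eq_analytic fa.
by exists A => n; rewrite -(eq_coef_sq n fg).
Qed.

Lemma H2_lin (k : C) f g : H2 f -> H2 g -> H2 (fun z => k * f z + g z).
Proof.
move=> [fa [A fA]] [ga [B gB]]; split.
  move=> z zd; exact: (derivable_addc (derivable_mulc (derivable_const k z) (fa z zd)) (ga z zd)).
exists (2 * normc k ^+ 2 * A + 2 * B) => n.
rewrite (le_trans (y := 2 * normc k ^+ 2 * coef_sq f n + 2 * coef_sq g n))//; last first.
  by rewrite lerD// ler_wpM2l// mulr_ge0// exprn_ge0// normc_ge0.
rewrite /coef_sq !mulr_sumr -big_split; apply: ler_sum => i _.
change (normc (coef (fun z => k * f z + g z) i) ^+ 2 <=
  2 * normc k ^+ 2 * normc (coef f i) ^+ 2 + 2 * normc (coef g i) ^+ 2).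
rewrite (@coef_lin R k f g i fa ga).
by have := @sqr_normcD_le R 1 (k * coef f i) (coef g i) ltr01; rewrite invr1 normcM exprMn mulrA.
Qed.

(** The Minkowski inequality on coefficients, from sqr_normcD_le with the optimal
    parameter Y / X. *)
Lemma hsq_triangle f g h (X Y : R) : H2 f -> H2 g -> 0 < X -> 0 < Y ->
  hsq f <= X ^+ 2 -> hsq g <= Y ^+ 2 -> (forall z, disc z -> h z = f z + g z) ->
  hsq h <= (X + Y) ^+ 2.
Proof.
move=> fH gH X0 Y0 fX gY hE.
have hE1 z : disc z -> h z = 1 * f z + g z by move=> zd; rewrite mul1r hE.
rewrite (eq_hsq hE1); apply: hsq_le => n.
have eta0 : 0 < Y / X by rewrite divr_gt0.
rewrite (le_trans (y := (1 + Y / X) * coef_sq f n + (1 + (Y / X)^-1) * coef_sq g n))//.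
  rewrite /coef_sq !mulr_sumr -big_split; apply: ler_sum => i _.
  change (normc (coef (fun z => 1 * f z + g z) i) ^+ 2 <=
    (1 + Y / X) * normc (coef f i) ^+ 2 + (1 + (Y / X)^-1) * normc (coef g i) ^+ 2).
  by rewrite (@coef_lin R 1 f g i fH.1 gH.1) mul1r; exact: sqr_normcD_le.
have -> : (X + Y) ^+ 2 = (1 + Y / X) * X ^+ 2 + (1 + (Y / X)^-1) * Y ^+ 2.
  by field; rewrite !gt_eqF.
rewrite lerD// ler_wpM2l//.
- by rewrite addr_ge0// ltW.
- exact: le_trans (hsq_ge n fH) fX.
- by rewrite addr_ge0// invr_ge0 ltW.
- exact: le_trans (hsq_ge n gH) gY.
Qed.

Lemma hsqZ (k : C) f : H2 f -> hsq (fun z => k * f z) <= normc k ^+ 2 * hsq f.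
Proof.
move=> fH; apply: hsq_le => n.
rewrite (le_trans (y := normc k ^+ 2 * coef_sq f n))//; last first.
  by rewrite ler_wpM2l ?hsq_ge// exprn_ge0// normc_ge0.
rewrite /coef_sq mulr_sumr; apply: ler_sum => i _.
have -> : coef (fun z => k * f z) i = k * coef f i + 0 * coef f i.
  rewrite mul0r addr0 -[RHS]addr0 -(coef0 R i).
  rewrite -(@coef_lin R k f (fun=> 0) i fH.1 (@analytic_cst R 0)).
  by apply: eq_coef => z _; rewrite addr0.
by rewrite mul0r addr0 normcM exprMn.
Qed.

(** Elements of hardy2 vanish off the disc; ext turns a function that matters on
    the disc only into such a representative. *)
Definition ext f : C -> C := patch (fun=> 0) disc f.

Lemma extE f z : disc z -> ext f z = f z.
Proof. by move=> zd; rewrite /ext patchE mem_set. Qed.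

Lemma ext_out f z : ~ disc z -> ext f z = 0.
Proof. by move=> zd; rewrite /ext patchE memNset. Qed.

Lemma ext_eq f z : disc z -> f z = ext f z. Proof. by move=> /extE. Qed.

Lemma circle_integral_sq f r : analytic_on disc f -> 0 <= r -> r < 1 ->
  circle_integral (fun zeta => (normc (f (r%:C * zeta)) ^+ 2)%:E) = (mean_sq f r)%:E.
Proof.
move=> fa r0 r1; rewrite (@circle_integral_mean R (fun z => normc (f (r%:C * z)) ^+ 2))//.
exact: cont_sq.
Qed.

Lemma H2_hardy2 f : H2 f -> hardy2 (ext f).
Proof.
move=> fH; have eH := eq_H2 (@ext_eq f) fH; split.
- exact: eH.1.
- by move=> z; exact: ext_out.
- apply: (@le_lt_trans _ _ (hsq (ext f))%:E); last exact: ltry.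
  apply: ge_ereal_sup => x [r rI <-]; move: rI; rewrite /= in_itv /= => /andP[r0 r1].
  rewrite circle_integral_sq ?lee_fin//; last exact: eH.1.
  by apply: mean_sq_le => // [|n]; [exact: eH.1|exact: hsq_ge].
Qed.

Lemma hardy2_H2 f : hardy2 f -> H2 f.
Proof.
move=> [fa _ fsup]; split => //.
set S := ereal_sup _ in fsup.
have le1 r : 0 <= r -> r < 1 -> ((mean_sq f r)%:E <= S)%E.
  move=> r0 r1; rewrite -circle_integral_sq//; apply: ereal_sup_ubound.
  by exists r => //=; rewrite in_itv /= r0.
have S0 : (0 <= S)%E.
  rewrite (le_trans _ (le1 0 (lexx _) ltr01))// lee_fin mean_ge0// => t.
  by rewrite exprn_ge0// normc_ge0.
have SE : S = (fine S)%:E by rewrite fineK// ge0_fin_numE.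
exists (fine S); apply: coef_sq_le => // r r0 r1.
by rewrite -lee_fin -SE le1.
Qed.

Lemma hardy2_normE f : H2 f -> hardy2_norm f = (Num.sqrt (hsq f))%:E.
Proof. by move=> [fa [A fA]]; rewrite /hardy2_norm (hardy_integral fa fA). Qed.

Lemma hardy2_norm_le f (X : R) : H2 f -> 0 <= X ->
  (hardy2_norm f <= X%:E)%E = (hsq f <= X ^+ 2).
Proof.
move=> fH X0; rewrite hardy2_normE// lee_fin.
by rewrite -[in RHS](sqr_sqrtr (H2_hsq_ge0 fH)) ler_pXn2r ?nnegrE ?sqrtr_ge0.
Qed.

Lemma hardy2_lin (k : C) f g : hardy2 f -> hardy2 g -> hardy2 (fun z => k * f z + g z).
Proof.
move=> fh gh.
have H := H2_lin k (hardy2_H2 fh) (hardy2_H2 gh).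
rewrite (_ : (fun z => k * f z + g z) = ext (fun z => k * f z + g z)); first exact: H2_hardy2.
apply/funext => z; have [zd|zd] := pselect (disc z); first by rewrite extE.
by rewrite ext_out// (let: And3 _ h _ := fh in h z zd) (let: And3 _ h _ := gh in h z zd) mulr0 addr0.
Qed.

(** * Normalized reproducing kernels *)
Definition ker a z : C := (Num.sqrt (1 - normc a ^+ 2))%:C / (1 - conjc a * z).

Lemma ker_den_neq0 a z : disc a -> normc z <= 1 -> 1 - conjc a * z != 0.
Proof. by move=> ad z1; apply: one_sub_neq0; exact: disc_conjM. Qed.

Lemma derivable_ker a z : disc a -> normc z <= 1 -> derivable (ker a) z 1.
Proof.
move=> ad z1; apply: (derivable_mulc (derivable_const _ z)).
apply: (@derivable_invc R (fun z => 1 - conjc a * z) z (ker_den_neq0 ad z1)).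
apply: (derivable_subc (derivable_const _ z)).
exact: (derivable_mulc (derivable_const _ z) (derivable_ident z)).
Qed.

Lemma one_sub_sq a : disc a -> 0 < 1 - normc a ^+ 2.
Proof. by move=> ad; rewrite subr_gt0 expr_lt1// normc_ge0. Qed.

Lemma ker_sq a z : disc a ->
  normc (ker a z) ^+ 2 = (1 - normc a ^+ 2) / normc (1 - conjc a * z) ^+ 2.
Proof.
move=> ad; rewrite /ker normcM normcV exprMn normc_real ?sqrtr_ge0//.
by rewrite sqr_sqrtr ?exprVn// ltW// one_sub_sq.
Qed.

Lemma ker_bound a z : disc a -> normc z <= 1 ->
  normc (ker a z) <= Num.sqrt (1 - normc a ^+ 2) / (1 - normc a).
Proof.
move=> ad z1; rewrite /ker normcM normcV normc_real ?sqrtr_ge0//.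
rewrite ler_wpM2l ?sqrtr_ge0// lef_pV2 ?posrE ?subr_gt0//; last first.
  by rewrite normc_gt0 ker_den_neq0.
rewrite (le_trans _ (ge_normcB _ _))// normc1 lerD2l lerN2 normcM normc_conj.
by rewrite ler_piMr// normc_ge0.
Qed.

Lemma H2_ker_comp a psi : disc a -> analytic_on disc psi ->
  (forall z, disc z -> disc (psi z)) -> H2 (fun z => ker a (psi z)).
Proof.
move=> ad pa pd.
have B0 : 0 <= Num.sqrt (1 - normc a ^+ 2) / (1 - normc a).
  by rewrite divr_ge0 ?sqrtr_ge0// subr_ge0 ltW.
have ka : analytic_on disc (fun z => ker a (psi z)).
  move=> z zd; have pz : normc (psi z) <= 1 by rewrite ltW// pd.
  exact: (derivable_chain (pa z zd) (derivable_ker ad pz)).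
have kb z : disc z ->
    normc (ker a (psi z)) <= Num.sqrt (1 - normc a ^+ 2) / (1 - normc a).
  by move=> zd; apply: ker_bound => //; rewrite ltW// pd.
exact: (@H2_bounded (fun z => ker a (psi z)) _ ka B0 kb).1.
Qed.

Lemma H2_ker a : disc a -> H2 (ker a).
Proof.
by move=> ad; apply: (@H2_ker_comp a id ad) => // z _; exact: derivable_ident.
Qed.

(** The kernel function ker a is continuous on the closed disc, so the boundary
    values of ker a o psi are ker a of those of psi, almost everywhere; and
    |ker a|^2 is the integrand of the theorem. *)
Lemma kernel_integral a psi : disc a -> analytic_on disc psi ->
  (forall z, disc z -> disc (psi z)) ->
  circle_integral (fun zeta =>
    ((1 - normc a ^+ 2) / normc (1 - conjc a * boundary psi zeta) ^+ 2)%:E) =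
  (hsq (fun z => ker a (psi z)))%:E.
Proof.
move=> ad pa pd.
have [ka [A kA]] := H2_ker_comp ad pa pd.
have [_ [A1 pA]] : H2 psi.
  have pb z : disc z -> normc (psi z) <= 1 by move=> zd; rewrite ltW// pd.
  exact: (@H2_bounded psi 1 pa ler01 pb).1.
rewrite -(hardy_integral ka kA) /circle_integral; congr (_ * _)%E.
have [N1 [mN1 N10 HN1]] := boundary_radial pa pA.
have [N2 [mN2 N20 HN2]] := boundary_radial ka kA.
pose N := N1 `|` N2.
have mN : measurable N by exact: measurableU.
have N0 : mu N = 0%E.
  apply: measure_negligible => //.
  by apply: negligibleU; [exists N1|exists N2]; split.
rewrite (@integral_null R (fun t => (1 - normc a ^+ 2) /
  normc (1 - conjc a * boundary psi (cis t)) ^+ 2) N mN N0); last first.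
  by move=> t; rewrite -ker_sq// exprn_ge0// normc_ge0.
rewrite (@integral_null R (fun t => normc (boundary (fun z => ker a (psi z)) (cis t)) ^+ 2) N mN N0); last first.
  by move=> t; rewrite exprn_ge0// normc_ge0.
apply: eq_integral => t; rewrite inE => -[/= tD nN]; congr (_%:E).
rewrite in_itv /= in tD.
have cv1 := HN1 t tD (fun hn => nN (or_introl hn)).
have cv2 := HN2 t tD (fun hn => nN (or_intror hn)).
have pr k : normc (psi ((rad k)%:C * cis t)) <= 1.
  rewrite ltW//; apply: pd; rewrite /disc /mkset normc_polar ?ltW ?rad_gt0//.
  exact: rad_lt1.
have b1 : normc (boundary psi (cis t)) <= 1.
  have h : normc (psi ((rad k)%:C * cis t)) @[k --> \oo] --> normc (boundary psi (cis t)) by exact: cvg_normc cv1.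
  rewrite -(cvg_lim (@Rhausdorff R) h); apply: limr_le; first by apply/cvg_ex; eexists; exact: h.
  by apply: nearW => k; exact: pr.
have ck : {for (boundary psi (cis t)), continuous (ker a)} :=
  analytic_continuous (derivable_ker ad b1).
have cv3 : ker a (psi ((rad k)%:C * cis t)) @[k --> \oo] --> ker a (boundary psi (cis t)).
  exact: (cvg_comp _ _ cv1 ck).
rewrite -ker_sq//; congr (_ ^+ 2).
have lim2 : normc (ker a (psi ((rad k)%:C * cis t))) @[k --> \oo] -->
  normc (boundary (fun z => ker a (psi z)) (cis t)) by exact: cvg_normc cv2.
have lim3 : normc (ker a (psi ((rad k)%:C * cis t))) @[k --> \oo] -->
  normc (ker a (boundary psi (cis t))) by exact: cvg_normc cv3.
by rewrite -(cvg_lim (@Rhausdorff R) lim3) -(cvg_lim (@Rhausdorff R) lim2).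
Qed.

(** The geometric series, read off from ker b = s + conj b * z * ker b. *)
Lemma coef_ker b n : disc b ->
  coef (ker b) n = (Num.sqrt (1 - normc b ^+ 2))%:C * conjc b ^+ n.
Proof.
move=> bd; set s := (Num.sqrt _)%:C.
have ka z : disc z -> derivable (ker b) z 1.
  by move=> zd; apply: derivable_ker => //; exact: ltW.
pose zk z := z * ker b z.
have zka : analytic_on disc zk.
  by move=> z zd; exact: (derivable_mulc (derivable_ident z) (ka z zd)).
have h0 := half_gt0 R; have h1 := half_lt1 R.
have rec m : coef (ker b) m = conjc b * coef zk m + s * (0%N == m)%:R.
  rewrite -(coef_monomial R 0 m).
  have sa : analytic_on disc (fun z : C => z ^+ 0) by move=> z _; exact: derivable_pow.
  have ska : analytic_on disc (fun z : C => s * z ^+ 0 + 0).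
    move=> z _; apply: (derivable_addc _ (derivable_const 0 z)).
    exact: (derivable_mulc (derivable_const s z) (@derivable_pow R 0 z)).
  have e1 : s * coef (fun z : C => z ^+ 0) m = coef (fun z : C => s * z ^+ 0 + 0) m.
    by rewrite (@coef_lin R s (fun z : C => z ^+ 0) (fun=> 0) m sa (@analytic_cst R 0)) coef0 addr0.
  rewrite e1 -(@coef_lin R (conjc b) zk _ m zka ska).
  apply: eq_coef => z zd; rewrite addr0 expr0 mulr1 /zk /ker -/s.
  have dn : 1 - conjc b * z != 0 by apply: ker_den_neq0 => //; exact: ltW.
  by field.
elim: n => [|n IH].
  rewrite rec expr0 (_ : coef zk 0 = 0) ?mulr0 ?add0r//.
  transitivity (Cmean (fun t => (1 / 2)%:C * cis t * ker b ((1 / 2)%:C * cis t))).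
    by apply: eq_Cmean => t; rewrite expr0 divr1.
  have dA z : annulus 0 (1 / 2) z -> derivable (ker b) z 1.
    by move=> /andP[_ z1]; apply: ka; exact: le_lt_trans z1 h1.
  rewrite -(@Cmean_annulus R 0 (1 / 2) (ker b) (lexx 0) (ltW h0) (ltW h1) dA).
  by rewrite -[RHS]Cmean_cst; apply: eq_Cmean => t; rewrite !mul0r.
rewrite rec mulr0 addr0 exprS mulrCA -IH; congr (_ * _).
apply: eq_Cmean => t; have z0 := polar_neq0 t h0.
have gen (x y w : C) : x != 0 -> x * y / (x * w) = y / w.
  by move=> x0; rewrite invfM mulrACA divff// mul1r.
by rewrite /zk exprS gen.
Qed.

(** The cross term is the inner product of f with ker b, which by the
    reproducing property is sqrt (1 - |b|^2) * f b.  For bounded f it tends to 0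
    as |b| tends to 1: this is the weak convergence to 0 of the kernels. *)
Lemma hsq_add_ker f b : H2 f -> disc b ->
  hsq (fun z => f z + ker b z) <=
  hsq f + 1 + 2 * (Num.sqrt (1 - normc b ^+ 2) * normc (f b)).
Proof.
move=> fH bd; set s := Num.sqrt _.
have s0 : 0 <= s := sqrtr_ge0 _.
have kH := H2_ker bd.
have sumE n : coef_sq (fun z => f z + ker b z) n <=
    hsq f + 1 + 2 * (s * normc (psum f n b)).
  have -> : coef_sq (fun z => f z + ker b z) n =
      coef_sq f n + s ^+ 2 * \sum_(0 <= k < n) (normc b ^+ 2) ^+ k +
      2 * cRe (s%:C * conjc (psum f n b)).
    have -> : cRe (s%:C * conjc (psum f n b)) =
        \sum_(0 <= k < n) cRe (s%:C * conjc (coef f k * b ^+ k)).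
      by rewrite /psum conjc_sum mulr_sumr (raddf_sum (@complex.Re R)).
    rewrite !mulr_sumr /coef_sq -!big_split.
    apply: eq_bigr => k _.
    change (normc (coef (fun z => f z + ker b z) k) ^+ 2 =
      normc (coef f k) ^+ 2 + s ^+ 2 * (normc b ^+ 2) ^+ k +
      2 * cRe (s%:C * conjc (coef f k * b ^+ k))).
    have -> : coef (fun z => f z + ker b z) k = coef f k + s%:C * conjc b ^+ k.
      rewrite -(coef_ker k bd) -[coef f k]mul1r -(@coef_lin R 1 f (ker b) k fH.1 kH.1).
      by apply: eq_coef => z _; rewrite mul1r.
    rewrite normc_sqrD normcM normcX normc_conj normc_real// exprMn -exprAC.
    congr (_ + 2 * cRe _).
    by rewrite conjcM conjcX mulrCA.
  have b2 : normc b ^+ 2 < 1 by rewrite expr_lt1// normc_ge0.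
  have h1 : s ^+ 2 * \sum_(0 <= k < n) (normc b ^+ 2) ^+ k <= 1.
    rewrite /s sqr_sqrtr ?(ltW (one_sub_sq bd))// mulrC -ler_pdivlMr ?one_sub_sq//.
    have := @geometric_tail R (normc b ^+ 2) 0 n (sqr_ge0 _) b2.
    by rewrite expr0 mul1r.
  have h2 : cRe (s%:C * conjc (psum f n b)) <= s * normc (psum f n b).
    by rewrite (le_trans (Re_le_normc _))// normcM normc_conj normc_real.
  have h3 := hsq_ge n fH.
  by lra.
apply: hsq_le => n; apply/ler_addgt0Pr => e e0.
have cv : normc (psum f n b) @[n --> \oo] --> normc (f b) by exact: cvg_normc (psum_cvg fH.1 bd).
have e2 : 0 < e / (2 * (s + 1)) by rewrite divr_gt0// mulr_gt0//; lra.
move/cvgrPdist_lt : cv => /(_ _ e2)[m0 _ hm].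
pose m := maxn n m0.
rewrite (le_trans (coef_sq_nd _ (leq_maxl n m0)))// (le_trans (sumE m))//.
have := hm m (leq_maxr n m0); rewrite /= distrC => h.
have h' : normc (psum f m b) <= normc (f b) + e / (2 * (s + 1)).
  by rewrite -lerBlDl (le_trans (ler_norm _))// ltW.
have h2 : s * normc (psum f m b) <= s * (normc (f b) + e / (2 * (s + 1))) by rewrite ler_wpM2l.
have h3 : s * (e / (2 * (s + 1))) <= e / 2.
  have s1 : 0 < s + 1 by lra.
  have -> : s * (e / (2 * (s + 1))) = e / 2 * (s / (s + 1)) by field; rewrite gt_eqF.
  by rewrite ler_piMr ?divr_ge0 ?(ltW e0)// ler_pdivrMr// mul1r lerDl.
by rewrite mulrDr in h2; lra.
Qed.

End hardy_space.

(** * Lower bound for the essential norm *)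
Section lower_bound.
Variable R : realType.
Local Notation C := R[i].
Local Notation rad := (@rad R).
Implicit Types (f g v : C -> C) (z a : C).

Lemma H2_sub f g : H2 f -> H2 g -> H2 (fun z => f z - g z).
Proof.
move=> fH gH; have := @H2_lin R (-1) g f gH fH.
by apply: eq_H2 => z _; rewrite mulN1r addrC.
Qed.

Lemma hsq_distC f g : H2 f -> H2 g -> hsq (fun z => f z - g z) <= hsq (fun z => g z - f z).
Proof.
move=> fH gH; have H := @hsqZ R (-1) _ (H2_sub gH fH).
rewrite normcN normc1 expr1n mul1r in H.
have E z : disc z -> f z - g z = -1 * (g z - f z) by move=> _; rewrite mulN1r opprB.
by rewrite (eq_hsq E); exact: H.
Qed.

Lemma compact_subsequence (K : (C -> C) -> (C -> C)) (u : nat -> C -> C) :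
  compact_operator K -> (forall n, hardy2 (u n) /\ hsq (u n) <= 1) ->
  exists (k : nat -> nat) g, [/\ forall n, (n <= k n)%N, hardy2 g &
    forall d : R, 0 < d -> exists n0, forall n, (n0 <= n)%N ->
      hsq (fun z => K (u (k n)) z - g z) <= d ^+ 2].
Proof.
move=> [KH _ Kc] uH.
have uB n : hardy2 (u n) /\ (hardy2_norm (u n) <= 1)%E.
  have [h1 h2] := uH n; split => //.
  by rewrite (@hardy2_norm_le R (u n) 1 (hardy2_H2 h1) ler01) expr1n.
have [k [g [kh gh kg]]] := Kc u uB; exists k, g; split => //.
  by elim=> // n IH; exact: leq_ltn_trans IH (kh _ _ (ltnSn n)).
move=> d d0.
have dH n : H2 (fun z => K (u (k n)) z - g z).
  by apply: H2_sub; apply: hardy2_H2 => //; apply: KH; exact: (uH _).1.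
have := kg; under eq_fun do rewrite hardy2_normE//.
move=> /fine_cvg /cvgrPdist_lt /(_ _ d0)[n0 _ h]; exists n0 => n nn.
have := h n nn; rewrite /= sub0r normrN ger0_norm ?sqrtr_ge0// => /ltW h1.
by rewrite -(@hardy2_norm_le R _ d (dH n) (ltW d0)) hardy2_normE// lee_fin.
Qed.

Lemma ker_hsq_le1 a : disc a -> hsq (ker a) <= 1.
Proof.
move=> ad; apply: hsq_le => n; rewrite /coef_sq.
have a2 : normc a ^+ 2 < 1 by rewrite expr_lt1// normc_ge0.
have -> : \sum_(0 <= k < n) normc (coef (ker a) k) ^+ 2 =
    (1 - normc a ^+ 2) * \sum_(0 <= k < n) (normc a ^+ 2) ^+ k.
  rewrite mulr_sumr; apply: eq_bigr => k _.
  rewrite coef_ker// normcM normcX normc_conj normc_real ?sqrtr_ge0// exprMn.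
  by rewrite sqr_sqrtr; [congr (_ * _); exact: exprAC|exact/ltW/one_sub_sq].
rewrite mulrC -ler_pdivlMr ?one_sub_sq//.
have := @geometric_tail R (normc a ^+ 2) 0 n (sqr_ge0 _) a2.
by rewrite expr0.
Qed.

Section compact.
Variables (K : (C -> C) -> (C -> C)) (Kc : compact_operator K).

Let KH f : hardy2 f -> H2 (K f).
Proof. by case: Kc => h _ _ fh; apply: hardy2_H2; exact: h. Qed.

Let Klin (c : C) f g z : hardy2 f -> hardy2 g ->
  K (fun z => c * f z + g z) z = c * K f z + K g z.
Proof. by case: Kc => _ h _ fh gh; rewrite h. Qed.

Lemma hardy2_zero : hardy2 (fun _ : C => 0 : C).
Proof.
have -> : (fun _ : C => 0 : C) = ext (fun _ : C => 0).
  by apply/funext => z; rewrite /ext patchE; case: ifP.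
apply: H2_hardy2.
have b z : disc z -> normc (0 : C) <= 0 by move=> _; rewrite normc0.
exact: (@H2_bounded R _ 0 (@analytic_cst R 0) (lexx 0) b).1.
Qed.

Lemma compact_zero z : K (fun=> 0) z = 0.
Proof.
have h := @Klin (-1) _ _ z hardy2_zero hardy2_zero.
transitivity (K (fun _ : C => -1 * 0 + 0) z); last by rewrite h mulN1r addNr.
by congr (K _ z); apply/funext => x; rewrite mulr0 addr0.
Qed.

Lemma ext_ker a : disc a -> hardy2 (ext (ker a)) /\ hsq (ext (ker a)) <= 1.
Proof.
move=> ad; split; first by apply: H2_hardy2; exact: H2_ker.
by rewrite (@eq_hsq R _ (ker a) (@extE R (ker a))) ker_hsq_le1.
Qed.

Section kernels.
Variables (v : nat -> C) (g : C -> C) (d : R).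
Hypotheses (vd : forall n, disc (v n)) (v1 : forall n, rad n <= normc (v n)).
Hypotheses (gh : hardy2 g) (d0 : 0 < d).
Variable n0 : nat.
Hypothesis vg : forall n, (n0 <= n)%N ->
  hsq (fun z => K (ext (ker (v n))) z - g z) <= d ^+ 2.

Lemma small_kernel (B : R) : 0 < B ->
  exists n, (n0 <= n)%N /\ Num.sqrt (1 - normc (v n) ^+ 2) * B <= 1 / 2.
Proof.
move=> B0; pose e := (1 / (2 * B)) ^+ 2 / 2.
have e0 : 0 < e by rewrite divr_gt0// exprn_gt0// divr_gt0// mulr_gt0.
move/cvgrPdist_lt : (@cvg_harmonic R) => /(_ _ e0)[N _ HN].
exists (maxn n0 N); split; first exact: leq_maxl.
set n := maxn n0 N; have := HN n (leq_maxr n0 N).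
rewrite /= sub0r normrN ger0_norm// => h.
have h2 : 1 - rad n < e.
  rewrite /rad opprB addrC subrK (le_lt_trans _ h)// lef_pV2 ?posrE//.
  by rewrite ler_nat.
have h3 : 1 - normc (v n) ^+ 2 <= (1 / (2 * B)) ^+ 2.
  have a1 := v1 n; have a2 : normc (v n) < 1 := vd n; have a3 := normc_ge0 (v n).
  have : e * 2 = (1 / (2 * B)) ^+ 2 by rewrite /e; field; rewrite gt_eqF.
  by rewrite expr2; nra.
have b0 : 0 <= 1 / (2 * B) by rewrite divr_ge0// mulr_ge0// ltW.
have : Num.sqrt (1 - normc (v n) ^+ 2) <= 1 / (2 * B).
  by rewrite -(ger0_norm b0) -sqrtr_sqr ler_wsqrtr.
move=> h4; rewrite (le_trans (ler_wpM2r (ltW B0) h4))//.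
by rewrite le_eqVlt; apply/orP; left; apply/eqP; field; rewrite gt_eqF.
Qed.

(** Kernels are added one at a time, each so close to the circle that it is
    almost orthogonal to the bounded sum of the previous ones: the squared
    norm grows by at most 2, while the image under K moves by g up to d. *)
Lemma kernel_sums N : exists f, [/\ hardy2 f,
  exists2 B, 0 < B & forall z, disc z -> normc (f z) <= B,
  hsq f <= 2 * N%:R &
  hsq (fun z => K f z - N%:R * g z) <= (N.+1%:R * d) ^+ 2].
Proof.
elim: N => [|N [f [fh [B B0 fB] f2 fK]]].
  exists (fun=> 0); split.
  - exact: hardy2_zero.
  - by exists 1 => // z _; rewrite normc0.
  - by rewrite mulr0; apply: hsq_le => n; rewrite /coef_sq big1// => k _; rewrite coef0 normc0 expr0n.
  - apply: (@le_trans _ _ 0); last exact: sqr_ge0.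
    rewrite (@eq_hsq R _ (fun=> 0)); last by move=> z _; rewrite compact_zero mul0r subr0.
    by apply: hsq_le => n; rewrite /coef_sq big1// => k _; rewrite coef0 normc0 expr0n.
have [n [nn nB]] := small_kernel B0.
have ad := vd n; set a := v n in ad nB.
have [eh e1] := ext_ker ad.
exists (fun z => 1 * ext (ker a) z + f z); split.
- exact: hardy2_lin.
- set A := Num.sqrt (1 - normc a ^+ 2) / (1 - normc a).
  have A0 : 0 <= A by rewrite divr_ge0 ?sqrtr_ge0// subr_ge0 ltW.
  exists (A + B) => [|z zd]; first by rewrite ltr_wpDl.
  rewrite (le_trans (le_normcD _ _))// mul1r extE// lerD ?fB//.
  by apply: ker_bound => //; exact: ltW.
- have fE z : disc z -> 1 * ext (ker a) z + f z = f z + ker a z.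
    by move=> zd; rewrite mul1r extE// addrC.
  rewrite (eq_hsq fE) (le_trans (@hsq_add_ker R f a (hardy2_H2 fh) ad))//.
  have h : Num.sqrt (1 - normc a ^+ 2) * normc (f a) <= 1 / 2.
    by rewrite (le_trans _ nB)// ler_wpM2l ?sqrtr_ge0// fB.
  move: f2 h; move: (hsq f) (Num.sqrt _ * _) => x y f2 h.
  by rewrite -addn1 natrD; lra.
- have gH := hardy2_H2 gh.
  have NgH : H2 (fun z => N%:R * g z).
    have := @H2_lin R N%:R g _ gH (hardy2_H2 hardy2_zero).
    by apply: eq_H2 => z _; rewrite addr0.
  have H1 : H2 (fun z => K (ext (ker a)) z - g z) := H2_sub (KH eh) gH.
  have H3 : H2 (fun z => K f z - N%:R * g z) := H2_sub (KH fh) NgH.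
  have N0 : 0 < N.+1%:R * d by rewrite mulr_gt0// ltr0n.
  have -> : N.+2%:R * d = d + N.+1%:R * d by rewrite -addn1 natrD; ring.
  apply: (@hsq_triangle R _ _ _ d (N.+1%:R * d) H1 H3 d0 N0 (vg nn) fK) => z zd.
  by rewrite Klin// -addn1 natrD; ring.
Qed.

(** A sum of N kernels has norm at most sqrt (2 N) and its image under K is N g up
    to about N d.  Since K is bounded, dividing by N shows that the norm of g is O (1 / sqrt N)
    plus about d. *)
Lemma kernel_limit_small : hsq g <= (4 * d) ^+ 2.
Proof.
have sqr_shift (x : R) : 0 <= x -> [/\ x <= (x + 1) ^+ 2, 0 < x + 1 & x + 2 = 1 + (x + 1)].
  by move=> x0; split; [rewrite expr2; nra|lra|ring].
have num : (d + 2 * d) ^+ 2 <= (4 * d) ^+ 2 by rewrite !expr2; nra.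
(* Boundedness of K on the sums F N.+1 is obtained from compactness,
   after normalizing them by s N = sqrt (2 (N + 1)). *)
have [F HF] := choice kernel_sums.
pose s (n : nat) : R := Num.sqrt (2 * n.+1%:R).
have s0 n : 0 < s n by rewrite sqrtr_gt0 mulr_gt0// ltr0n.
have s2 n : s n ^+ 2 = 2 * n.+1%:R by rewrite sqr_sqrtr// mulr_ge0// ler0n.
pose u n z := (s n)^-1%:C * F n.+1 z + 0.
have uH n : hardy2 (u n) /\ hsq (u n) <= 1.
  have [Fh _ F2 _] := HF n.+1; split.
    by apply: (@hardy2_lin R _ _ (fun=> 0)) => //; exact: hardy2_zero.
  have uE z : disc z -> u n z = (s n)^-1%:C * F n.+1 z by move=> _; rewrite /u addr0.
  rewrite (eq_hsq uE) (le_trans (@hsqZ R _ _ (hardy2_H2 Fh)))//.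
  rewrite normc_real ?invr_ge0 ?(ltW (s0 n))// exprVn s2 mulrC.
  by rewrite ler_pdivrMr ?mulr_gt0 ?ltr0n// mul1r.
have [k [g' [kn g'h kg']]] := compact_subsequence Kc uH.
have g'H := hardy2_H2 g'h; have gH := hardy2_H2 gh.
have [m0 hm0] := kg' 1 ltr01.
pose M := hsq g' + 2.
have g'0 := H2_hsq_ge0 g'H.
have M0 : 0 < M by rewrite /M ltr_wpDl.
have e0 : 0 < d ^+ 2 / (2 * M ^+ 2) by rewrite divr_gt0 ?exprn_gt0// mulr_gt0 ?exprn_gt0.
move/cvgrPdist_lt : (@cvg_harmonic R) => /(_ _ e0)[m1 _ hm1].
pose m := maxn m0 m1; pose N := k m.
have Nm1 : (m1 <= N)%N := leq_trans (leq_maxr m0 m1) (kn m).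
have := hm1 N Nm1; rewrite /= sub0r normrN ger0_norm// => hN.
have [Fh _ F2 FK] := HF N.+1.
have KuH : H2 (K (u N)) by apply: KH; exact: (uH N).1.
(* the image of the normalized sum is bounded independently of N *)
have Ku : hsq (K (u N)) <= M ^+ 2.
  have [h2 M1 ME] := sqr_shift _ g'0; rewrite /M ME.
  apply: (@hsq_triangle R _ _ _ _ _ (H2_sub KuH g'H) g'H ltr01 M1 (hm0 m (leq_maxl m0 m1)) h2).
  by move=> z _; rewrite subrK.
have KuE z : K (u N) z = (s N)^-1%:C * K (F N.+1) z.
  by rewrite (@Klin _ _ (fun=> 0) z Fh hardy2_zero) compact_zero addr0.
have n0' : 0 < N.+1%:R :> R by rewrite ltr0n.
have cN : N.+1%:R != 0 :> C by rewrite -normc_gt0 normc_nat.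
have KFH : H2 (K (F N.+1)) := KH Fh.
have NgH : H2 (fun z => N.+1%:R * g z).
  have := @H2_lin R N.+1%:R g _ gH (hardy2_H2 hardy2_zero).
  by apply: eq_H2 => z _; rewrite addr0.
(* g is recovered as an average of the images of the kernels, up to d *)
have h1 : hsq (fun z => (s N / N.+1%:R)%:C * K (u N) z) <= d ^+ 2.
  rewrite (le_trans (@hsqZ R _ _ KuH))// normc_real ?divr_ge0 ?(ltW (s0 N))// expr_div_n s2.
  have c0 : 0 <= 2 * N.+1%:R / N.+1%:R ^+ 2 :> R by rewrite divr_ge0 ?exprn_ge0 ?mulr_ge0 ?ler0n.
  apply: (le_trans (ler_wpM2l c0 Ku)).
  have gen (x y : R) : 0 < x -> 2 * x / x ^+ 2 * y = x^-1 * (2 * y).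
    by move=> x0; field; rewrite gt_eqF.
  have M2 : 0 < 2 * M ^+ 2 by rewrite mulr_gt0 ?exprn_gt0.
  by rewrite (gen _ _ n0') -(ler_pdivlMr _ _ M2); exact: ltW hN.
have h2 : hsq (fun z => N.+1%:R^-1 * (N.+1%:R * g z - K (F N.+1) z)) <= (2 * d) ^+ 2.
  rewrite (le_trans (@hsqZ R _ _ (H2_sub NgH KFH)))// normcV normc_nat.
  have h := le_trans (hsq_distC NgH KFH) FK.
  rewrite (le_trans (ler_wpM2l _ h))// ?exprn_ge0 ?invr_ge0 ?(ltW n0')//.
  rewrite -exprMn ler_pXn2r ?nnegrE//; last 2 first.
  - by rewrite !mulr_ge0 ?invr_ge0 ?ler0n// ltW.
  - by rewrite mulr_ge0// ltW.
  by rewrite mulrA ler_pM2r// mulrC ler_pdivrMr// -natrM ler_nat mul2n doubleS !ltnS -addnn leq_addr.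
have H1 : H2 (fun z => (s N / N.+1%:R)%:C * K (u N) z).
  have := @H2_lin R (s N / N.+1%:R)%:C _ _ KuH (hardy2_H2 hardy2_zero).
  by apply: eq_H2 => z _; rewrite addr0.
have H3 : H2 (fun z => N.+1%:R^-1 * (N.+1%:R * g z - K (F N.+1) z)).
  have := @H2_lin R N.+1%:R^-1 _ _ (H2_sub NgH KFH) (hardy2_H2 hardy2_zero).
  by apply: eq_H2 => z _; rewrite addr0.
have d2 : 0 < 2 * d by rewrite mulr_gt0.
have := @hsq_triangle R _ _ g d (2 * d) H1 H3 d0 d2 h1 h2.
have E z : disc z -> g z = (s N / N.+1%:R)%:C * K (u N) z +
    N.+1%:R^-1 * (N.+1%:R * g z - K (F N.+1) z).
  move=> _; rewrite KuE rmorphM/= fmorphV rmorph_nat.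
  have sc : (s N)%:C != 0 by rewrite -normc_gt0 normc_real ?(ltW (s0 N)).
  have -> : (s N)^-1%:C = (s N)%:C^-1 by rewrite fmorphV.
  have gen (n t x y : C) : n != 0 -> t != 0 -> y = t / n * (t^-1 * x) + n^-1 * (n * y - x).
    by move=> n0'' t0; field; rewrite n0'' t0.
  exact: gen.
move=> /(_ E) h; apply: (le_trans h).
exact: num.
Qed.

End kernels.

(** If C_psi (ker a) were larger than X + e along points a tending to the circle,
    then K (ker a), at distance at most X from it, would stay away from 0; by
    compactness it would accumulate at some nonzero g, contradicting
    kernel_limit_small. *)
Lemma essential_lower psi (X : R) : analytic_on disc psi ->
  (forall z, disc z -> disc (psi z)) -> 0 <= X ->
  (operator_norm (fun f z => (composition_operator psi f z - K f z)%R) <= X%:E)%E ->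
  forall e, 0 < e -> exists r : R, r < 1 /\ forall a, r < normc a -> normc a < 1 ->
    hsq (fun z => ker a (psi z)) <= (X + e) ^+ 2.
Proof.
move=> pa pd X0 KX e e0.
have p1 : 0 < X + e / 4 by lra.
have p2 : 0 < e / 2 by lra.
have p3 : 0 < 4 * (e / 16) by lra.
have d0 : 0 < e / 16 by lra.
have n1 : X ^+ 2 <= (X + e / 4) ^+ 2 by rewrite !expr2; nra.
have n2 : (X + e / 4 + e / 2) ^+ 2 <= (X + e) ^+ 2 by rewrite !expr2; nra.
have n3 : (e / 16 + 4 * (e / 16)) ^+ 2 <= (e / 2) ^+ 2 by rewrite !expr2; nra.
apply: contrapT => Hn.
have Hn' n : exists a, [/\ rad n < normc a, disc a &
    (X + e) ^+ 2 < hsq (fun z => ker a (psi z))].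
  apply: contrapT => h; apply: Hn; exists (rad n); split; first exact: rad_lt1.
  move=> a ra a1; rewrite leNgt; apply/negP => h1; apply: h; exists a; split => //.
have [a Ha] := choice Hn'.
have ad n : disc (a n) by case: (Ha n).
have Kv n : (e / 2) ^+ 2 < hsq (K (ext (ker (a n)))).
  rewrite ltNge; apply/negP => h.
  have [_ _ big] := Ha n; have [vh v1] := ext_ker (ad n).
  set v := ext (ker (a n)) in h vh v1.
  have TH : H2 (composition_operator psi v).
    apply: (@eq_H2 R (fun z => ker (a n) (psi z))); last exact: H2_ker_comp.
    by move=> z zd; rewrite /composition_operator patchE mem_set//= /v extE// ; exact: pd.
  have TE z : disc z -> ker (a n) (psi z) = (composition_operator psi v z - K v z) + K v z.
    move=> zd; rewrite subrK /composition_operator patchE mem_set//= /v extE//; exact: pd.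
  have TK : hsq (fun z => composition_operator psi v z - K v z) <= (X + e / 4) ^+ 2.
    have h1 : (hardy2_norm (fun z => (composition_operator psi v z - K v z)%R) <= X%:E)%E.
      apply: le_trans KX; apply: ereal_sup_ubound; exists v => //; split => //.
      by rewrite (@hardy2_norm_le R v 1 (hardy2_H2 vh) ler01) expr1n.
    rewrite (@hardy2_norm_le R _ X (H2_sub TH (KH vh)) X0) in h1.
    exact: (le_trans h1).
  have := @hsq_triangle R _ _ _ _ _ (H2_sub TH (KH vh)) (KH vh) p1 p2 TK h TE.
  move=> h2; have := lt_le_trans big h2.
  by rewrite ltNge n2.
have vB n : hardy2 (ext (ker (a n))) /\ hsq (ext (ker (a n))) <= 1 by exact: ext_ker.
have [k [g [kn gh kg]]] := compact_subsequence Kc vB.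
have [n0 hn0] := kg _ d0.
have v1 n : rad n <= normc (a (k n)).
  apply: (@le_trans _ _ (rad (k n))); last by case: (Ha (k n)) => /ltW.
  by rewrite /rad lerD2l lerN2 lef_pV2 ?posrE// ler_nat !ltnS.
have gs := @kernel_limit_small (fun n => a (k n)) g (e / 16) (fun n => ad (k n)) v1 gh d0 n0 hn0.
have := Kv (k n0); rewrite ltNge => /negP; apply.
have := @hsq_triangle R _ _ (K (ext (ker (a (k n0))))) _ _
  (H2_sub (KH (vB (k n0)).1) (hardy2_H2 gh)) (hardy2_H2 gh) d0 p3 (hn0 n0 (leqnn _)) gs.
move=> h; apply: (le_trans (h _)); first by move=> z _; rewrite subrK.
exact: n3.
Qed.

End compact.
End lower_bound.

(** * Averaging Poisson kernels along an analytic self-map *)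
Section poisson_average.
Variable R : realType.
Local Notation C := R[i].
Local Notation cRe := (@complex.Re R).
Implicit Types (f g : C -> C) (r s t : R) (z w u zeta : C).

Lemma sqr_one_sub s u : normc (1 - s%:C * u) ^+ 2 = 1 - 2 * s * cRe u + s ^+ 2 * normc u ^+ 2.
Proof. by rewrite !normc_sqr; case: u => a b /=; ring. Qed.

Lemma conj_one_sub w zeta : normc (1 - conjc w * zeta) = normc (1 - conjc zeta * w).
Proof.
rewrite -normc_conj; congr normc.
by case: w => a b; case: zeta => c d; apply: eq_ReIm => /=; ring.
Qed.

(** Multiply and divide by conj (1 - u). *)
Lemma Re_herglotz u : normc u < 1 ->
  cRe ((1 + u) / (1 - u)) = (1 - normc u ^+ 2) / normc (1 - u) ^+ 2.
Proof.
move=> u1; have n0 : 1 - u != 0 := one_sub_neq0 u1.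
have m0 : normc (1 - u) ^+ 2 != 0 by rewrite expf_neq0// normc_eq0.
have E : (1 + u) / (1 - u) = ((1 + u) * conjc (1 - u)) * ((normc (1 - u) ^+ 2)^-1)%:C.
  have K : (normc (1 - u) ^+ 2)%:C * ((normc (1 - u) ^+ 2)^-1)%:C = 1.
    by rewrite -rmorphM divff// rmorph1.
  apply: (mulIf n0); rewrite divfK//.
  have gen (p q r k n : C) : q * r = n -> n * k = 1 -> p = p * r * k * q.
    by move=> qr nk; rewrite -[LHS]mulr1 -nk -qr; ring.
  exact: gen (mulc_conj _) K.
rewrite E ReM /= mulr0 subr0; congr (_ / _).
by rewrite normc_sqr; case: u {u1 n0 m0 E} => a b /=; ring.
Qed.

Lemma mean_value f t : analytic_on disc f -> 0 <= t -> t < 1 ->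
  Cmean (fun x => f (t%:C * cis x)) = f 0.
Proof.
move=> fa; rewrite le_eqVlt => /orP[/eqP<- _|t0 t1].
  by rewrite -[RHS]Cmean_cst; apply: eq_Cmean => x; rewrite mul0r.
rewrite -(@cauchy_formula R f t 0 fa) ?normc0//; apply: eq_Cmean => x.
by rewrite subr0 mulfV ?mulr1// polar_neq0.
Qed.

Section selfmap.
Variables (phi : C -> C).
Hypotheses (pa : analytic_on disc phi) (pd : forall z, disc z -> disc (phi z)).

Let herg zeta z := (1 + conjc zeta * phi z) / (1 - conjc zeta * phi z).

Let poissonE zeta z : normc zeta = 1 -> disc z -> poisson (phi z) zeta = cRe (herg zeta z).
Proof.
move=> z1 zd; rewrite /herg Re_herglotz; last first.
  by rewrite normcM normc_conj z1 mul1r; exact: pd.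
by rewrite /poisson conj_one_sub normcM normc_conj z1 mul1r.
Qed.

Let herg_analytic zeta : normc zeta = 1 -> analytic_on disc (herg zeta).
Proof.
move=> z1 z zd; have n0 : 1 - conjc zeta * phi z != 0.
  by apply: one_sub_neq0; rewrite /disc /mkset normcM normc_conj z1 mul1r; exact: pd.
have dm := derivable_mulc (derivable_const (conjc zeta) z) (pa zd).
apply: derivable_mulc; first exact: (derivable_addc (derivable_const 1 z) dm).
exact: (@derivable_invc R (fun z => 1 - conjc zeta * phi z) z n0
  (derivable_subc (derivable_const 1 z) dm)).
Qed.

Lemma cont_poisson_selfmap zeta t : normc zeta = 1 -> 0 <= t -> t < 1 ->
  continuous (fun x => poisson (phi (t%:C * cis x)) zeta).
Proof.
move=> z1 t0 t1.
rewrite (_ : (fun x => _) = (fun x => cRe (herg zeta (t%:C * cis x)))); last first.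
  by apply/funext => x; rewrite poissonE// /disc /mkset normc_polar.
have c := @cont_analytic R (herg zeta) t (herg_analytic z1) t0 t1.
by move=> x; exact: (@continuous_Re R _ (fun x => herg zeta (t%:C * cis x)) x (c x)).
Qed.

(** The Poisson kernel is the real part of an analytic function of its first
    argument, hence has the mean value property along phi. *)
Lemma mean_poisson zeta t : normc zeta = 1 -> 0 <= t -> t < 1 ->
  mean (fun x => poisson (phi (t%:C * cis x)) zeta) = poisson (phi 0) zeta.
Proof.
move=> z1 t0 t1; have d0 : disc (0 : C) by rewrite /disc /mkset normc0.
rewrite (poissonE z1 d0) -(mean_value (herg_analytic z1) t0 t1) Re_Cmean.
by apply: eq_mean => x; rewrite poissonE// /disc /mkset normc_polar.
Qed.

End selfmap.

(** The truncated kernel subtracted from the Poisson kernel of w: by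
    trunc_poissonE it is a harmonic function of w minus the squared modulus of
    the kernel function of the point s * zeta. *)
Definition trunc_poisson s w zeta : R :=
  s ^+ 2 * (1 - normc w ^+ 2) / normc (1 - conjc w * (s%:C * zeta)) ^+ 2.

Lemma disc_scale s z : 0 <= s -> s <= 1 -> disc z -> disc (s%:C * z).
Proof.
move=> s0 s1 zd; rewrite /disc /mkset normcM normc_real// (le_lt_trans _ zd)//.
by rewrite ler_piMl// normc_ge0.
Qed.

Lemma disc_scale1 s zeta : 0 <= s -> s < 1 -> normc zeta = 1 -> disc (s%:C * zeta).
Proof. by move=> s0 s1 z1; rewrite /disc /mkset normcM z1 mulr1 normc_real. Qed.

Lemma trunc_poissonE s w zeta : 0 <= s -> s < 1 -> normc zeta = 1 -> disc w ->
  trunc_poisson s w zeta =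
  poisson (s%:C * w) zeta - normc (ker (s%:C * zeta) w) ^+ 2.
Proof.
move=> s0 s1 z1 wd; rewrite ker_sq; last exact: disc_scale1.
rewrite -conj_one_sub /poisson /trunc_poisson.
have -> : conjc (s%:C * w) * zeta = conjc w * (s%:C * zeta).
  by rewrite conjcM conjc_real mulrCA mulrA.
rewrite -mulrBl !normcM z1 mulr1 normc_real// !exprMn; congr (_ / _); ring.
Qed.

(** With u = conj w * zeta, this says s^2 |1 - u|^2 <= |1 - s u|^2, where the
    difference is (1 - s) (1 + s - 2 s Re u). *)
Lemma trunc_poisson_le s w zeta : 0 <= s -> s <= 1 -> normc zeta = 1 -> disc w ->
  trunc_poisson s w zeta <= poisson w zeta.
Proof.
move=> s0 s1 z1 wd; rewrite /trunc_poisson /poisson.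
have w2 := one_sub_sq wd.
have d1 : 0 < normc (1 - conjc w * zeta) ^+ 2.
  by rewrite exprn_gt0// normc_gt0 one_sub_neq0//; apply: disc_conjM; rewrite ?z1.
have u1 : normc (conjc w * zeta) < 1 by apply: disc_conjM; rewrite ?z1.
rewrite (mulrCA (conjc w)).
have d2 : 0 < normc (1 - s%:C * (conjc w * zeta)) ^+ 2.
  by rewrite exprn_gt0// normc_gt0 one_sub_neq0//; exact: disc_scale.
have gen (n p q S : R) : 0 <= n -> 0 < p -> 0 < q -> S * q <= p -> S * n / p <= n / q.
  move=> n0 p0 q0 Sq; rewrite ler_pdivrMr// [X in _ <= X]mulrAC ler_pdivlMr//.
  by rewrite [X in X <= _]mulrAC [X in _ <= X]mulrC ler_wpM2r.
apply: gen => //; first exact: ltW.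
have E1 : normc (1 - conjc w * zeta) ^+ 2 =
    1 - 2 * cRe (conjc w * zeta) + normc (conjc w * zeta) ^+ 2.
  by have := sqr_one_sub 1 (conjc w * zeta); rewrite rmorph1 !mul1r mulr1 expr1n mul1r.
rewrite sqr_one_sub E1.
have := le_trans (Re_le_normc (conjc w * zeta)) (ltW u1).
move: (cRe _) (normc (conjc w * zeta) ^+ 2) => x y x1.
have h1 : 0 <= 1 - s by rewrite subr_ge0.
have h2 : 0 <= 1 + s - 2 * s * x by clear -s0 s1 x1; nra.
have := mulr_ge0 h1 h2; rewrite -subr_ge0 => h3; rewrite -subr_ge0.
apply: (le_trans h3); rewrite le_eqVlt; apply/orP; left; apply/eqP; ring.
Qed.

(** For fixed s < 1 the denominator stays away from 0: the truncated kernel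
    vanishes as w tends to the circle, uniformly, unlike the Poisson kernel. *)
Lemma trunc_poisson_small s w zeta : 0 <= s -> s < 1 -> normc zeta = 1 -> disc w ->
  trunc_poisson s w zeta <= (1 - normc w ^+ 2) / (1 - s) ^+ 2.
Proof.
move=> s0 s1 z1 wd; have w2 := one_sub_sq wd.
have s1' : 0 < 1 - s by rewrite subr_gt0.
have h : 1 - s <= normc (1 - conjc w * (s%:C * zeta)).
  rewrite (le_trans _ (ge_normcB _ _))// normc1 lerD2l lerN2.
  rewrite !normcM z1 mulr1 normc_conj normc_real// ler_piMl//.
  exact: ltW wd.
rewrite /trunc_poisson ler_pM//.
- by rewrite mulr_ge0 ?sqr_ge0// ltW.
- by rewrite invr_ge0 exprn_ge0// normc_ge0.
- by rewrite ler_piMl ?(ltW w2)// expr_le1// ltW.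
rewrite lef_pV2 ?posrE ?exprn_gt0 ?(lt_le_trans s1' h)//.
by rewrite ler_pXn2r ?nnegrE ?normc_ge0// ltW.
Qed.

Lemma poisson_dilate s w zeta : 0 <= s -> s <= 1 -> normc zeta = 1 -> disc w ->
  poisson w zeta - poisson (s%:C * w) zeta <= 4 * (1 - s) / (1 - normc w) ^+ 4.
Proof.
move=> s0 s1 z1 wd; set u := conjc w * zeta.
have w0 := normc_ge0 w; have w1 : normc w < 1 := wd.
have uw : normc u = normc w by rewrite /u normcM normc_conj z1 mulr1.
rewrite /poisson (_ : conjc (s%:C * w) * zeta = s%:C * u); last first.
  by rewrite conjcM conjc_real mulrA.
rewrite -/u; set d1 := normc (1 - u); set d2 := normc (1 - s%:C * u).
have h1 : 1 - normc w <= d1.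
  by rewrite (le_trans _ (ge_normcB _ _))// normc1 uw.
have h2 : 1 - normc w <= d2.
  rewrite (le_trans _ (ge_normcB _ _))// normc1 normcM uw normc_real//.
  by rewrite lerD2l lerN2 ler_piMl.
have h3 : d2 - d1 <= 1 - s.
  rewrite (le_trans (ge_normcB _ _))//.
  rewrite (_ : _ - _ = (1 - s)%:C * u); last by rewrite rmorphB rmorph1; ring.
  by rewrite normcM normc_real ?subr_ge0// uw ler_piMr ?subr_ge0// ltW.
have h4 : d1 <= 2 by rewrite (le_trans (le_normcB _ _))// normc1 uw; lra.
have h5 : d2 <= 2.
  rewrite (le_trans (le_normcB _ _))// normc1 normcM uw normc_real//.
  have : s * normc w <= 1 by rewrite mulr_ile1// ltW.
  lra.
rewrite normcM normc_real//.
have c0 : 0 < 1 - normc w by rewrite subr_gt0.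
move: (normc w) d1 d2 w0 w1 c0 h1 h2 h3 h4 h5 => {uw} x a b x0 x1 c0 h1 h2 h3 h4 h5.
have a0 : 0 < a := lt_le_trans c0 h1.
have b0 : 0 < b := lt_le_trans c0 h2.
have k1 : (1 - x ^+ 2) / b ^+ 2 <= (1 - (s * x) ^+ 2) / b ^+ 2.
  rewrite ler_pM2r ?invr_gt0 ?exprn_gt0// lerD2l lerN2 ler_pXn2r ?nnegrE ?mulr_ge0//.
  by rewrite ler_piMl.
apply: (@le_trans _ _ ((1 - x ^+ 2) * (b ^+ 2 - a ^+ 2) / (a ^+ 2 * b ^+ 2))).
  have -> : (1 - x ^+ 2) * (b ^+ 2 - a ^+ 2) / (a ^+ 2 * b ^+ 2) =
      (1 - x ^+ 2) / a ^+ 2 - (1 - x ^+ 2) / b ^+ 2.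
    by field; rewrite !gt_eqF.
  by rewrite lerD2l lerN2.
have k2 : (1 - x ^+ 2) * (b ^+ 2 - a ^+ 2) <= 4 * (1 - s).
  have y0 : 0 <= 1 - x ^+ 2 by rewrite subr_ge0 expr_le1// ltW.
  have y1 : 1 - x ^+ 2 <= 1 by rewrite gerBl sqr_ge0.
  have q : b ^+ 2 - a ^+ 2 <= 4 * (1 - s) by rewrite subr_sqr; nra.
  have [ba|/ltW ba] := leP (b ^+ 2 - a ^+ 2) 0.
    apply: (@le_trans _ _ 0); first by rewrite mulr_ge0_le0.
    by rewrite mulr_ge0// subr_ge0.
  by rewrite (le_trans _ q)// ler_piMl.
have k3 : (1 - x) ^+ 4 <= a ^+ 2 * b ^+ 2.
  rewrite (_ : 4 = 2 + 2)%N// exprD ler_pM ?exprn_ge0 ?(ltW c0)//.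
    by rewrite ler_pXn2r ?nnegrE// ltW.
  by rewrite ler_pXn2r ?nnegrE// ltW.
apply: (@le_trans _ _ (4 * (1 - s) / (a ^+ 2 * b ^+ 2))).
  by rewrite ler_pM2r ?invr_gt0 ?mulr_gt0 ?exprn_gt0.
rewrite ler_wpM2l ?mulr_ge0 ?subr_ge0// lef_pV2 ?posrE ?mulr_gt0 ?exprn_gt0//.
Qed.

(** As a function of zeta, the truncated kernel is a multiple of the Poisson
    kernel of s * w. *)
Lemma cont_trunc_poisson s w : 0 <= s -> s <= 1 -> disc w ->
  continuous (fun t => trunc_poisson s w (cis t)).
Proof.
move=> s0 s1 wd.
rewrite (_ : (fun t => _) =
  (fun t => s ^+ 2 * (1 - normc w ^+ 2) / (1 - normc (s%:C * w) ^+ 2) *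
            poisson (s%:C * w) (cis t))); last first.
  apply/funext => t; rewrite /trunc_poisson /poisson.
  have -> : conjc (s%:C * w) * cis t = conjc w * (s%:C * cis t).
    by rewrite conjcM conjc_real mulrCA mulrA.
  have gen (a c d : R) : d != 0 -> a / c = a / d * (d / c).
    by move=> d0; rewrite mulrA divfK.
  by apply: gen; rewrite gt_eqF//; exact/one_sub_sq/disc_scale.
move=> t; apply: cvgM; first exact: cvg_cst.
by apply: cont_poisson; exact: disc_scale.
Qed.

End poisson_average.

(** * Exchange of two averages *)
Section exchange.
Variable R : realType.
Local Notation mu := (@lebesgue_measure R).
Local Notation D := (`[0%R, (2 * pi)%R]%classic : set R).

Lemma mean_integral (g : R -> R) : continuous g ->
  (\int[mu]_(t in D) (g t)%:E = (2 * pi * mean g)%:E)%E.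
Proof.
move=> cg; rewrite /mean mulrA mulfV ?gt_eqF ?pi2_gt0// mul1r.
rewrite /rint /Rintegral fineK//; apply: integrable_fin_num => //.
by apply: cts_integrable => t _; exact: cg.
Qed.

Lemma indic_integral (g : R -> R) : continuous g ->
  (\int[mu]_t (\1_D t * g t)%:E = (2 * pi * mean g)%:E)%E.
Proof.
move=> cg; rewrite -mean_integral// [RHS]integral_mkcond; apply: eq_integral => t _.
by rewrite patchE indicE; case: ifP => _; rewrite ?mul1r ?mul0r.
Qed.

(** Tonelli's theorem for F on the square; its inner averages are only compared
    with the continuous functions M and H. *)
Lemma mean_fubini_le (F : R -> R -> R) (M H : R -> R) :
  measurable_fun setT (fun p : measurableTypeR R * measurableTypeR R => F p.1 p.2) ->
  (forall x y, 0 <= F x y) -> (forall x, continuous (F x)) ->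
  (forall y, continuous (fun x => F x y)) -> continuous M -> continuous H ->
  (forall x, 0 <= M x) -> (forall x, M x <= mean (F x)) ->
  (forall y, mean (fun x => F x y) <= H y) -> mean M <= mean H.
Proof.
move=> mF F0 cF1 cF2 cM cH M0 MF FH.
have p0 := pi2_gt0 R; have p1 := ltW p0.
have I0 (t : R) : 0 <= \1_D t :> R by [].
have mI : measurable_fun setT (\1_D : measurableTypeR R -> R).
  by apply: measurable_indic; exact: measurable_itv.
pose f (p : measurableTypeR R * measurableTypeR R) : \bar R :=
  (\1_D p.1 * (\1_D p.2 * F p.1 p.2))%:E.
have f0 p : (0 <= f p)%E by rewrite lee_fin !mulr_ge0.
have mf : measurable_fun setT f.
  apply/measurable_EFinP; apply: measurable_funM.
    exact: (measurableT_comp mI measurable_fst).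
  apply: measurable_funM => //.
  exact: (measurableT_comp mI measurable_snd).
have inner1 x : (\int[mu]_y f (x, y) = (\1_D x * (2 * pi * mean (F x)))%:E)%E.
  transitivity (\int[mu]_y (\1_D y * (\1_D x * F x y))%:E)%E.
    by apply: eq_integral => y _; congr (_%:E); rewrite mulrCA.
  rewrite (@indic_integral (fun y => \1_D x * F x y)).
    by congr (_%:E); rewrite (@meanZ R _ (F x) (cF1 x)) mulrCA.
  by move=> y; apply: cvgM; [exact: cvg_cst|exact: cF1].
have inner2 y : (\int[mu]_x f (x, y) = (\1_D y * (2 * pi * mean (fun x => F x y)))%:E)%E.
  transitivity (\int[mu]_x (\1_D x * (\1_D y * F x y))%:E)%E.
    by apply: eq_integral.
  rewrite (@indic_integral (fun x => \1_D y * F x y)).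
    by congr (_%:E); rewrite (@meanZ R _ (fun x => F x y) (cF2 y)) mulrCA.
  by move=> x; apply: cvgM; [exact: cvg_cst|exact: cF2].
have cs (k : R) (g : R -> R) : continuous g -> continuous (fun x => k * g x).
  by move=> cg x; apply: cvgM; [exact: cvg_cst|exact: cg].
have H0 y : 0 <= H y by apply: le_trans (FH y); exact: mean_ge0.
have iM := @indic_integral (fun x => 2 * pi * M x) (cs _ _ cM).
have iH := @indic_integral (fun x => 2 * pi * H x) (cs _ _ cH).
rewrite (@meanZ R _ M cM) in iM; rewrite (@meanZ R _ H cH) in iH.
have n0 : measurable (set0 : set R) := measurable0.
have m0 : mu set0 = 0%E by rewrite measure0.
have key : ((2 * pi * (2 * pi * mean M))%:E <= (2 * pi * (2 * pi * mean H))%:E)%E.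
  rewrite -iM -iH.
  apply: (@le_trans _ _ (\int[mu]_x \int[mu]_y f (x, y))%E).
    apply: (@ge0_le_integral_null R _ _ set0 n0 m0).
    - by move=> x; rewrite lee_fin !mulr_ge0 ?pi_ge0.
    - by move=> x; apply: integral_ge0 => y _; exact: f0.
    - by move=> x _; rewrite inner1 lee_fin ler_wpM2l// ler_wpM2l.
  rewrite (@fubini_tonelli _ _ _ _ R mu mu f mf f0).
  apply: (@ge0_le_integral_null R _ _ set0 n0 m0).
  - by move=> y; apply: integral_ge0 => x _; exact: f0.
  - by move=> y; rewrite lee_fin !mulr_ge0 ?pi_ge0.
  - by move=> y _; rewrite inner2 lee_fin ler_wpM2l// ler_wpM2l.
by move: key; rewrite lee_fin !(ler_pM2l p0).
Qed.

End exchange.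

(** * Composition operators on tails of power series *)
Section tail_estimate.
Variable R : realType.
Local Notation C := R[i].
Local Notation cRe := (@complex.Re R).
Local Notation cIm := (@complex.Im R).
Local Notation rad := (@rad R).
Local Notation mR := (measurableTypeR R).
Variables (psi : C -> C) (s L e : R).
Hypotheses (pa : analytic_on disc psi) (pd : forall z, disc z -> disc (psi z)).
Hypotheses (s0 : 0 <= s) (s1 : s < 1).
Hypothesis kerL : forall zeta, normc zeta = 1 ->
  hsq (fun z => ker (s%:C * zeta) (psi z)) <= L.
Hypothesis pe : forall zeta, normc zeta = 1 ->
  poisson (psi 0) zeta - poisson (s%:C * psi 0) zeta <= e.
Implicit Types (f g : C -> C) (r t x y : R) (z w zeta : C).

Let dpolar t x : 0 <= t -> t < 1 -> disc (t%:C * cis x).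
Proof. by move=> t0 t1; rewrite /disc /mkset normc_polar. Qed.

Let psi_scale_analytic : analytic_on disc (fun z => s%:C * psi z).
Proof. by move=> z zd; exact: (derivable_mulc (derivable_const s%:C z) (pa zd)). Qed.

Let psi_scale_disc z : disc z -> disc (s%:C * psi z).
Proof. by move=> zd; apply: disc_scale => //; [exact: ltW|exact: pd]. Qed.

Let continuousB (a b : R -> R) : continuous a -> continuous b ->
  continuous (fun x => a x - b x).
Proof. by move=> ca cb x; apply: cvgB; [exact: ca|exact: cb]. Qed.

Let continuousM (a b : R -> R) : continuous a -> continuous b ->
  continuous (fun x => a x * b x).
Proof. by move=> ca cb x; apply: cvgM; [exact: ca|exact: cb]. Qed.

Let continuousD (a b : R -> R) : continuous a -> continuous b ->
  continuous (fun x => a x + b x).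
Proof. by move=> ca cb x; apply: cvgD; [exact: ca|exact: cb]. Qed.

Let continuousC (k : R) : continuous (fun _ : R => k).
Proof. by move=> x; exact: cvg_cst. Qed.

Lemma cont_trunc_selfmap zeta t : normc zeta = 1 -> 0 <= t -> t < 1 ->
  continuous (fun x => trunc_poisson s (psi (t%:C * cis x)) zeta) /\
  mean (fun x => trunc_poisson s (psi (t%:C * cis x)) zeta) =
  poisson (s%:C * psi 0) zeta - mean_sq (fun z => ker (s%:C * zeta) (psi z)) t.
Proof.
move=> z1 t0 t1.
have kd := disc_scale1 s0 s1 z1.
have cP := @cont_poisson_selfmap R _ psi_scale_analytic psi_scale_disc zeta t z1 t0 t1.
have ck := @cont_sq R _ t (H2_ker_comp kd pa pd).1 t0 t1.
have E : (fun x => trunc_poisson s (psi (t%:C * cis x)) zeta) =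
    (fun x => poisson (s%:C * psi (t%:C * cis x)) zeta -
              normc (ker (s%:C * zeta) (psi (t%:C * cis x))) ^+ 2).
  by apply/funext => x; rewrite trunc_poissonE//; apply: pd; exact: dpolar.
rewrite E; split; first exact: (continuousB cP ck).
rewrite (meanB cP ck).
by rewrite (@mean_poisson R _ psi_scale_analytic psi_scale_disc zeta t z1 t0 t1).
Qed.

(** Both Poisson kernels have the mean value property along psi, and the
    remaining term is the mean square of the kernel function of s * zeta
    composed with psi. *)
Lemma mean_kernel_gap zeta t : normc zeta = 1 -> 0 <= t -> t < 1 ->
  mean (fun x => poisson (psi (t%:C * cis x)) zeta -
                 trunc_poisson s (psi (t%:C * cis x)) zeta) <= L + e.
Proof.
move=> z1 t0 t1; have [cV mV] := cont_trunc_selfmap z1 t0 t1.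
have cP := @cont_poisson_selfmap R psi pa pd zeta t z1 t0 t1.
rewrite (meanB cP cV) mV (@mean_poisson R psi pa pd zeta t z1 t0 t1).
have kd := disc_scale1 s0 s1 z1; have kH := H2_ker_comp kd pa pd.
have h : mean_sq (fun z => ker (s%:C * zeta) (psi z)) t <= L.
  apply: le_trans (kerL z1); apply: (@mean_sq_le R _ t _ kH.1 t0 t1) => n.
  exact: hsq_ge.
have h2 := pe z1.
rewrite opprB addrA; move: h h2.
move: (poisson _ _) (poisson _ _) (mean_sq _ _) => p q m h h2.
by rewrite addrAC addrC lerD.
Qed.

(** The denominators are polynomials in the coordinates of psi and of the boundary
    point; their inverses are written as powers with exponent -1. *)
Lemma measurable_kernel_gap t : 0 <= t -> t < 1 ->
  measurable_fun setT (fun p : mR * mR =>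
    poisson (psi (t%:C * cis p.1)) (cis p.2) -
    trunc_poisson s (psi (t%:C * cis p.1)) (cis p.2)).
Proof.
move=> t0 t1; pose w x := psi (t%:C * cis x).
have cw : continuous w := cont_analytic pa t0 t1.
have wd x : disc (w x) by apply: pd; exact: dpolar.
have m1 (g : R -> R) : continuous g -> measurable_fun setT (fun p : mR * mR => g p.1).
  by move=> cg; exact: (measurableT_comp (continuous_measurable_fun cg) measurable_fst).
have m2 (g : R -> R) : continuous g -> measurable_fun setT (fun p : mR * mR => g p.2).
  by move=> cg; exact: (measurableT_comp (continuous_measurable_fun cg) measurable_snd).
have mw2 : measurable_fun setT (fun p : mR * mR => normc (w p.1) ^+ 2).
  by apply: (m1 (fun x => normc (w x) ^+ 2)) => x; exact: continuous_normc2 (cw x).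
have mn : measurable_fun setT (fun p : mR * mR => 1 - normc (w p.1) ^+ 2).
  by apply: measurable_funB.
have mre : measurable_fun setT (fun p : mR * mR =>
    cRe (w p.1) * cos p.2 + cIm (w p.1) * sin p.2).
  apply: measurable_funD; apply: measurable_funM.
  - by apply: (m1 (fun x => cRe (w x))) => x; exact: continuous_Re (cw x).
  - by apply: (m2 (@cos R)) => x; exact: continuous_cos.
  - by apply: (m1 (fun x => cIm (w x))) => x; exact: continuous_Im (cw x).
  - by apply: (m2 (@sin R)) => x; exact: continuous_sin.
have md (k : R) : measurable_fun setT (fun p : mR * mR =>
    powR (1 - 2 * k * (cRe (w p.1) * cos p.2 + cIm (w p.1) * sin p.2) +
          k ^+ 2 * normc (w p.1) ^+ 2) (-1)).
  apply: (measurableT_comp (@measurable_powR R (-1))).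
  apply: measurable_funD; last exact: measurable_funM.
  by apply: measurable_funB => //; exact: measurable_funM.
have dE (k : R) x y : normc (1 - conjc (w x) * (k%:C * cis y)) ^+ 2 =
    1 - 2 * k * (cRe (w x) * cos y + cIm (w x) * sin y) + k ^+ 2 * normc (w x) ^+ 2.
  rewrite mulrCA sqr_one_sub normcM normc_conj normc_cis mulr1.
  by congr (_ - _ * _ + _); case: (w x) => a b /=; ring.
rewrite (_ : (fun p => _) = (fun p : mR * mR =>
  (1 - normc (w p.1) ^+ 2) *
    powR (1 - 2 * 1 * (cRe (w p.1) * cos p.2 + cIm (w p.1) * sin p.2) +
          1 ^+ 2 * normc (w p.1) ^+ 2) (-1) -
  s ^+ 2 * (1 - normc (w p.1) ^+ 2) *
    powR (1 - 2 * s * (cRe (w p.1) * cos p.2 + cIm (w p.1) * sin p.2) +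
          s ^+ 2 * normc (w p.1) ^+ 2) (-1))); last first.
  apply/funext => -[x y]; rewrite /fst /snd -!dE !powR_inv1 ?exprn_ge0 ?normc_ge0//.
  by rewrite mul1r.
apply: measurable_funB; apply: measurable_funM => //.
exact: measurable_funM.
Qed.

(** For w well inside the disc a tail is uniformly small; near the circle the
    truncated kernel is negligible, so that it may be subtracted from the
    Poisson kernel in poisson_bound at the cost of k. *)
Lemma tail_pointwise k : 0 < k -> exists n, forall f rho w, H2 f -> hsq f <= 1 ->
  0 < rho -> rho < 1 -> disc w ->
  normc (tail f n (rho%:C * w)) ^+ 2 <=
  k + mean (fun t => normc (tail f n (rho%:C * cis t)) ^+ 2 *
                     (poisson w (cis t) - trunc_poisson s w (cis t))).
Proof.
move=> k0; have s1' : 0 < (1 - s) ^+ 2 by rewrite exprn_gt0// subr_gt0.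
have d0 : 0 < k * (1 - s) ^+ 2 by rewrite mulr_gt0.
(* beyond r the truncated kernel is at most k; within r the n-th tail is *)
pose r := Num.max (1 / 2) (1 - k * (1 - s) ^+ 2 / 2).
have r0 : 0 < r by rewrite lt_max half_gt0.
have r1 : r < 1 by rewrite gt_max half_lt1/= ltrBlDr ltrDl divr_gt0.
have rk : 1 - r ^+ 2 <= k * (1 - s) ^+ 2.
  have : 1 - k * (1 - s) ^+ 2 / 2 <= r by rewrite le_max lexx orbT.
  move: (k * (1 - s) ^+ 2) r0 r1 => q r0 r1 h; rewrite expr2; nra.
have q0 : 0 <= r ^+ 2 by exact: sqr_ge0.
have q1 : r ^+ 2 < 1 by rewrite expr_lt1// ltW.
have [n _ hn] := geometric_small (1 - r ^+ 2)^-1 q0 q1 k0.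
exists n => f rho w fH f1 rho0 rho1 wd.
have fb m : coef_sq f m <= 1 := le_trans (hsq_ge m fH) f1.
set g := tail f n.
have ga : analytic_on disc g := analytic_tail fH.1.
have gb m : coef_sq g m <= 1.
  apply: le_trans (fb (maxn m n)); apply: le_trans (coef_sq_tail n m fH.1).
  by rewrite lerDl coef_sq_ge0.
have cg := cont_sq ga (ltW rho0) rho1.
have cP := cont_poisson wd.
have cV := cont_trunc_poisson s0 (ltW s1) wd.
have g0 t : 0 <= normc (g (rho%:C * cis t)) ^+ 2 by rewrite exprn_ge0 ?normc_ge0.
have [rw|wr] := ltP r (normc w).
- rewrite (@eq_mean R _ (fun t => normc (g (rho%:C * cis t)) ^+ 2 * poisson w (cis t) -
    normc (g (rho%:C * cis t)) ^+ 2 * trunc_poisson s w (cis t))); last first.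
    by move=> t; rewrite mulrBr.
  rewrite (meanB (continuousM cg cP) (continuousM cg cV)).
  have h1 := @poisson_bound R g rho w ga rho0 rho1 wd.
  have h2 : mean (fun t => normc (g (rho%:C * cis t)) ^+ 2 * trunc_poisson s w (cis t)) <= k.
    apply: (@le_trans _ _ (mean (fun t => k * normc (g (rho%:C * cis t)) ^+ 2))).
      apply: (le_mean (continuousM cg cV) (continuousM (@continuousC k) cg)) => t.
      rewrite mulrC ler_wpM2r//.
      apply: (le_trans (trunc_poisson_small s0 s1 (normc_cis t) wd)).
      rewrite ler_pdivrMr// (le_trans _ rk)// lerD2l lerN2 ler_pXn2r ?nnegrE ?normc_ge0//; exact: ltW.
    rewrite (meanZ k cg) -[X in _ <= X]mulr1 ler_wpM2l ?(ltW k0)//.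
    exact: (@mean_sq_le R g rho 1 ga (ltW rho0) rho1 gb).
  apply: (le_trans h1); rewrite addrCA lerDl subr_ge0; exact: h2.
- rewrite -[X in X <= _]addr0 lerD//; last first.
    apply: mean_ge0 => t; rewrite mulr_ge0// subr_ge0.
    by apply: trunc_poisson_le => //; [exact: ltW|exact: normc_cis].
  have hA m : \sum_(0 <= j < m) normc (coef f j) ^+ 2 * (rho ^+ 2) ^+ j <= 1.
    apply: (le_trans (bessel m fH.1 (ltW rho0) rho1)).
    exact: (@mean_sq_le R f rho 1 fH.1 (ltW rho0) rho1 fb).
  apply: (le_trans (tail_bound n fH.1 (ltW rho0) (ltW rho1) wd hA)).
  rewrite mul1r; apply: le_trans (ltW hn).
  have w2 : normc w ^+ 2 <= r ^+ 2 by rewrite ler_pXn2r ?nnegrE ?normc_ge0// ltW.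
  have w0 : 0 <= normc w ^+ 2 by exact: sqr_ge0.
  have w1 : 0 < 1 - normc w ^+ 2 by rewrite subr_gt0 (le_lt_trans w2 q1).
  rewrite mulrC; apply: ler_pM.
  - by rewrite invr_ge0 ltW.
  - by rewrite exprn_ge0.
  - by rewrite lef_pV2 ?posrE// ?subr_gt0// lerD2l lerN2.
  - by rewrite lerXn2r.
Qed.

(** The pointwise bound is averaged over w = psi (t cis x); exchanging the two
    averages leaves the mean of the kernel gap, at most L + e, against the mean
    square of the tail, at most 1.  The dilation factor rho then tends to 1. *)
Lemma tail_composition k : 0 < k -> exists n, forall f, H2 f -> hsq f <= 1 ->
  H2 (fun z => tail f n (psi z)) /\ hsq (fun z => tail f n (psi z)) <= k + (L + e).
Proof.
move=> k0; have [n hn] := tail_pointwise k0; exists n => f fH f1.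
have fb m : coef_sq f m <= 1 := le_trans (hsq_ge m fH) f1.
have ga : analytic_on disc (tail f n) := analytic_tail fH.1.
have gb m : coef_sq (tail f n) m <= 1.
  apply: le_trans (fb (maxn m n)); apply: le_trans (coef_sq_tail n m fH.1).
  by rewrite lerDl coef_sq_ge0.
have z1 : normc (1 : C) = 1 by exact: normc1.
have Le0 : 0 <= L + e.
  have d0 : disc (0 : C) by rewrite /disc /mkset normc0.
  apply: le_trans (mean_kernel_gap z1 (lexx 0) ltr01); apply: mean_ge0 => x.
  rewrite subr_ge0; apply: trunc_poisson_le => //; first exact: ltW.
  by apply: pd; exact: dpolar.
have dil rho t : 0 < rho -> rho < 1 -> 0 <= t -> t < 1 ->
    mean (fun x => normc (tail f n (rho%:C * psi (t%:C * cis x))) ^+ 2) <= k + (L + e).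
  move=> rho0 rho1 t0 t1.
  pose F x y := k + normc (tail f n (rho%:C * cis y)) ^+ 2 *
    (poisson (psi (t%:C * cis x)) (cis y) - trunc_poisson s (psi (t%:C * cis x)) (cis y)).
  pose H y := k + normc (tail f n (rho%:C * cis y)) ^+ 2 * (L + e).
  have cg := cont_sq ga (ltW rho0) rho1.
  have g0 y : 0 <= normc (tail f n (rho%:C * cis y)) ^+ 2 by rewrite exprn_ge0 ?normc_ge0.
  have wd x : disc (psi (t%:C * cis x)) by apply: pd; exact: dpolar.
  have cQ1 x : continuous (fun y => normc (tail f n (rho%:C * cis y)) ^+ 2 *
    (poisson (psi (t%:C * cis x)) (cis y) - trunc_poisson s (psi (t%:C * cis x)) (cis y))).
    apply: (continuousM cg); apply: continuousB; first exact: cont_poisson.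
    by apply: cont_trunc_poisson => //; exact: ltW.
  have cgap y : continuous (fun x => poisson (psi (t%:C * cis x)) (cis y) -
      trunc_poisson s (psi (t%:C * cis x)) (cis y)).
    apply: continuousB; last exact: (cont_trunc_selfmap (normc_cis y) t0 t1).1.
    exact: (@cont_poisson_selfmap R psi pa pd (cis y) t (normc_cis y) t0 t1).
  have cH : continuous H.
    exact: continuousD (@continuousC k) (continuousM cg (@continuousC (L + e))).
  have ca : analytic_on disc (fun z => tail f n (rho%:C * psi z)).
    move=> z zd; have rd : disc (rho%:C * psi z).
      by apply: disc_scale; [exact: ltW|exact: ltW|exact: pd].
    have dm := derivable_mulc (derivable_const rho%:C z) (pa zd).
    exact: (@derivable_chain R (fun z => rho%:C * psi z) (tail f n) z dm (ga _ rd)).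
  have cM := cont_sq ca t0 t1.
  have mF : measurable_fun setT (fun p : mR * mR => F p.1 p.2).
    apply: measurable_funD => //; apply: measurable_funM; last exact: measurable_kernel_gap.
    exact: (measurableT_comp (continuous_measurable_fun cg) measurable_snd).
  have gap0 x y : 0 <= poisson (psi (t%:C * cis x)) (cis y) -
      trunc_poisson s (psi (t%:C * cis x)) (cis y).
    by rewrite subr_ge0; apply: trunc_poisson_le => //; [exact: ltW|exact: normc_cis].
  have F0 x y : 0 <= F x y by rewrite addr_ge0 ?(ltW k0)// mulr_ge0.
  have cF1 x : continuous (F x) := continuousD (@continuousC k) (cQ1 x).
  have cF2 y : continuous (fun x => F x y).
    exact: continuousD (@continuousC k) (continuousM (@continuousC _) (cgap y)).
  have M0 x : 0 <= normc (tail f n (rho%:C * psi (t%:C * cis x))) ^+ 2.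
    by rewrite exprn_ge0 ?normc_ge0.
  have MF x : normc (tail f n (rho%:C * psi (t%:C * cis x))) ^+ 2 <= mean (F x).
    rewrite (@meanD R (fun=> k) _ (@continuousC k) (cQ1 x)) mean_cst.
    exact: (hn f rho _ fH f1 rho0 rho1 (wd x)).
  have FH y : mean (fun x => F x y) <= H y.
    rewrite (@meanD R (fun=> k) _ (@continuousC k) (continuousM (@continuousC _) (cgap y))).
    rewrite mean_cst lerD2l (meanZ _ (cgap y)) ler_wpM2l//.
    exact: mean_kernel_gap (normc_cis y) t0 t1.
  apply: (le_trans (mean_fubini_le mF F0 cF1 cF2 cM cH M0 MF FH)).
  rewrite (@meanD R (fun=> k) _ (@continuousC k) (continuousM cg (@continuousC (L + e)))).
  rewrite mean_cst lerD2l.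
  rewrite (@eq_mean R _ (fun y => (L + e) * normc (tail f n (rho%:C * cis y)) ^+ 2)); last first.
    by move=> y; rewrite mulrC.
  rewrite (meanZ _ cg) -[X in _ <= X]mulr1 ler_wpM2l//.
  exact: (@mean_sq_le R _ rho 1 ga (ltW rho0) rho1 gb).
have gpa : analytic_on disc (fun z => tail f n (psi z)).
  by move=> z zd; exact: (derivable_chain (pa zd) (ga _ (pd zd))).
apply: H2_mean => // t t0 t1.
have wd x : disc (psi (t%:C * cis x)) by apply: pd; exact: dpolar.
have m0 : (@lebesgue_measure R) set0 = 0%E by rewrite measure0.
pose G j x := normc (tail f n ((rad j)%:C * psi (t%:C * cis x))) ^+ 2.
have Gk j : mean (G j) <= k + (L + e) by apply: dil => //; [exact: rad_gt0|exact: rad_lt1].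
have cG j : continuous (G j).
  have r0 := ltW (rad_gt0 R j); have r1 := rad_lt1 R j.
  have ca : analytic_on disc (fun z => tail f n ((rad j)%:C * psi z)).
    move=> z zd; have rd : disc ((rad j)%:C * psi z).
      by apply: disc_scale; [exact: r0|exact: ltW r1|exact: pd].
    have dm := derivable_mulc (derivable_const (rad j)%:C z) (pa zd).
    exact: (@derivable_chain R (fun z => (rad j)%:C * psi z) (tail f n) z dm (ga _ rd)).
  exact: (cont_sq ca t0 t1).
have G0 j x : 0 <= G j x by rewrite exprn_ge0 ?normc_ge0.
have h0 x : 0 <= normc (tail f n (psi (t%:C * cis x))) ^+ 2 by rewrite exprn_ge0 ?normc_ge0.
have Gh x : G j x @[j --> \oo] --> normc (tail f n (psi (t%:C * cis x))) ^+ 2.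
  have cr : (rad j)%:C * psi (t%:C * cis x) @[j --> \oo] --> psi (t%:C * cis x).
    have := @rad_cvg R 0; rewrite (_ : cis 0 = 1) => [h|]; last first.
      by rewrite /cis cos0 sin0.
    rewrite -[X in _ --> X]mul1r.
    by under eq_fun do rewrite -[(rad _)%:C]mulr1; apply: cvgM; [exact: h|exact: cvg_cst].
  have cv := cvg_comp _ _ cr (analytic_continuous (ga _ (wd x))).
  have cn : normc (tail f n ((rad j)%:C * psi (t%:C * cis x))) @[j --> \oo] -->
      normc (tail f n (psi (t%:C * cis x))) by exact: cvg_normc cv.
  by rewrite /G; apply: cvgM; exact: cn.
have := @ae_fatou R G (fun x => normc (tail f n (psi (t%:C * cis x))) ^+ 2) set0
  (k + (L + e)) measurable0 m0 cG G0 h0 (fun x _ _ => Gh x) Gk.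
rewrite mean_integral; last exact: (cont_sq gpa t0 t1).
by rewrite lee_fin ler_pM2l ?pi2_gt0.
Qed.

End tail_estimate.

(** * Upper bound for the essential norm *)
Section upper_bound.
Variable R : realType.
Local Notation C := R[i].
Local Notation cRe := (@complex.Re R).
Local Notation cIm := (@complex.Im R).
Implicit Types (f g : C -> C) (s L e : R) (z a : C).

Lemma bounded_subsequence (u : nat -> R) : (forall n, `|u n| <= 1) ->
  exists (k : nat -> nat) (l : R), {homo k : m n / (m < n)%N} /\ u (k n) @[n --> \oo] --> l.
Proof.
move=> u1.
have bu : bounded_fun u.
  by exists 1; split; [exact: num_real|move=> M M1 x _; exact: le_trans (u1 x) (ltW M1)].
have [k ik /cvg_ex[l kl]] := bolzano_weierstrass bu.
exists k, l; split => // m n mn.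
by rewrite ltnNge; have := ik n m; rewrite leEnat => ->; rewrite -ltnNge.
Qed.

Lemma homo_ltn_id (k : nat -> nat) : {homo k : m n / (m < n)%N} -> forall n, (n <= k n)%N.
Proof. by move=> ik; elim=> // n IH; exact: leq_ltn_trans IH (ik _ _ (ltnSn n)). Qed.

Lemma cvg_subsequence (T : topologicalType) (u : nat -> T) (l : T) (k : nat -> nat) :
  {homo k : m n / (m < n)%N} -> u @ \oo --> l -> u (k n) @[n --> \oo] --> l.
Proof.
move=> ik ul; apply: (@cvg_comp _ _ _ k u \oo \oo) => //.
move=> A [N _ NA]; exists N => // n Nn; apply: NA => /=.
exact: leq_trans Nn (homo_ltn_id ik n).
Qed.

Lemma bounded_subsequenceC (u : nat -> C) : (forall n, normc (u n) <= 1) ->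
  exists (k : nat -> nat) (l : C), {homo k : m n / (m < n)%N} /\ u (k n) @[n --> \oo] --> l.
Proof.
move=> u1.
have [k1 [a [ik1 ka]]] : exists (k : nat -> nat) (l : R), {homo k : m n / (m < n)%N} /\
    cRe (u (k n)) @[n --> \oo] --> l.
  apply: (@bounded_subsequence (fun n => cRe (u n))) => n.
  exact: le_trans (abs_Re_le _) (u1 n).
have [k2 [b [ik2 kb]]] : exists (k : nat -> nat) (l : R), {homo k : m n / (m < n)%N} /\
    cIm (u (k1 (k n))) @[n --> \oo] --> l.
  apply: (@bounded_subsequence (fun n => cIm (u (k1 n)))) => n.
  exact: le_trans (abs_Im_le _) (u1 _).
exists (fun n => k1 (k2 n)), (a +i* b); split.
  by move=> m n mn; apply: ik1; exact: ik2.
have ka2 := @cvg_subsequence _ (fun n => cRe (u (k1 n))) a k2 ik2 ka.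
apply/cvg_normcP => e e0; have e2 : 0 < e / 2 by rewrite divr_gt0.
move/cvgrPdist_lt : ka2 => /(_ _ e2) h1.
move/cvgrPdist_lt : kb => /(_ _ e2) h2.
apply: filterS2 h1 h2 => n h1 h2.
apply: (le_lt_trans (normc_le_ReIm _)).
rewrite ReD ImD ReN ImN distrC [X in _ + X]distrC.
by rewrite [e]splitr ltrD.
Qed.

Lemma common_subsequence (x : nat -> nat -> C) m : (forall j n, normc (x j n) <= 1) ->
  exists (k : nat -> nat) (b : nat -> C), {homo k : i j / (i < j)%N} /\
    forall j, (j < m)%N -> x j (k n) @[n --> \oo] --> b j.
Proof.
move=> x1; elim: m => [|m [k [b [ik kb]]]]; first by exists id, (fun=> 0); split => [i j|j]; rewrite ?ltn0.
have [k' [l [ik' kl]]] := @bounded_subsequenceC (fun n => x m (k n)) (fun n => x1 m (k n)).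
exists (fun n => k (k' n)), (fun j => if j == m then l else b j); split.
  by move=> i j ij; apply: ik; exact: ik'.
move=> j; rewrite ltnS leq_eqVlt; have [->|jm] := eqVneq j m; first by [].
by move=> /= jm'; exact: (@cvg_subsequence _ (fun n => x j (k n)) _ k' ik' (kb j jm')).
Qed.

Section finite_rank.
Variables (psi : C -> C) (N : nat).
Hypotheses (pa : analytic_on disc psi) (pd : forall z, disc z -> disc (psi z)).

(** The composition operator after truncation of the Taylor series: its range is
    spanned by the powers of psi of degree less than N. *)
Definition finite_rank_part f : C -> C := ext (fun z => psum f N (psi z)).

Let poly (b : nat -> C) z : C := \sum_(0 <= k < N) b k * psi z ^+ k.

Let poly_H2 b (d : R) : \sum_(0 <= k < N) normc (b k) <= d ->
  H2 (poly b) /\ hsq (poly b) <= d ^+ 2.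
Proof.
move=> bd.
have d0 : 0 <= d by apply: le_trans bd; apply: sumr_ge0 => k _; exact: normc_ge0.
have ap : analytic_on disc (poly b).
  move=> z zd; rewrite /poly; elim: N => [|n IH].
    by under eq_fun do rewrite big_nil; exact: derivable_const.
  under eq_fun do rewrite big_nat_recr//=.
  apply: (derivable_addc IH); apply: (derivable_mulc (derivable_const (b n) z)).
  exact: (@derivable_chain R psi (fun x => x ^+ n) z (pa zd) (@derivable_pow R n (psi z))).
have bp z : disc z -> normc (poly b z) <= d.
  move=> zd; apply: (le_trans (normc_sum _ _)); apply: le_trans bd; apply: ler_sum => k _.
  rewrite normcM normcX ler_piMr ?normc_ge0// exprn_ile1 ?normc_ge0//.
  exact/ltW/pd.
exact: (@H2_bounded R (poly b) d ap d0 bp).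
Qed.

Let psum_H2 f : H2 (fun z => psum f N (psi z)).
Proof. exact: (poly_H2 (lexx _)).1. Qed.

(** The first N Taylor coefficients of functions in the unit ball are bounded by 1:
    a subsequence along which they converge makes the images converge. *)
Lemma finite_rank_compact : compact_operator finite_rank_part.
Proof.
split.
- by move=> f _; exact: (H2_hardy2 (psum_H2 f)).
- move=> c f g [fa _ _] [ga _ _]; apply/funext => z; rewrite /finite_rank_part.
  have [zd|zd] := pselect (disc z); last by rewrite !ext_out// mulr0 addr0.
  rewrite !extE// /psum mulr_sumr -big_split; apply: eq_bigr => k _.
  change (coef (fun z => c * f z + g z) k * psi z ^+ k =
    c * (coef f k * psi z ^+ k) + coef g k * psi z ^+ k).
  by rewrite (@coef_lin R c f g k fa ga) mulrDl mulrA.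
- move=> u uB.
  have uc j n : normc (coef (u n) j) <= 1.
    have [uh u1] := uB n; have uH := hardy2_H2 uh.
    rewrite (@hardy2_norm_le R (u n) 1 uH ler01) expr1n in u1.
    rewrite -(@expr_le1 _ 2)// ?normc_ge0//; apply: le_trans u1.
    apply: le_trans (hsq_ge j.+1 uH).
    by rewrite /coef_sq big_nat_recr//= lerDr; exact: coef_sq_ge0.
  have [k [b [ik kb]]] := @common_subsequence (fun j n => coef (u n) j) N uc.
  exists k, (ext (poly b)); split; [exact: ik|exact: (H2_hardy2 (poly_H2 (lexx _)).1)|].
  pose w n z := finite_rank_part (u (k n)) z - ext (poly b) z.
  pose d n := \sum_(0 <= j < N) normc (coef (u (k n)) j - b j).
  have wE n z : disc z -> poly (fun j => coef (u (k n)) j - b j) z = w n z.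
    move=> zd; rewrite /w /finite_rank_part !extE// /poly /psum -sumrB.
    by apply: eq_bigr => j _; rewrite mulrBl.
  have wH n : H2 (w n) /\ hsq (w n) <= d n ^+ 2.
    have [h1 h2] := @poly_H2 (fun j => coef (u (k n)) j - b j) (d n) (lexx _).
    split; [exact: (eq_H2 (@wE n) h1)|rewrite -(eq_hsq (@wE n)); exact: h2].
  have d0 n : 0 <= d n by apply: sumr_ge0 => j _; exact: normc_ge0.
  have cd : d n @[n --> \oo] --> 0.
    have -> : 0 = \sum_(0 <= j < N) 0 :> R by rewrite big1.
    rewrite /d; elim: N kb => [|m IH] kb.
      by under eq_fun do rewrite big_nil; rewrite big_nil; exact: cvg_cst.
    under eq_fun do rewrite big_nat_recr//=; rewrite big_nat_recr//=.
    apply: cvgD; first by apply: IH => j jm; exact: kb (ltnW jm).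
    have /cvg_normcP h := kb m (ltnSn m).
    apply/cvgrPdist_lt => e e0; apply: filterS (h e e0) => n hn.
    by rewrite sub0r normrN ger0_norm ?normc_ge0.
  change (hardy2_norm (w n) @[n --> \oo] --> 0%E).
  under eq_fun do rewrite (hardy2_normE (wH _).1).
  apply: cvg_EFin; first exact: nearW.
  apply: (@squeeze_cvgr _ _ _ _ (fun=> 0) d) => //; last exact: cvg_cst.
  apply: nearW => n; rewrite /= sqrtr_ge0/= -(ger0_norm (d0 n)) -sqrtr_sqr.
  by apply: ler_wsqrtr; exact: (wH n).2.
Qed.

End finite_rank.

Lemma dilation_parameter (p e s0 : R) : 0 < p -> 0 < e -> s0 < 1 ->
  exists s, [/\ 0 <= s, s < 1, s0 < s & 4 * (1 - s) / p <= e].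
Proof.
move=> p0 e0 s01.
have ep : 0 < e * p by rewrite mulr_gt0.
pose m := Num.max (Num.max 0 s0) (1 - e * p / 4).
have m1 : m < 1 by rewrite !gt_max ltr01 s01/= ltrBlDr ltrDl divr_gt0.
have m0 : 0 <= m by rewrite !le_max lexx.
have ms : s0 <= m by rewrite !le_max lexx orbT.
have me : 1 - e * p / 4 <= m by rewrite le_max lexx orbT.
exists ((m + 1) / 2); split; [lra|lra|lra|].
by rewrite ler_pdivrMr//; move: (e * p) me ep => q me ep; lra.
Qed.

(** The difference between C_psi and its truncation is C_psi applied to the tails;
    s is first chosen so near 1 that the Poisson kernels of psi 0 and
    s * psi 0 differ by at most e / 2, then the degree of truncation. *)
Lemma essential_upper psi L s0 : analytic_on disc psi ->
  (forall z, disc z -> disc (psi z)) -> s0 < 1 ->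
  (forall a, s0 < normc a -> normc a < 1 -> hsq (fun z => ker a (psi z)) <= L) ->
  forall e, 0 < e -> exists K, compact_operator K /\
    forall f, hardy2 f -> hsq f <= 1 ->
      H2 (fun z => composition_operator psi f z - K f z) /\
      hsq (fun z => composition_operator psi f z - K f z) <= L + e.
Proof.
move=> pa pd s01 kL e e0; have e2 : 0 < e / 2 by rewrite divr_gt0.
have d0 : disc (0 : C) by rewrite /disc /mkset normc0.
have wd : disc (psi 0) := pd 0 d0.
have p0 : 0 < (1 - normc (psi 0)) ^+ 4 by rewrite exprn_gt0// subr_gt0.
have [s [s0' s1 ss0 se]] := dilation_parameter p0 e2 s01.
have kerL zeta : normc zeta = 1 -> hsq (fun z => ker (s%:C * zeta) (psi z)) <= L.
  move=> z1; have nE : normc (s%:C * zeta) = s by rewrite normcM z1 mulr1 normc_real.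
  by apply: kL; rewrite nE.
have pe zeta : normc zeta = 1 ->
    poisson (psi 0) zeta - poisson (s%:C * psi 0) zeta <= e / 2.
  move=> z1; apply: le_trans se; exact: poisson_dilate s0' (ltW s1) z1 wd.
have [n hn] := tail_composition pa pd s0' s1 kerL pe e2.
exists (finite_rank_part psi n); split; first exact: finite_rank_compact.
move=> f fh f1; have [h1 h2] := hn f (hardy2_H2 fh) f1.
have E z : disc z -> tail f n (psi z) =
    composition_operator psi f z - finite_rank_part psi n f z.
  by move=> zd; rewrite /finite_rank_part extE// /composition_operator patchE mem_set.
split; first exact: (eq_H2 E h1).
rewrite -(eq_hsq E); apply: (le_trans h2); rewrite le_eqVlt; apply/orP; left; apply/eqP.
by rewrite addrCA -splitr.
Qed.

End upper_bound.

(** * The essential norm *)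
Section essential_norm.
Variable R : realType.
Local Notation C := R[i].
Variables (psi : C -> C).
Hypotheses (pa : analytic_on disc psi) (pd : forall z, disc z -> disc (psi z)).
Let T := composition_operator psi.
Let F (a : C) := circle_integral (fun zeta : C =>
  ((1 - normc a ^+ 2) / normc (1 - conjc a * boundary psi zeta) ^+ 2)%:E).

Let FE a : disc a -> F a = (hsq (fun z => ker a (psi z)))%:E.
Proof. by move=> ad; exact: kernel_integral. Qed.

Let near_circle (P : C -> Prop) : disc_to_circle [set a | P a] ->
  exists r : R, r < 1 /\ forall a, r < normc a -> normc a < 1 -> P a.
Proof.
rewrite /disc_to_circle /= => -[d /= d0 hd].
exists (1 - d); split; first by rewrite ltrBlDr ltrDl.
move=> a da a1; apply: (hd (normc a)) => //=.
by rewrite ger0_norm ?subr_ge0 ?ltW// ltrBlDr addrC -ltrBlDr.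
Qed.

Let circle_near (P : C -> Prop) (r : R) : r < 1 ->
  (forall a, r < normc a -> normc a < 1 -> P a) -> disc_to_circle [set a | P a].
Proof.
move=> r1 hP; exists (1 - r) => /=; first by rewrite subr_gt0.
move=> x /= xr x1 a ax; apply: hP; rewrite ax//.
by move: xr; rewrite ger0_norm ?subr_ge0 ?ltW// ltrD2l ltrN2.
Qed.

Let ess := essential_norm T.

Lemma operator_norm_ge0 K : compact_operator K ->
  (0 <= operator_norm (fun f z => (T f z - K f z)%R))%E.
Proof.
move=> _; apply: le_ereal_sup_tmp.
exists (hardy2_norm (fun z => T (fun=> 0) z - K (fun=> 0) z)); last exact: sqrte_ge0.
exists (fun=> 0); last exact: erefl.
split; first exact: hardy2_zero.
rewrite (@hardy2_norm_le R _ 1 (hardy2_H2 (hardy2_zero R)) ler01) expr1n.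
by apply: hsq_le => n; rewrite /coef_sq big1// => k _; rewrite coef0 normc0 expr0n.
Qed.

Lemma essential_norm_ge0 : (0 <= ess)%E.
Proof. by apply: le_ereal_inf_tmp => _ [K Kc <-]; exact: operator_norm_ge0. Qed.

Lemma limsup_le_essential (X : R) : (ess < X%:E)%E -> forall e, 0 < e ->
  (limf_esup F disc_to_circle <= ((X + e) ^+ 2)%:E)%E.
Proof.
move=> eX e e0.
have X0 : 0 <= X by rewrite -lee_fin; exact: ltW (le_lt_trans essential_norm_ge0 eX).
have [_ [K Kc <-] KX] := ereal_inf_lt eX.
have [r [r1 hr]] := @essential_lower R K Kc psi X pa pd X0 (ltW KX) e e0.
pose A := [set a : C | disc a /\ r < normc a].
apply: (@le_trans _ _ (ereal_sup (F @` A))).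
  apply: ereal_inf_lbound; exists A => //.
  by apply: (@circle_near (fun a => disc a /\ r < normc a) r r1).
by apply: ge_ereal_sup => _ [a [ad ra] <-]; rewrite FE// lee_fin; exact: hr.
Qed.

Lemma essential_le_limsup (L : R) : (limf_esup F disc_to_circle < L%:E)%E ->
  0 <= L /\ forall e, 0 < e -> (ess ^+ 2 <= (L + e)%:E)%E.
Proof.
move=> FL; have [_ [A /near_circle[r [r1 hr]] <-] AL] := ereal_inf_lt FL.
have kL a : r < normc a -> normc a < 1 -> hsq (fun z => ker a (psi z)) <= L.
  move=> ra a1; rewrite -lee_fin -FE//; apply: le_trans (ltW AL).
  by apply: ereal_sup_ubound; exists a => //; exact: hr.
have L0 : 0 <= L.
  pose m : R := Num.max r 0; pose x := (m + 1) / 2.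
  have m1 : m < 1 by rewrite gt_max r1 ltr01.
  have mr : r <= m by rewrite le_max lexx.
  have m0 : 0 <= m by rewrite le_max lexx orbT.
  have x0 : 0 <= x by rewrite /x; lra.
  have x1 : x < 1 by rewrite /x; lra.
  have rx : r < x by rewrite /x; lra.
  have nx : normc x%:C = x by rewrite normc_real.
  have xd : disc x%:C by rewrite /disc /mkset nx.
  apply: (@le_trans _ _ (hsq (fun z => ker x%:C (psi z)))); last by apply: kL; rewrite nx.
  by apply: H2_hsq_ge0; exact: H2_ker_comp.
split => // e e0.
have [K [Kc hK]] := @essential_upper R psi L r pa pd r1 kL e e0.
have Le0 : 0 <= L + e by rewrite addr_ge0// ltW.
have s0 : 0 <= Num.sqrt (L + e) := sqrtr_ge0 _.
have h : (ess <= (Num.sqrt (L + e))%:E)%E.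
  apply: (@le_trans _ _ (operator_norm (fun f z => (T f z - K f z)%R))).
    by apply: ereal_inf_lbound; exists K.
  apply: ge_ereal_sup => _ [f [fh f1] <-].
  rewrite (@hardy2_norm_le R f 1 (hardy2_H2 fh) ler01) expr1n in f1.
  have [h1 h2] := hK f fh f1.
  by rewrite (@hardy2_norm_le R _ _ h1 s0) sqr_sqrtr.
by rewrite -(sqr_sqrtr Le0) EFin_expe lee_sqr ?essential_norm_ge0// lee_fin.
Qed.

Lemma limsup_eq_essential : limf_esup F disc_to_circle = (ess ^+ 2)%E.
Proof.
apply/eqP; rewrite eq_le; apply/andP; split.
- have := essential_norm_ge0.
  case E : ess => [x| |] //; last by move=> _; rewrite expe2 mulyy leey.
  rewrite lee_fin => x0; rewrite -EFin_expe; apply/lee_addgt0Pr => e e0.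
  pose d := Num.min 1 (e / (4 * (x + 1))).
  have d4 : 0 < 4 * (x + 1) by rewrite mulr_gt0// ltr_wpDl.
  have d0 : 0 < d by rewrite lt_min ltr01 divr_gt0.
  have xd : (ess < (x + d)%:E)%E by rewrite E lte_fin ltrDl.
  apply: (le_trans (limsup_le_essential xd d0)); rewrite -EFinD lee_fin.
  have d1 : d <= 1 by rewrite ge_min lexx.
  have d2 : d * (4 * (x + 1)) <= e by rewrite -ler_pdivlMr// ge_min lexx orbT.
  by rewrite expr2 [x ^+ 2]expr2; nra.
- have : (0 <= ess ^+ 2)%E by exact: sqre_ge0.
  case E : (limf_esup F disc_to_circle) => [l| |]; last 2 first.
  + by move=> _; rewrite leey.
  + have FL : (limf_esup F disc_to_circle < (-1)%:E)%E by rewrite E ltNyr.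
    by have [] := essential_le_limsup FL; rewrite ler0N1.
  move=> _; apply/lee_addgt0Pr => e e0; have e2 : 0 < e / 2 by rewrite divr_gt0.
  have FL : (limf_esup F disc_to_circle < (l + e / 2)%:E)%E by rewrite E lte_fin ltrDl.
  have [_ h] := essential_le_limsup FL.
  by apply: (le_trans (h _ e2)); rewrite -addrA -splitr.
Qed.

End essential_norm.

Unset Implicit Arguments. Set Strict Implicit. Set Printing Implicit Defensive.
Theorem corollary2p3 (R : realType) (psi : R[i] -> R[i])
    (psi_analytic : analytic_on disc psi)
    (psi_disc : forall z : R[i], disc z -> disc (psi z)) :
  limf_esup
    (fun a : R[i] => circle_integral (fun zeta : R[i] =>
       ((1 - normc a ^+ 2)
        / normc (1 - a^* * boundary psi zeta) ^+ 2)%:E))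
    disc_to_circle
  = (essential_norm (composition_operator psi) ^+ 2)%E.
Proof.
exact: (limsup_eq_essential psi_analytic psi_disc).
Qed.
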